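(* Let $\mu$ be a positive Borel measure on the unit circle $\mathbb{T}$, singular with respect to Lebesgue measure, and let $S_\mu$ be the associated singular inner function. If $S_\mu$ is cyclic in $\ell^p_A$ for some $p>2$, then $\mu(E)=0$ for every Beurling-Carleson set $E\subset\mathbb{T}$.
   Context: $\mathbb{D}$ is the open unit disc. The singular inner function associated with $\mu$ is $$S_\mu(z)=\exp\left\{-\int_0^{2\pi}\frac{e^{i\theta}+z}{e^{i\theta}-z}\,d\mu(\theta)\right\},\qquad z\in\mathbb{D}.$$ $\ell^p_A$ is the space of analytic functions $f(z)=\sum_{k\ge0}\hat f(k)z^k$ on $\mathbb{D}$ with $\|f\|_p^p=\sum_{k\ge0}|\hat f(k)|^p<\infty$. A function $f\in\ell^p_A$ is cyclic in $\ell^p_A$ if there is a sequence of polynomials $(p_n)$ such that $\|p_nf-1\|_p\to0$. A closed set $E\subset\mathbb{T}$ is a Beurling-Carleson set if it has zero Lebesgue measure and $\sum_n|I_n|\log\frac{1}{|I_n|}<\infty$, where $\mathbb{T}\setminus E$ is the disjoint union of the open intervals (arcs) $(I_n)_n$ and $|\cdot|$ denotes Lebesgue measure on $\mathbb{T}$. *)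

(* Defs.v *)
From HB Require Import structures.
From mathcomp Require Import all_boot all_order all_algebra.
From mathcomp Require Export complex.
From mathcomp Require Import all_classical all_reals all_analysis.

Set Implicit Arguments.
Unset Strict Implicit.
Unset Printing Implicit Defensive.

Import Order.TTheory GRing.Theory Num.Theory.
Import numFieldNormedType.Exports.

Local Open Scope classical_set_scope.
Local Open Scope complex_scope.
Local Open Scope ring_scope.

(* R[i] itself carries no topology in the library; R[i]^o is the same type with
   the topology of the complex modulus, so it is used wherever limits or open
   sets are involved. *)

Section Circle.
Variable R : realType.

Definition unit_circle : set R[i]^o := [set z | `|z| = 1].

Definition circle : Type := unit_circle.

Fact cis_subproof (t : R) : ((cos t +i* sin t)%C : R[i]^o) \in unit_circle.
Proof.
apply/mem_set; rewrite /unit_circle /=.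
by rewrite normc_def /= cos2Dsin2 sqrtr1.
Qed.

(* t |-> e^{it} *)
Definition cis (t : R) : circle :=
  @exist _ (fun z => z \in unit_circle) _ (cis_subproof t).

(* The topology is the one induced by R[i]; the measurable sets are the Borel
   sets of that topology. *)
HB.instance Definition _ := Topological.copy circle (set_type unit_circle).
HB.instance Definition _ := isPointed.Build circle (cis 0).
HB.instance Definition _ :=
  Measurable.copy circle (g_sigma_algebraType (@open circle)).

(* Arc length, of total mass 2 * pi. *)
Definition circle_lebesgue : set circle -> \bar R :=
  pushforward (mrestr lebesgue_measure
    (measurable_itv `[(0 : R), 2 * pi[%R : measurable `[(0 : R), 2 * pi[)) cis.

Definition singular_measure (mu : set circle -> \bar R) : Prop :=
  exists A : set circle,
    [/\ measurable A, circle_lebesgue A = 0%E & mu (~` A) = 0%E].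

(* a and b are arbitrary, so the empty set and the whole circle are arcs; with
   the whole circle the empty set is a Beurling-Carleson set, and with the
   empty set a family indexed by nat may stand for a finite one. *)
Definition open_arc (I : set circle) : Prop :=
  exists a b : R, I = cis @` `]a, b[.

Definition arc_length (I : set circle) : R := fine (circle_lebesgue I).

(* At most six of the disjoint arcs are longer than 1, so all but finitely many
   terms are nonnegative and convergence means that the sum is finite. *)
Definition Beurling_Carleson (E : set circle) : Prop :=
  [/\ closed E,
      circle_lebesgue E = 0%E &
      exists I : nat -> set circle,
        [/\ forall n, open_arc (I n),
            trivIset setT I,
            ~` E = \bigcup_n I n &
            cvgn (series (fun n =>
              arc_length (I n) * ln (1 / arc_length (I n))))]].

End Circle.

Section SingularInner.
Variable R : realType.

Definition expC (z : R[i]) : R[i] :=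
  (expR (complex.Re z) * cos (complex.Im z)
   +i* (expR (complex.Re z) * sin (complex.Im z)))%C.

Definition cintegral (mu : {measure set (circle R) -> \bar R})
    (f : circle R -> R[i]) : R[i] :=
  ((\int[mu]_x complex.Re (f x))%R +i* (\int[mu]_x complex.Im (f x))%R)%C.

(* The variable zeta of the integral over the circle is e^{i theta}. *)
Definition singular_inner (mu : {measure set (circle R) -> \bar R})
    (z : R[i]) : R[i] :=
  expC (- cintegral mu (fun zeta => (sval zeta + z) / (sval zeta - z))).

End SingularInner.

Section LpA.
Variable R : realType.

(* f z = \sum_k (a k) z^k on the open unit disc; the values of f outside the
   disc are irrelevant. *)
Definition power_series_on_disc (f : R[i] -> R[i]) (a : nat -> R[i]) : Prop :=
  forall z : R[i], `|z| < 1 ->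
    (series (fun k => a k * z ^+ k) : nat -> R[i]^o) @ \oo --> (f z : R[i]^o).

Definition analytic_on_disc (f : R[i] -> R[i]) : Prop :=
  exists a, power_series_on_disc f a.

(* The coefficient sequence of a function analytic on the disc is unique; the
   value 0 is a default for the other functions. *)
Definition taylor_coef (f : R[i] -> R[i]) : nat -> R[i] :=
  xget (fun=> 0) [set a | power_series_on_disc f a].

Definition lp_norm (p : R) (f : R[i] -> R[i]) : \bar R :=
  ((\sum_(0 <= k <oo) (Normc.normc (taylor_coef f k) `^ p)%:E) `^ (p^-1)%R)%E.

Definition lpA (p : R) (f : R[i] -> R[i]) : Prop :=
  analytic_on_disc f /\ (lp_norm p f < +oo)%E.

Definition cyclic_lpA (p : R) (f : R[i] -> R[i]) : Prop :=
  lpA p f /\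
  exists P : nat -> {poly R[i]},
    lp_norm p (fun z => (P n).[z] * f z - 1) @[n --> \oo] --> 0%E.

End LpA.

(* Main.v *)
Require Import Defs.
From mathcomp Require Import all_boot all_order all_algebra.
From mathcomp Require Import all_classical all_reals all_analysis measurable_realfun.
From mathcomp Require Import ring lra zify.

(** Why the theorem is true.  Let [theta] be the singular inner function of the
    restriction of [mu] to [E] and [sigma] that of its restriction to the
    complement, so that [S_mu = theta * sigma].  We test functions [f] on the
    disc by pairing them, on the circle of radius [r < 1], with
    [e^{i (m + 1) t} F conj(theta)], where [F] is a bounded outer function that
    vanishes on [E].

    The pairing is continuous on [l^p_A], uniformly in [r].  [theta'] is
    [O(dist^-2)], where [dist] is the distance to [E], and [F] vanishes on [E]
    to the second order ([outer_small]); hence [F conj(theta)] is Lipschitz on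
    the circles, uniformly in [r] ([inner_product_lipschitz]), and its Fourier
    coefficients are [O(1 / k)] ([fourier_lipschitz], [Phi_fourier]).  The
    sequence [1 / k] lies in [l^q] for every [q > 1], so Hoelder's inequality
    applies ([lp_harmonic_small], [power_series_pairing]).

    The pairing with [f = P S_mu] tends to 0 as [r] tends to 1, for every
    polynomial [P].  Indeed [f F conj(theta) = P sigma F |theta|^2], where the
    first three factors are analytic, hence orthogonal to positive frequencies,
    and [|theta|] tends to 1 boundedly and almost everywhere because [E] is
    closed and null ([gap_small]).  If [P_n S_mu] tends to 1 in [l^p_A], then
    the pairing with the function 1 tends to 0 as well ([cyclic_annihilates]).

    The factor [F] can be removed.  Carleson's condition gives not just one such
    [F] but a sequence [F_J] with the same properties that tends to 1 in mean,
    uniformly on circles ([outer_near1]).  In the limit all Fourier coefficients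
    of [conj(theta)] of positive index vanish, so the mean square of [theta] on
    each circle is [|theta(0)|^2 = exp(- 2 mu(E))] ([inner_coef_eq0],
    [inner_mean_square]).  It also tends to 1, and [mu(E) = 0].

    The outer functions.  [F_J] is the exponential of minus the Herglotz
    integral of a multiple of the sum over [j >= J] of Lebesgue measure on the
    collars [{dist < 2^-j}], a dyadic form of the weight [log(1 / dist)].  This
    measure is finite: a complementary arc of length [L] meets the [j]-th collar
    in a set of measure at most [min(L, C 2^-j)] ([collar_arc_measure]), the sum
    over [j] is [O(L + L log(1 / L))] ([sum_min_geometric_le]), and Carleson's
    condition allows to sum over the arcs ([Carleson_sum_bounded]).  The poles of
    the Herglotz kernels are moved off the circle by a quarter of their distance
    to [E], so that they stay away from each point [z] of the disc by a fixed
    fraction of [dist z] ([dist_outer_node]); this bounds the derivative of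
    [F_J] together with its size.

    Analytic functions enter only as uniform limits of polynomials on closed
    discs ([poly_approx]).  That is enough for Cauchy's theorem and for the mean
    value property on circles ([circint_expi_approx], [circint_mean]). *)

Set Implicit Arguments.
Unset Strict Implicit.
Unset Printing Implicit Defensive.
Import Order.TTheory GRing.Theory Num.Theory.
Import numFieldNormedType.Exports.
Local Open Scope classical_set_scope.
Local Open Scope ring_scope.

(** * Complex modulus *)

Section ComplexBasics.
Variable R : realType.
Implicit Types z w : R[i].
Local Notation C := R[i].
Local Notation nc := (@Normc.normc R).
Local Notation Re := (@complex.Re R).
Local Notation Im := (@complex.Im R).

Lemma normc_abs z : `|z| = (nc z)%:C%C.
Proof. by []. Qed.

Lemma ncE z : nc z = Num.sqrt (Re z ^+ 2 + Im z ^+ 2).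
Proof. by case: z. Qed.

Lemma nc_ge0 z : 0 <= nc z.
Proof. by rewrite ncE sqrtr_ge0. Qed.

Lemma nc_sqr z : nc z ^+ 2 = Re z ^+ 2 + Im z ^+ 2.
Proof. by rewrite ncE sqr_sqrtr// addr_ge0 ?sqr_ge0. Qed.

Lemma ncX z n : nc (z ^+ n) = nc z ^+ n.
Proof.
elim: n => [|n IH]; first by rewrite !expr0; exact: Normc.normc1.
by rewrite !exprS Normc.normcM IH.
Qed.

Lemma ncB z w : nc (z - w) = nc (w - z).
Proof. by rewrite -[LHS]normcN opprB. Qed.

Lemma ncD z w : nc (z + w) <= nc z + nc w.
Proof. exact: le_normcD. Qed.

Lemma ncBD z w : nc (z - w) <= nc z + nc w.
Proof. by rewrite (le_trans (ncD _ _))// normcN. Qed.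

Lemma nc_tri z w u : nc (z - u) <= nc (z - w) + nc (w - u).
Proof. by rewrite (le_trans _ (ncD _ _))// addrA subrK. Qed.

Lemma nc_rev z w : nc z - nc w <= nc (z - w).
Proof. by rewrite lerBlDr (le_trans _ (ncD _ _))// subrK. Qed.

Lemma nc_sum (I : Type) (r : seq I) (P : pred I) (F : I -> C) :
  nc (\sum_(i <- r | P i) F i) <= \sum_(i <- r | P i) nc (F i).
Proof.
elim/big_rec2: _ => [|i x y _ le]; first by rewrite Normc.normc0.
by rewrite (le_trans (ncD _ _))// lerD2l.
Qed.

Lemma ler_Re z : `|Re z| <= nc z.
Proof.
by rewrite -ler_sqr ?nnegrE ?nc_ge0// nc_sqr real_normK ?num_real// lerDl sqr_ge0.
Qed.

Lemma ler_Im z : `|Im z| <= nc z.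
Proof.
by rewrite -ler_sqr ?nnegrE ?nc_ge0// nc_sqr real_normK ?num_real// lerDr sqr_ge0.
Qed.

Lemma nc_le z : nc z <= `|Re z| + `|Im z|.
Proof.
rewrite -ler_sqr ?nnegrE ?nc_ge0 ?addr_ge0// nc_sqr sqrrD !real_normK ?num_real//.
by rewrite lerD2r lerDl mulrn_wge0// mulr_ge0.
Qed.

Lemma nc_real (x : R) : nc x%:C%C = `|x|.
Proof. by rewrite ncE /= expr0n/= addr0 sqrtr_sqr. Qed.

Lemma nc_conj z : nc z^*%C = nc z.
Proof. by rewrite !ncE; case: z => a b /=; rewrite sqrrN. Qed.

Lemma cReD z w : Re (z + w) = Re z + Re w. Proof. by case: z; case: w. Qed.
Lemma cImD z w : Im (z + w) = Im z + Im w. Proof. by case: z; case: w. Qed.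
Lemma cReN z : Re (- z) = - Re z. Proof. by case: z. Qed.
Lemma cImN z : Im (- z) = - Im z. Proof. by case: z. Qed.
Lemma cReM z w : Re (z * w) = Re z * Re w - Im z * Im w.
Proof. by case: z; case: w. Qed.
Lemma cImM z w : Im (z * w) = Re z * Im w + Im z * Re w.
Proof. by case: z; case: w. Qed.
Lemma cRe_conj z : Re z^*%C = Re z. Proof. by case: z. Qed.
Lemma cIm_conj z : Im z^*%C = - Im z. Proof. by case: z. Qed.

Lemma cReMr z (x : R) : Re (z * x%:C%C) = Re z * x.
Proof. by case: z => a b /=; rewrite mulr0 subr0. Qed.

Lemma cconjM z w : (z * w)^*%C = z^*%C * w^*%C.
Proof. exact: rmorphM. Qed.

Lemma real_complexB1 (x : R) : (x - 1)%:C%C = x%:C%C - 1.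
Proof. by rewrite rmorphB rmorph1. Qed.

Lemma real_complex1B (x : R) : (1 - x)%:C%C = 1 - x%:C%C.
Proof. by rewrite rmorphB rmorph1. Qed.

Lemma nc_nat n : nc (n%:R : C) = n%:R.
Proof. by rewrite -(rmorph_nat (real_complex R)) nc_real normr_nat. Qed.

Lemma complex_eq z w : Re z = Re w -> Im z = Im w -> z = w.
Proof. by case: z w => a b [c d] /= -> ->. Qed.

Lemma mulr_conj z : z * z^*%C = (nc z ^+ 2)%:C%C.
Proof.
apply: complex_eq; rewrite /= ?nc_sqr ?cReM ?cImM cRe_conj cIm_conj /=; ring.
Qed.

Lemma nc_eq0 z : (nc z == 0) = (z == 0).
Proof.
apply/eqP/eqP => [/Normc.eq0_normc//|->]; exact: Normc.normc0.
Qed.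

Lemma ncXB z w n (M : R) : nc z <= M -> nc w <= M ->
  nc (z ^+ n - w ^+ n) <= n%:R * nc (z - w) * M ^+ n.-1.
Proof.
move=> zM wM; have M0 : 0 <= M := le_trans (nc_ge0 _) zM.
rewrite subrXX Normc.normcM (mulrC n%:R) -mulrA ler_wpM2l ?nc_ge0//.
rewrite (le_trans (nc_sum _ _ _))//.
rewrite (@le_trans _ _ (\sum_(i < n) M ^+ n.-1))//; last first.
  by rewrite sumr_const card_ord mulr_natl.
apply: ler_sum => i _; rewrite Normc.normcM !ncX.
have ni : n.-1 = ((n.-1 - i) + i)%N.
  by rewrite subnK//; case: n i => [[]//|n] i /=; rewrite -ltnS ltn_ord.
rewrite [X in _ <= M ^+ X]ni exprD.
by apply: ler_pM; rewrite ?exprn_ge0 ?nc_ge0// lerXn2r ?nnegrE ?nc_ge0.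
Qed.

End ComplexBasics.

(** * Elementary estimates for sine, cosine and the exponential *)

Section Trig.
Variable R : realType.
Implicit Types x y s t : R.

Lemma sin_lip x y : `|sin x - sin y| <= `|x - y|.
Proof.
wlog xy : x y / y <= x => [H|].
  by case: (leP y x) => [/H//|/ltW /H]; rewrite distrC (distrC y).
have [|c _ ->] := MVT_segment xy (fun z _ => is_derive_sin z); last first.
- by rewrite normrM ler_piMl// cos_max.
- exact/continuous_subspaceT/continuous_sin.
Qed.

Lemma cos_lip x y : `|cos x - cos y| <= `|x - y|.
Proof.
by rewrite -!sinDpihalf (le_trans (sin_lip _ _))// opprD addrACA subrr addr0.
Qed.

Lemma norm_sin_le x : `|sin x| <= `|x|.
Proof. by have := sin_lip x 0; rewrite sin0 !subr0. Qed.

Lemma cos_half x : cos x = 1 - 2 * sin (x / 2) ^+ 2.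
Proof.
have {1}-> : x = (x / 2) *+ 2 by rewrite -mulr_natr divfK.
by rewrite cos_mulr2n cos2sin2; ring.
Qed.

Lemma cos_quad x : `|cos x - 1| <= x ^+ 2 / 2.
Proof.
rewrite cos_half addrAC subrr add0r normrN normrM (gtr0_norm (ltr0n _ 2))//.
rewrite normrX.
have h : `|sin (x / 2)| ^+ 2 <= `|x / 2| ^+ 2.
  by rewrite lerXn2r ?nnegrE ?normr_ge0// norm_sin_le.
rewrite [leRHS]real_normK ?num_real// in h.
by have e : (x / 2) ^+ 2 = x ^+ 2 / 4; [field|rewrite e in h; lra].
Qed.

Lemma sin_quad x : `|x| <= 1 -> `|sin x - x| <= x ^+ 2.
Proof.
wlog x0 : x / 0 <= x => [H x1|x1].
  case: (leP 0 x) => [/H ->//|/ltW x0].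
  have := H (- x); rewrite oppr_ge0 normrN sinN sqrrN => /(_ x0 x1).
  by rewrite -opprD normrN.
have [|c] := MVT_segment x0 (fun z _ => is_derive_sin z).
  exact/continuous_subspaceT/continuous_sin.
rewrite in_itv/= => /andP[c0 cx]; rewrite sin0 !subr0 => ->.
rewrite (_ : cos c * x - x = (cos c - 1) * x); last by ring.
rewrite normrM (ger0_norm x0) expr2 ler_wpM2r// (le_trans (cos_quad _))//.
by move: x1; rewrite ger0_norm// => x1; nra.
Qed.

Lemma expR_quad x : `|x| <= 1 / 2 -> `|expR x - 1 - x| <= 2 * x ^+ 2.
Proof.
rewrite ler_norml => /andP[x1 x2].
have h1 := expR_ge1Dx x; have h2 := expR_ge1Dx (- x).
have e0 := expR_gt0 x; have := expRxMexpNx_1 x.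
set e := expR x in h1 e0 *; set f := expR (- x) in h2 * => ef.
rewrite ger0_norm; last lra.
have h3 : e * (1 - x) <= 1 by have := ler_wpM2l (ltW e0) h2; rewrite ef.
rewrite -(ler_pM2r (_ : 0 < 1 - x)); last lra.
apply: (@le_trans _ _ (x ^+ 2)); first by nra.
nra.
Qed.

Lemma expR_lip x y M : expR x <= M -> expR y <= M ->
  `|expR x - expR y| <= M * `|x - y|.
Proof.
wlog xy : x y / x <= y => [H|].
  by case: (leP x y) => [/H//|/ltW /H h a b]; rewrite distrC (distrC x) h.
move=> _ yM; rewrite ler0_norm ?subr_le0 ?ler_expR// ler0_norm ?subr_le0// !opprB.
have := expR_ge1Dx (x - y); rewrite expRB => h.
have e0 := expR_gt0 y.
have : (1 + (x - y)) * expR y <= expR x by rewrite -ler_pdivlMr.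
move=> h2; apply: (@le_trans _ _ (expR y * (y - x))); first lra.
by rewrite ler_wpM2r// subr_ge0.
Qed.

Lemma sin_lb x : 0 <= x <= pi / 2 -> x / 2 <= sin x.
Proof.
move=> /andP[x0 xpi].
(* sin x = 2 sin (x/2) cos (x/2) >= x cos (x/2)^2 by the mean value theorem *)
have cx : 0 <= cos x by apply: cos_ge0_pihalf; rewrite xpi andbT; have := pi_gt0 R; lra.
have [|c] := MVT_segment (divr_ge0 x0 (ler0n _ 2)) (fun z _ => is_derive_sin z).
  exact/continuous_subspaceT/continuous_sin.
rewrite in_itv/= => /andP[c0 cx2]; rewrite sin0 !subr0 => sE.
have pi0 := pi_gt0 R.
have ch : cos (x / 2) <= cos c.
  rewrite le_eqVlt; case: (eqVneq c (x / 2)) => [->|ne]; first by rewrite eqxx.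
  by apply/orP; right; rewrite ltr_cos ?in_itv/= 1?lt_neqAle ?ne//=; apply/andP; split; lra.
have s2 : sin x = 2 * (cos (x / 2) * sin (x / 2)).
  have {1}-> : x = (x / 2) *+ 2 by rewrite -mulr_natr divfK.
  by rewrite sin_mulr2n; ring.
have cc : cos x = 2 * cos (x / 2) ^+ 2 - 1.
  have {1}-> : x = (x / 2) *+ 2 by rewrite -mulr_natr divfK.
  by rewrite cos_mulr2n; ring.
have c20 : 0 <= cos (x / 2) by apply: cos_ge0_pihalf; apply/andP; split; lra.
rewrite s2 sE.
have h1 : cos (x / 2) ^+ 2 <= cos (x / 2) * cos c by rewrite expr2 ler_wpM2l.
have h2 : 1 / 2 <= cos (x / 2) * cos c by lra.
nra.
Qed.

End Trig.

(** * The exponential on the circle and in the plane *)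

Section CircleExp.
Variable R : realType.
Implicit Types (z w : R[i]) (s t : R).
Local Notation C := R[i].
Local Notation nc := (@Normc.normc R).
Local Notation Re := (@complex.Re R).
Local Notation Im := (@complex.Im R).

Definition expi t : C := sval (cis t).

Lemma Re_expi t : Re (expi t) = cos t. Proof. by []. Qed.
Lemma Im_expi t : Im (expi t) = sin t. Proof. by []. Qed.

Lemma expiD s t : expi (s + t) = expi s * expi t.
Proof.
apply: complex_eq; rewrite ?cReM ?cImM ?Re_expi ?Im_expi ?cosD ?sinD//.
by rewrite addrC; congr (_ + _); rewrite mulrC.
Qed.

Lemma expi0 : expi 0 = 1.
Proof. by apply: complex_eq; rewrite ?Re_expi ?Im_expi ?cos0 ?sin0. Qed.

Lemma nc_expi t : nc (expi t) = 1.
Proof. by rewrite ncE Re_expi Im_expi cos2Dsin2 sqrtr1. Qed.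

Lemma expiX t n : expi t ^+ n = expi (n%:R * t).
Proof.
elim: n => [|n IH]; first by rewrite expr0 mul0r expi0.
by rewrite exprS IH -expiD -{1}[t]mul1r -mulrDl -natr1 addrC.
Qed.

Lemma expiN t : expi (- t) = (expi t)^*%C.
Proof.
by apply: complex_eq; rewrite ?cRe_conj ?cIm_conj ?Re_expi ?Im_expi ?cosN ?sinN.
Qed.

Lemma expiV t : expi (- t) * expi t = 1.
Proof. by rewrite -expiD addNr expi0. Qed.

Lemma expiD2pi t : expi (t + 2 * pi) = expi t.
Proof.
have e : 2 * pi = pi *+ 2 :> R by rewrite mulr_natl.
by apply: complex_eq; rewrite ?Re_expi ?Im_expi e ?cosD2pi ?sinD2pi.
Qed.

Lemma expiDnpi t n : expi (t + n%:R * (2 * pi)) = expi t.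
Proof.
elim: n => [|n IH]; first by rewrite mul0r addr0.
by rewrite -natr1 mulrDl mul1r addrA expiD2pi.
Qed.

Lemma nc_expiB s t : nc (expi s - expi t) <= 2 * `|s - t|.
Proof.
rewrite (le_trans (nc_le _))// cReD cImD cReN cImN !Re_expi !Im_expi.
by rewrite mulr_natl mulr2n lerD ?cos_lip ?sin_lip.
Qed.

Lemma nc_expi1 v : nc (expi v - 1) ^+ 2 = 4 * sin (v / 2) ^+ 2.
Proof.
rewrite nc_sqr cReD cImD cReN cImN !Re_expi !Im_expi /= oppr0 addr0.
have := cos2Dsin2 v; rewrite cos_half; set a := sin (v / 2) ^+ 2 => h.
have -> : sin v ^+ 2 = 1 - (1 - 2 * a) ^+ 2 by lra.
ring.
Qed.

(** The chord of an arc of length v is [2 sin (v / 2)], and [v / 2] stays in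
    the range where sine is at least half its argument. *)
Lemma nc_expi_lb s t : `|s - t| <= pi -> `|s - t| / 2 <= nc (expi s - expi t).
Proof.
wlog st : s t / t <= s => [H|].
  by case: (leP t s) => [/H//|/ltW /H]; rewrite distrC ncB.
rewrite ger0_norm ?subr_ge0// => stpi.
have -> : expi s - expi t = expi t * (expi (s - t) - 1).
  by rewrite mulrBr -expiD mulr1 (addrC t) subrK.
rewrite Normc.normcM nc_expi mul1r.
set v := s - t in stpi *; have v0 : 0 <= v by rewrite subr_ge0.
have := @sin_lb R (v / 2); have -> : 0 <= v / 2 <= pi / 2 by apply/andP; split; lra.
move=> /(_ isT) h.
rewrite -ler_sqr ?nnegrE ?nc_ge0 ?divr_ge0// nc_expi1; nra.
Qed.

(** An argument within pi of a prescribed u: for such arguments chords and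
    arcs are comparable. *)
Lemma unit_expi z u : nc z = 1 -> exists s, `|s - u| <= pi /\ z = expi s.
Proof.
move=> z1; pose w := z * expi (- u).
have w1 : nc w = 1 by rewrite Normc.normcM nc_expi z1 mul1r.
have zw : z = expi u * w by rewrite mulrCA mulrC (mulrC (expi u)) expiV mul1r.
have rw : -1 <= Re w <= 1 by rewrite -ler_norml -w1 ler_Re.
have s2 : Im w ^+ 2 = 1 - Re w ^+ 2 by have := nc_sqr w; rewrite w1 => h; lra.
have a0 := acos_ge0 rw; have a1 := acos_lepi rw.
have sE : sin (acos (Re w)) = `|Im w| by rewrite sin_acos// -s2 sqrtr_sqr.
have cE : cos (acos (Re w)) = Re w by rewrite acosK.
case: (leP 0 (Im w)) => i0.
  exists (u + acos (Re w)); rewrite addrAC subrr add0r ger0_norm//; split => //.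
  rewrite expiD zw; congr (_ * _).
  by apply: complex_eq; rewrite ?Re_expi ?Im_expi ?cE ?sE// ger0_norm.
exists (u - acos (Re w)); rewrite addrAC subrr add0r normrN ger0_norm//; split => //.
rewrite expiD zw; congr (_ * _).
by apply: complex_eq; rewrite ?Re_expi ?Im_expi ?cosN ?sinN ?cE ?sE// ltr0_norm// opprK.
Qed.

Lemma expC0 : expC 0 = 1 :> C.
Proof. by apply: complex_eq; rewrite /= ?expR0 ?cos0 ?sin0 ?mulr1 ?mulr0. Qed.

Lemma expCE z : expC z = (expR (Re z))%:C%C * expi (Im z).
Proof. by apply: complex_eq; rewrite /= ?cReM ?cImM /= ?mul0r ?subr0 ?addr0. Qed.

Lemma expCD z w : expC (z + w) = expC z * expC w.
Proof.
rewrite !expCE cReD cImD expRD expiD rmorphM /=; ring.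
Qed.

Lemma expC_nat n z : expC (n%:R * z) = expC z ^+ n.
Proof.
elim: n => [|n IH]; first by rewrite mul0r expr0 expC0.
by rewrite exprS -IH -expCD -{2}[z]mul1r -mulrDl -natr1 addrC.
Qed.

Lemma nc_expC z : nc (expC z) = expR (Re z).
Proof. by rewrite expCE Normc.normcM nc_expi mulr1 nc_real ger0_norm ?expR_ge0. Qed.

Lemma conj_expC z : (expC z)^*%C = expC z^*%C.
Proof.
rewrite !expCE rmorphM cRe_conj cIm_conj expiN; congr (_ * _).
by apply: complex_eq; rewrite /= ?oppr0.
Qed.

(** The modulus has to be bounded at the end points only, because on the
    segment between them it is at most the larger of the two end values. *)
Lemma expC_lip z w (M : R) : nc (expC z) <= M -> nc (expC w) <= M ->
  nc (expC z - expC w) <= 3 * M * nc (z - w).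
Proof.
move=> zM wM; have M0 : 0 <= M := le_trans (nc_ge0 _) zM.
have -> : expC z - expC w = (expR (Re z) - expR (Re w))%:C%C * expi (Im z)
   + (expR (Re w))%:C%C * (expi (Im z) - expi (Im w)).
  by rewrite !expCE rmorphB /=; ring.
rewrite (le_trans (ncD _ _))// !Normc.normcM nc_expi mulr1 !nc_real.
rewrite !nc_expC in zM wM.
have h1 := expR_lip zM wM.
have h2 := nc_expiB (Im z) (Im w).
have h3 : `|Re z - Re w| <= nc (z - w) by have := ler_Re (z - w); rewrite cReD cReN.
have h4 : `|Im z - Im w| <= nc (z - w) by have := ler_Im (z - w); rewrite cImD cImN.
rewrite (ger0_norm (expR_ge0 _)).
have h5 : M * `|Re z - Re w| <= M * nc (z - w) by rewrite ler_wpM2l.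
have h6 : expR (Re w) * nc (expi (Im z) - expi (Im w)) <= M * (2 * nc (z - w)).
  by apply: ler_pM => //; rewrite ?expR_ge0 ?nc_ge0//; lra.
lra.
Qed.

Lemma expC_quad z : nc z <= 1 / 2 -> nc (expC z - (1 + z)) <= 8 * nc z ^+ 2.
Proof.
move=> z1.
have rz := ler_Re z; have iz := ler_Im z.
have := nc_sqr z; set N := nc z in z1 rz iz * => N2.
have N0 : 0 <= N := nc_ge0 z.
have := @expR_quad R (Re z); have := @sin_quad R (Im z); have := cos_quad (Im z).
move=> hc /(_ ltac:(lra)) hs /(_ ltac:(lra)) he.
have x2 : Re z ^+ 2 <= N ^+ 2 by rewrite N2 lerDl sqr_ge0.
have y2 : Im z ^+ 2 <= N ^+ 2 by rewrite N2 lerDr sqr_ge0.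
rewrite (le_trans (nc_le _))// !(cReD, cImD, cReN, cImN) /= add0r.
move: hc hs he; move: (Re z) (Im z) rz iz x2 y2 => x y rz iz x2 y2.
have e0 := expR_ge0 x.
have e2 : expR x <= 2.
  have h := expR_ge1Dx (- x); have := expRxMexpNx_1 x.
  move: rz; rewrite ler_norml => /andP[_ rz].
  have f0 : 1 / 2 <= expR (- x) by lra.
  nra.
set e := expR x in e0 e2 *; set c := cos y; set s := sin y => hc hs he.
have hc' : `|e * (c - 1)| <= 2 * (y ^+ 2 / 2).
  by rewrite normrM (ger0_norm e0); apply: ler_pM.
have e1 : `|e - 1| <= 1 * N + 2 * N ^+ 2.
  have -> : e - 1 = (e - 1 - x) + x by ring.
  by rewrite (le_trans (ler_normD _ _))//; lra.
have e1' : `|e - 1| <= 2 * N by nra.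
have hs' : `|(e - 1) * y| <= 2 * N * N by rewrite normrM; apply: ler_pM.
have hs2 : `|e * (s - y)| <= 2 * y ^+ 2.
  by rewrite normrM (ger0_norm e0); apply: ler_pM.
have -> : e * c - (1 + x) = e * (c - 1) + (e - 1 - x) by ring.
have -> : e * s - y = e * (s - y) + (e - 1) * y by ring.
have k1 := ler_normD (e * (c - 1)) (e - 1 - x).
have k2 := ler_normD (e * (s - y)) ((e - 1) * y).
nra.
Qed.

End CircleExp.

(** * Integrals of complex-valued functions *)

Section ComplexIntegral.
Context d (T : measurableType d) (R : realType).
Variables (mu : {measure set T -> \bar R}) (D : set T).
Hypothesis mD : measurable D.
Local Notation C := R[i].
Local Notation nc := (@Normc.normc R).
Local Notation Re := (@complex.Re R).
Local Notation Im := (@complex.Im R).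
Implicit Types (f g : T -> C) (h : T -> R).

Definition cmeasurable f :=
  measurable_fun D (fun x => Re (f x)) /\ measurable_fun D (fun x => Im (f x)).

Definition cintegrable f :=
  mu.-integrable D (fun x => (Re (f x))%:E) /\
  mu.-integrable D (fun x => (Im (f x))%:E).

Definition cint f : C :=
  (\int[mu]_(x in D) Re (f x) +i* \int[mu]_(x in D) Im (f x))%C.

Lemma eq_cint f g : (forall x, D x -> f x = g x) -> cint f = cint g.
Proof.
by move=> fg; apply: complex_eq; apply: eq_Rintegral => x /set_mem Dx; rewrite fg.
Qed.

Lemma cmeasurable_cst c : cmeasurable (fun=> c).
Proof. by split; exact: measurable_cst. Qed.

Lemma cmeasurableD f g : cmeasurable f -> cmeasurable g ->
  cmeasurable (fun x => f x + g x).
Proof.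
move=> [f1 f2] [g1 g2]; split.
  by under eq_fun do rewrite cReD; exact: measurable_funD.
by under eq_fun do rewrite cImD; exact: measurable_funD.
Qed.

Lemma cmeasurableN f : cmeasurable f -> cmeasurable (fun x => - f x).
Proof.
move=> [f1 f2]; split.
  by under eq_fun do rewrite cReN; exact: measurable_funN.
by under eq_fun do rewrite cImN; exact: measurable_funN.
Qed.

Lemma cmeasurableM f g : cmeasurable f -> cmeasurable g ->
  cmeasurable (fun x => f x * g x).
Proof.
move=> [f1 f2] [g1 g2]; split.
  under eq_fun do rewrite cReM.
  by apply: measurable_funB; exact: measurable_funM.
under eq_fun do rewrite cImM.
by apply: measurable_funD; exact: measurable_funM.
Qed.

Lemma cmeasurableX f n : cmeasurable f -> cmeasurable (fun x => f x ^+ n).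
Proof.
move=> mf; elim: n => [|n IH]; first exact: cmeasurable_cst.
by under eq_fun do rewrite exprS; exact: cmeasurableM.
Qed.

Lemma cmeasurable_conj f : cmeasurable f -> cmeasurable (fun x => (f x)^*%C).
Proof.
move=> [f1 f2]; split; first by under eq_fun do rewrite cRe_conj.
by under eq_fun do rewrite cIm_conj; exact: measurable_funN.
Qed.

Lemma cmeasurableV f : (forall x, D x -> f x != 0) -> cmeasurable f ->
  cmeasurable (fun x => (f x)^-1).
Proof.
move=> f0 mf.
(* 1 / f is conj f / |f|^2, and division by |f|^2 is written as
   multiplication by exp (- ln |f|^2), a composite of measurable functions *)
have Vx x : D x -> (f x)^-1 = (f x)^*%C * (expR (- ln (nc (f x) ^+ 2)))%:C%C.
  move=> /f0 fx0; have nf : 0 < nc (f x) by rewrite lt_def nc_eq0 fx0 nc_ge0.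
  apply: (mulfI fx0); rewrite mulfV// mulrA mulr_conj -rmorphM/= expRN.
  by rewrite lnK ?posrE ?exprn_gt0// mulfV// gt_eqF// exprn_gt0.
have mexp : measurable_fun D (fun x => expR (- ln (nc (f x) ^+ 2))).
  apply: (@measurableT_comp _ _ _ _ _ _ expR) => //.
  apply: measurable_funN; apply: (@measurableT_comp _ _ _ _ _ _ (@ln R)) => //.
  under eq_fun do rewrite nc_sqr.
  by case: mf => m1 m2; apply: measurable_funD; exact: measurable_funX.
have [m1 m2] : cmeasurable (fun x => (f x)^*%C * (expR (- ln (nc (f x) ^+ 2)))%:C%C).
  apply: cmeasurableM; first exact: cmeasurable_conj.
  by split; [exact: mexp|exact: measurable_cst].
by split; [apply: eq_measurable_fun m1|apply: eq_measurable_fun m2] => x /set_mem Dx;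
  rewrite -Vx.
Qed.

Lemma bounded_cintegrable f (M : R) : (mu D < +oo)%E -> cmeasurable f ->
  (forall x, D x -> nc (f x) <= M) -> cintegrable f.
Proof.
move=> Doo [m1 m2] fM.
have bnd (h : T -> R) : (forall x, D x -> `|h x| <= M) -> [bounded h x | x in D].
  move=> hM; exists M; split; first exact: num_real.
  by move=> y My x Dx /=; rewrite (le_trans (hM _ Dx))// ltW.
split; apply: (@measurable_bounded_integrable _ _ _ _ _ D) => //; apply: bnd => x Dx.
  exact: le_trans (ler_Re _) (fM _ Dx).
exact: le_trans (ler_Im _) (fM _ Dx).
Qed.

Lemma cintegrableD f g : cintegrable f -> cintegrable g ->
  cintegrable (fun x => f x + g x).
Proof.
move=> [f1 f2] [g1 g2]; split.
  by under eq_fun do rewrite cReD EFinD; exact: integrableD.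
by under eq_fun do rewrite cImD EFinD; exact: integrableD.
Qed.

Lemma cintegrableZ c f : cintegrable f -> cintegrable (fun x => c * f x).
Proof.
move=> [f1 f2]; split.
  under eq_fun do rewrite cReM EFinB !EFinM.
  by apply: integrableB => //; exact: integrableZl.
under eq_fun do rewrite cImM EFinD !EFinM.
by apply: integrableD => //; exact: integrableZl.
Qed.

Lemma cintD f g : cintegrable f -> cintegrable g ->
  cint (fun x => f x + g x) = cint f + cint g.
Proof.
move=> [f1 f2] [g1 g2]; apply: complex_eq => /=.
  by under eq_Rintegral do rewrite cReD; rewrite RintegralD.
by under eq_Rintegral do rewrite cImD; rewrite RintegralD.
Qed.

Lemma integrableZlF (c : R) (h : T -> R) :
  mu.-integrable D (EFin \o h) -> mu.-integrable D (EFin \o (fun x => c * h x)).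
Proof. by move=> ih; have := integrableZl mD c ih; apply: eq_integrable => //. Qed.

Lemma cintZ c f : cintegrable f -> cint (fun x => c * f x) = c * cint f.
Proof.
move=> [f1 f2]; apply: complex_eq; rewrite ?cReM ?cImM /=.
  under eq_Rintegral do rewrite cReM.
  rewrite RintegralB//; [|exact: integrableZlF|exact: integrableZlF].
  by rewrite !RintegralZl.
under eq_Rintegral do rewrite cImM.
rewrite RintegralD//; [|exact: integrableZlF|exact: integrableZlF].
by rewrite !RintegralZl.
Qed.

Lemma cintegrableB f g : cintegrable f -> cintegrable g ->
  cintegrable (fun x => f x - g x).
Proof.
move=> fi gi; apply: cintegrableD => //.
by under eq_fun do rewrite -mulN1r; exact: cintegrableZ.
Qed.

Lemma cintB f g : cintegrable f -> cintegrable g ->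
  cint (fun x => f x - g x) = cint f - cint g.
Proof.
move=> fi gi.
have -> : cint (fun x => f x - g x) = cint (fun x => f x + -1 * g x).
  by apply: eq_cint => x _; rewrite mulN1r.
by rewrite cintD ?cintZ ?mulN1r//; exact: cintegrableZ.
Qed.

Lemma cint_sum (F : nat -> T -> C) n : cintegrable (fun=> 0) ->
  (forall i, cintegrable (F i)) ->
  cintegrable (fun x => \sum_(i < n) F i x) /\
  cint (fun x => \sum_(i < n) F i x) = \sum_(i < n) cint (F i).
Proof.
move=> i0 Fi; elim: n => [|n [IH1 IH2]].
  have E : (fun x => \sum_(i < 0) F i x) = (fun=> 0) by apply/funext => x; rewrite big_ord0.
  rewrite E big_ord0; split => //; apply: complex_eq; by rewrite /= Rintegral_cst ?mul0r.
have E : (fun x => \sum_(i < n.+1) F i x) = (fun x => \sum_(i < n) F i x + F n x).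
  by apply/funext => x; rewrite big_ord_recr.
by rewrite E big_ord_recr/= -IH2; split; [exact: cintegrableD|exact: cintD].
Qed.

(** The factor 2 is the price of bounding the real and the imaginary part
    separately. *)
Lemma nc_cint_le f h : cintegrable f -> mu.-integrable D (EFin \o h) ->
  (forall x, D x -> nc (f x) <= h x) ->
  nc (cint f) <= 2 * \int[mu]_(x in D) h x.
Proof.
move=> [f1 f2] hi fh; rewrite (le_trans (nc_le _))//= mulr_natl mulr2n.
have aux (k : T -> R) : mu.-integrable D (EFin \o k) ->
    (forall x, `|k x| <= nc (f x)) ->
    `|\int[mu]_(x in D) k x| <= \int[mu]_(x in D) h x.
  move=> ki kf; rewrite (le_trans (le_normr_Rintegral _ _))//.
  apply: le_Rintegral => //; first exact: integrable_norm.
  by move=> x Dx; rewrite (le_trans (kf _))// fh.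
by apply: lerD; apply: aux => // x; [exact: ler_Re|exact: ler_Im].
Qed.

Lemma nc_cint_bounded f (M : R) : (mu D < +oo)%E -> cmeasurable f ->
  (forall x, D x -> nc (f x) <= M) ->
  nc (cint f) <= 2 * (M * fine (mu D)).
Proof.
move=> Doo mf fM; rewrite -Rintegral_cst//.
apply: nc_cint_le => //; first exact: bounded_cintegrable fM.
apply: (@measurable_bounded_integrable _ _ _ _ _ D) => //.
exists `|M|; split; first exact: num_real.
by move=> y My x Dx /=; rewrite ltW.
Qed.

End ComplexIntegral.

(** * Uniform approximation by polynomials *)

Section PolyApprox.
Variable R : realType.
Local Notation C := R[i].
Local Notation nc := (@Normc.normc R).
Implicit Types (r e M : R) (F G : C -> C) (p q : {poly C}) (z w : C).

(** Stands for analyticity: Cauchy's theorem and the mean value property on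
    circles hold for polynomials by inspection of Fourier coefficients and
    pass to uniform limits, and the class is closed under products and under
    composition with the exponential. *)
Definition poly_approx r G := forall e, 0 < e ->
  exists q, forall z, nc z <= r -> nc (G z - q.[z]) <= e.

Lemma poly_bounded r q : 0 <= r -> exists2 M, 0 <= M & forall z, nc z <= r -> nc q.[z] <= M.
Proof.
move=> r0; exists (\sum_(i < size q) nc q`_i * r ^+ i).
  by apply: sumr_ge0 => i _; rewrite mulr_ge0 ?nc_ge0 ?exprn_ge0.
move=> z zr; rewrite horner_coef (le_trans (nc_sum _ _ _))//.
apply: ler_sum => i _; rewrite Normc.normcM ncX ler_wpM2l ?nc_ge0//.
by rewrite lerXn2r ?nnegrE ?nc_ge0.
Qed.

Lemma poly_approx_bounded r G : 0 <= r -> poly_approx r G ->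
  exists2 M, 0 <= M & forall z, nc z <= r -> nc (G z) <= M.
Proof.
move=> r0 /(_ 1 ltr01)[q qG]; have [M M0 qM] := poly_bounded q r0.
exists (1 + M); first by rewrite addr_ge0.
move=> z zr; rewrite -(subrK q.[z] (G z)) (le_trans (ncD _ _))// lerD ?qG ?qM//.
Qed.

Lemma poly_approx_poly r q : poly_approx r (horner q).
Proof.
by move=> e e0; exists q => z _; rewrite subrr Normc.normc0 ltW.
Qed.

Lemma poly_approx_cst r (c : C) : poly_approx r (fun=> c).
Proof.
by move=> e e0; exists c%:P => z _; rewrite hornerC subrr Normc.normc0 ltW.
Qed.

Lemma poly_approx_eq r F G : (forall z, nc z <= r -> F z = G z) ->
  poly_approx r F -> poly_approx r G.
Proof. by move=> FG PF e /PF[q qF]; exists q => z zr; rewrite -FG// qF. Qed.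

Lemma poly_approx_le r r' G : r <= r' -> poly_approx r' G -> poly_approx r G.
Proof. by move=> rr PG e /PG[q qG]; exists q => z zr; rewrite qG// (le_trans zr). Qed.

Lemma poly_approxM r F G : 0 <= r -> poly_approx r F -> poly_approx r G ->
  poly_approx r (fun z => F z * G z).
Proof.
move=> r0 PF PG e e0.
have [M M0 GM] := poly_approx_bounded r0 PG.
have e1 : 0 < e / 2 / (M + 1) by rewrite divr_gt0 ?divr_gt0// ltr_wpDl.
have [p pF] := PF _ e1.
have [N N0 pN] := poly_bounded p r0.
have e2 : 0 < e / 2 / (N + 1) by rewrite divr_gt0 ?divr_gt0// ltr_wpDl.
have [q qG] := PG _ e2.
exists (p * q) => z zr.
have -> : F z * G z - (p * q).[z] = (F z - p.[z]) * G z + p.[z] * (G z - q.[z]).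
  by rewrite hornerM; ring.
rewrite (le_trans (ncD _ _))// !Normc.normcM.
have h1 : nc (F z - p.[z]) * nc (G z) <= e / 2 / (M + 1) * (M + 1).
  by apply: ler_pM; rewrite ?nc_ge0 ?pF//; have := GM z zr; lra.
have h2 : nc p.[z] * nc (G z - q.[z]) <= (N + 1) * (e / 2 / (N + 1)).
  by apply: ler_pM; rewrite ?nc_ge0 ?qG//; have := pN z zr; lra.
rewrite divfK in h1; last by rewrite gt_eqF// ltr_wpDl.
rewrite [X in _ <= X]mulrC divfK in h2; last by rewrite gt_eqF// ltr_wpDl.
lra.
Qed.

Lemma poly_approx_lim r G : (forall e, 0 < e -> exists2 F, poly_approx r F &
  forall z, nc z <= r -> nc (G z - F z) <= e) -> poly_approx r G.
Proof.
move=> H e e0; have e2 : 0 < e / 2 by rewrite divr_gt0.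
have [F PF FG] := H _ e2; have [q qF] := PF _ e2.
exists q => z zr; rewrite (le_trans (nc_tri _ (F z) _))//.
by have := FG z zr; have := qF z zr; lra.
Qed.

Lemma poly_approxX r G n : 0 <= r -> poly_approx r G -> poly_approx r (fun z => G z ^+ n).
Proof.
move=> r0 PG; elim: n => [|n IH]; first exact: poly_approx_cst.
apply: (@poly_approx_eq _ (fun z => G z * G z ^+ n)) => [z _|]; first by rewrite exprS.
exact: poly_approxM.
Qed.

Lemma poly_approxD r F G : poly_approx r F -> poly_approx r G ->
  poly_approx r (fun z => F z + G z).
Proof.
move=> PF PG e e0; have e2 : 0 < e / 2 by rewrite divr_gt0.
have [p pF] := PF _ e2; have [q qG] := PG _ e2.
exists (p + q) => z zr; rewrite hornerD opprD addrACA (le_trans (ncD _ _))//.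
by have := pF z zr; have := qG z zr; lra.
Qed.

(** The powers of [1 + z / n] are compared with [exp z = exp (z / n)^n] factor
    by factor, so one quadratic estimate of the exponential near 0 is enough. *)
Lemma expC_powers (B e : R) : 0 <= B -> 0 < e -> exists n : nat, forall z, nc z <= B ->
  nc (expC z - (1 + n.+1%:R^-1 * z) ^+ n.+1) <= e.
Proof.
move=> B0 e0.
(* n factors, each off by 8 (B / n)^2, with products bounded by e^B, give the
   error 8 B^2 e^B / n *)
have c0 : 0 <= 8 * B ^+ 2 * expR B by rewrite !mulr_ge0 ?expR_ge0.
set c := 8 * B ^+ 2 * expR B in c0 *.
have [n [n1 n2]] : exists n : nat, 2 * B <= n.+1%:R /\ c / e <= n.+1%:R.
  exists (Num.truncn (2 * B + c / e)).
  have h := truncnS_gt (2 * B + c / e).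
  have ce : 0 <= c / e by rewrite divr_ge0// ltW.
  by split; lra.
exists n => z zB; set N : R := n.+1%:R in n1 n2 *.
have N0 : 0 < N by rewrite ltr0n.
pose w : C := n.+1%:R^-1 * z.
have NC : (n.+1%:R : C) = N%:C%C by rewrite rmorph_nat.
have nw : nc w = nc z / N.
  by rewrite Normc.normcM Normc.normcV NC nc_real gtr0_norm// mulrC.
have wB : nc w <= B / N by rewrite nw ler_pM2r ?invr_gt0.
have BN : B / N <= 1 / 2 by rewrite ler_pdivrMr//; lra.
have zw : z = n.+1%:R * w by rewrite mulrA mulfV ?mul1r// pnatr_eq0.
rewrite -/w {1}zw expC_nat.
have Mz : nc (expC w) <= expR (B / N).
  rewrite nc_expC ler_expR (le_trans _ wB)// (le_trans (ler_norm _))//; exact: ler_Re.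
have Mw : nc (1 + w) <= expR (B / N).
  rewrite (le_trans (ncD _ _))// Normc.normc1 (le_trans _ (expR_ge1Dx _))//.
  by rewrite lerD2l.
rewrite (le_trans (ncXB _ Mz Mw))//=.
have h1 := expC_quad (le_trans wB BN).
have h2 : expR (B / N) ^+ n <= expR B.
  rewrite -expRM_natl ler_expR mulrCA ler_piMr// ler_pdivrMr// mul1r.
  by rewrite ler_nat.
have w2 : nc w ^+ 2 <= (B / N) ^+ 2 by rewrite lerXn2r ?nnegrE ?nc_ge0// divr_ge0// ltW.
have h3 : nc (expC w - (1 + w)) <= 8 * (B / N) ^+ 2 by rewrite (le_trans h1) ?ler_wpM2l.
rewrite (@le_trans _ _ (N * (8 * (B / N) ^+ 2) * expR B))//.
  apply: ler_pM => //; rewrite ?exprn_ge0 ?expR_ge0//.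
    by rewrite mulr_ge0 ?nc_ge0// ltW.
  by rewrite ler_wpM2l// ltW.
have -> : N * (8 * (B / N) ^+ 2) * expR B = c / N.
  by rewrite /c; field; rewrite gt_eqF.
by rewrite ler_pdivrMr// mulrC -ler_pdivrMr.
Qed.

Lemma poly_approx_expC r G : 0 <= r -> poly_approx r G -> poly_approx r (fun z => expC (G z)).
Proof.
move=> r0 PG; apply: poly_approx_lim => e e0.
have [M M0 GM] := poly_approx_bounded r0 PG.
have [n Hn] := expC_powers M0 e0.
exists (fun z => (1 + n.+1%:R^-1 * G z) ^+ n.+1); last by move=> z /GM /Hn.
apply: poly_approxX => //; apply: poly_approxD; first exact: poly_approx_cst.
by apply: poly_approxM => //; exact: poly_approx_cst.
Qed.

End PolyApprox.

(** * The Herglotz kernel *)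

Section HerglotzKernel.
Variable R : realType.
Local Notation C := R[i].
Local Notation nc := (@Normc.normc R).
Local Notation Re := (@complex.Re R).
Implicit Types (k z w : C).

(** For [k = e^{-it}] this is [(e^{it} + z) / (e^{it} - z)]. With the inverse
    k of the pole as parameter, poles outside the closed disc are covered by
    [nc k < 1], and the point at infinity by [k = 0]. *)
Definition hkernel k z : C := (1 + k * z) / (1 - k * z).

Lemma nc_mul_le k z (r : R) : nc k <= 1 -> nc z <= r -> nc (k * z) <= r.
Proof.
move=> k1 zr; rewrite Normc.normcM (le_trans _ zr)//.
by rewrite ler_piMl ?nc_ge0.
Qed.

Lemma nc_1B z (r : R) : nc z <= r -> 1 - r <= nc (1 - z).
Proof. by move=> zr; have := nc_rev 1 z; rewrite Normc.normc1; lra. Qed.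

Lemma hkernel_den k z : nc k <= 1 -> nc z < 1 -> 1 - k * z != 0.
Proof.
move=> k1 z1; rewrite -nc_eq0 gt_eqF//.
by have := nc_1B (nc_mul_le k1 (lexx (nc z))); lra.
Qed.

Lemma hkernel0 k : hkernel k 0 = 1.
Proof. by rewrite /hkernel mulr0 addr0 subr0 divr1. Qed.

Lemma Re_hkernel k z : nc k <= 1 -> nc z < 1 ->
  Re (hkernel k z) = (1 - nc (k * z) ^+ 2) / nc (1 - k * z) ^+ 2.
Proof.
move=> k1 z1; have d0 := hkernel_den k1 z1; rewrite /hkernel.
move: (k * z) d0 => u d0.
have n0 : nc (1 - u) ^+ 2 != 0 by rewrite expf_neq0// nc_eq0.
apply: (mulIf n0); rewrite divfK//.
have -> : Re ((1 + u) / (1 - u)) * nc (1 - u) ^+ 2 = Re ((1 + u) * (1 - u)^*%C).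
  have -> : (1 + u) * (1 - u)^*%C = (1 + u) / (1 - u) * (nc (1 - u) ^+ 2)%:C%C.
    by rewrite -mulr_conj mulrA divfK.
  by rewrite cReMr.
rewrite nc_sqr; case: u {d0 n0} => a b /=; ring.
Qed.

Lemma Re_hkernel_ge0 k z : nc k <= 1 -> nc z < 1 -> 0 <= Re (hkernel k z).
Proof.
move=> k1 z1; rewrite Re_hkernel// divr_ge0 ?exprn_ge0 ?nc_ge0//.
rewrite subr_ge0 exprn_ile1 ?nc_ge0//.
by rewrite (le_trans (nc_mul_le k1 (lexx _)))// ltW.
Qed.

(** A geometric series, as [(1 + u) / (1 - u) = 2 / (1 - u) - 1]. *)
Lemma hkernel_series k z n : 1 - k * z != 0 ->
  hkernel k z - \sum_(i < n.+1) (if i == 0 :> nat then 1 else 2) * k ^+ i * z ^+ i =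
  2 * (k * z) ^+ n.+1 / (1 - k * z).
Proof.
move=> d0.
have -> : \sum_(i < n.+1) (if i == 0 :> nat then 1 else 2) * k ^+ i * z ^+ i =
    2 * \sum_(i < n.+1) (k * z) ^+ i - 1.
  rewrite !big_ord_recl /= !expr0 !mulr1 mulrDr mulr1 big_distrr /=.
  have -> : \sum_(i < n) 2 * k ^+ bump 0 i * z ^+ bump 0 i = \sum_(i < n) 2 * (k * z) ^+ bump 0 i.
    by apply: eq_bigr => i _; rewrite exprMn mulrA.
  by ring.
apply: (mulIf d0); rewrite divfK// /hkernel mulrBl divfK//.
have := subrX1 (k * z) n.+1; move: (\sum_(i < n.+1) _) => S h.
have -> : (k * z) ^+ n.+1 = 1 - (1 - k * z) * S by rewrite -[LHS](subrK 1) h; ring.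
ring.
Qed.

Lemma nc_hkernel_le k z (r : R) : nc k <= 1 -> r < 1 -> nc z <= r -> nc (hkernel k z) <= 2 / (1 - r).
Proof.
move=> k1 r1 zr; have kz := nc_mul_le k1 zr.
rewrite Normc.normcM Normc.normcV.
have h := nc_1B kz.
apply: ler_pM; rewrite ?nc_ge0 ?invr_ge0 ?nc_ge0//.
  by rewrite (le_trans (ncD _ _))// Normc.normc1; lra.
by rewrite lef_pV2 ?posrE//; lra.
Qed.

Lemma hkernel_diff k z w : 1 - k * z != 0 -> 1 - k * w != 0 ->
  hkernel k z - hkernel k w = 2 * k * (z - w) / ((1 - k * z) * (1 - k * w)).
Proof. by move=> h1 h2; rewrite /hkernel; field; rewrite h1 h2. Qed.

End HerglotzKernel.

(** * Herglotz integrals and their exponentials *)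

Section Herglotz.
Context d (T : measurableType d) (R : realType).
Local Notation C := R[i].
Local Notation nc := (@Normc.normc R).
Local Notation Re := (@complex.Re R).
Variables (mu : {measure set T -> \bar R}) (D : set T) (k : T -> C).
Hypotheses (mD : measurable D) (Doo : (mu D < +oo)%E).
Hypotheses (mk : cmeasurable D k) (k1 : forall x, nc (k x) <= 1).
Implicit Types (z w : C) (r : R).

(** The point x carries a pole at [1 / k x], which lies on the unit circle or
    outside it. For the identity map of the circle, that is [k x = conj x],
    this is the usual Herglotz integral; other choices of k move the poles off
    the circle. *)
Definition herglotz z := cint mu D (fun x => hkernel (k x) z).

Lemma cmeasurable_hkernel z : nc z < 1 -> cmeasurable D (fun x => hkernel (k x) z).
Proof.
move=> z1; have mkz : cmeasurable D (fun x => k x * z).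
  by apply: cmeasurableM => //; exact: cmeasurable_cst.
apply: cmeasurableM => //.
  by apply: cmeasurableD => //; exact: cmeasurable_cst.
apply: cmeasurableV => // [x _|]; first exact: hkernel_den.
by apply: cmeasurableD => //; exact: cmeasurableN.
Qed.

Lemma cintegrable_hkernel z : nc z < 1 -> cintegrable mu D (fun x => hkernel (k x) z).
Proof.
move=> z1; apply: (bounded_cintegrable mD Doo (cmeasurable_hkernel z1)) => x _.
exact: nc_hkernel_le (k1 x) z1 (lexx _).
Qed.

Lemma herglotz0 : herglotz 0 = (fine (mu D))%:C%C.
Proof.
rewrite /herglotz (@eq_cint _ _ _ _ _ _ (fun=> 1)); last by move=> x _; exact: hkernel0.
by apply: complex_eq; rewrite /= Rintegral_cst// ?mul1r ?mul0r.
Qed.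

Lemma integrable_Re_hkernel z : nc z < 1 -> mu.-integrable D (EFin \o (fun x => Re (hkernel (k x) z))).
Proof. by move=> /cintegrable_hkernel[]. Qed.

Lemma Re_herglotz_ge0 z : nc z < 1 -> 0 <= Re (herglotz z).
Proof. by move=> z1; apply: Rintegral_ge0 => x _; exact: Re_hkernel_ge0. Qed.

Lemma Re_herglotz_le z (c : R) : nc z < 1 ->
  (forall x, D x -> Re (hkernel (k x) z) <= c) -> Re (herglotz z) <= c * fine (mu D).
Proof.
move=> z1 H; rewrite -Rintegral_cst//.
apply: le_Rintegral => //; first exact: integrable_Re_hkernel.
apply: (@measurable_bounded_integrable _ _ _ _ _ D) => //.
exists `|c|; split; first exact: num_real.
by move=> y My x Dx /=; rewrite ltW.
Qed.

Lemma Re_herglotz_ge (A : set T) z (c : R) : measurable A -> A `<=` D -> nc z < 1 -> 0 <= c ->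
  (forall x, A x -> c <= Re (hkernel (k x) z)) -> c * fine (mu A) <= Re (herglotz z).
Proof.
move=> mA AD z1 c0 H.
have Afin : (mu A < +oo)%E by rewrite (le_lt_trans _ Doo)// le_measure ?inE.
have iz := integrable_Re_hkernel z1.
apply: (@le_trans _ _ (\int[mu]_(x in A) Re (hkernel (k x) z))).
  rewrite -Rintegral_cst//; apply: le_Rintegral => //.
    apply: (@measurable_bounded_integrable _ _ _ _ _ A) => //.
    exists `|c|; split; first exact: num_real.
    by move=> y My x Dx /=; rewrite ltW.
  exact: integrableS iz.
apply: fine_le.
- exact: integrable_fin_num (integrableS mD mA AD iz).
- exact: integrable_fin_num iz.
- apply: ge0_subset_integral => //.
    by case/integrableP : iz.
  by move=> x _; rewrite lee_fin Re_hkernel_ge0.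
Qed.

(** A difference of two kernels is [z - w] over the product of both
    denominators, so z and w may be at very different distances from the
    poles. *)
Lemma nc_herglotz_diff z w (a b : R) : nc z < 1 -> nc w < 1 -> 0 < a -> 0 < b ->
  (forall x, D x -> a <= nc (1 - k x * z)) ->
  (forall x, D x -> b <= nc (1 - k x * w)) ->
  nc (herglotz z - herglotz w) <= 2 * (2 / (a * b) * nc (z - w) * fine (mu D)).
Proof.
move=> z1 w1 a0 b0 az bw.
rewrite /herglotz -cintB//; [|exact: cintegrable_hkernel..].
apply: nc_cint_bounded => //.
  apply: cmeasurableD; first exact: cmeasurable_hkernel.
  by apply: cmeasurableN => //; exact: cmeasurable_hkernel.
move=> x Dx; rewrite hkernel_diff ?hkernel_den// Normc.normcM Normc.normcV !Normc.normcM.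
rewrite (nc_nat R 2) [X in _ <= X]mulrAC; apply: ler_pM.
- by rewrite !mulr_ge0 ?nc_ge0.
- by rewrite invr_ge0 mulr_ge0 ?nc_ge0.
- by rewrite ler_wpM2r ?nc_ge0// ler_piMr.
rewrite lef_pV2 ?posrE ?mulr_gt0//; first by rewrite ler_pM ?az ?bw// ltW.
  exact: lt_le_trans (az _ Dx).
exact: lt_le_trans (bw _ Dx).
Qed.

Lemma exprn_small (r e : R) : 0 <= r < 1 -> 0 < e -> exists n : nat, r ^+ n.+1 <= e.
Proof.
move=> /andP[r0 r1] e0.
have /cvgrPdist_le/(_ e e0)[N _ HN] : (r ^+ n @[n --> \oo] --> (0 : R)).
  by apply: cvg_expr; rewrite ger0_norm.
exists N; have := HN N.+1 (leqnSn N).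
by rewrite sub0r normrN ger0_norm ?exprn_ge0.
Qed.

(** The Taylor expansion of the kernel can be integrated term by term, since
    its remainder is a geometric tail that does not depend on the pole. *)
Lemma poly_approx_herglotz r : 0 <= r < 1 -> poly_approx r herglotz.
Proof.
move=> r01 e e0; have /andP[r0 r1] := r01.
set m := fine (mu D); have m0 : 0 <= m by rewrite fine_ge0.
have h1r : 0 < 1 - r by lra.
have hm : 0 < m + 1 by lra.
have [|n Hn'] := @exprn_small r (e * (1 - r) / (4 * (m + 1))) r01.
  by rewrite divr_gt0 ?mulr_gt0.
pose c (i : nat) : C := if i == 0%N then 1 else 2.
exists (\poly_(i < n.+1) cint mu D (fun x => c i * k x ^+ i)).
move=> z zr; have z1 : nc z < 1 by rewrite (le_lt_trans zr).
pose term (i : nat) x := c i * k x ^+ i * z ^+ i.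
have ick (i : nat) : cintegrable mu D (fun x => c i * k x ^+ i).
  apply: cintegrableZ => //.
  apply: (@bounded_cintegrable _ _ _ _ _ mD _ 1 Doo); first exact: cmeasurableX.
  by move=> x _; rewrite ncX exprn_ile1 ?nc_ge0.
have i0 : cintegrable mu D (fun=> 0 : C).
  apply: (@bounded_cintegrable _ _ _ _ _ mD _ 1 Doo) => [|x _].
    exact: cmeasurable_cst.
  by rewrite Normc.normc0.
have iterm i : cintegrable mu D (term i).
  by have := cintegrableZ mD (z ^+ i) (ick i); under eq_fun do rewrite mulrC.
have [isum Esum] := @cint_sum _ _ _ mu _ mD term n.+1 i0 iterm.
rewrite horner_poly.
have -> : \sum_(i < n.+1) cint mu D (fun x => c i * k x ^+ i) * z ^+ i =
    cint mu D (fun x => \sum_(i < n.+1) term i x).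
  rewrite Esum; apply: eq_bigr => i _; rewrite mulrC -cintZ//.
  by apply: eq_cint => x _; rewrite mulrC.
rewrite /herglotz -cintB//; last exact: cintegrable_hkernel.
have H x : D x ->
    nc (hkernel (k x) z - \sum_(i < n.+1) term i x) <= 2 * r ^+ n.+1 / (1 - r).
  move=> Dx; rewrite /term /c hkernel_series ?hkernel_den//.
  have kz := nc_mul_le (k1 x) zr.
  rewrite Normc.normcM Normc.normcV Normc.normcM ncX (nc_nat R 2).
  apply: ler_pM; rewrite ?invr_ge0 ?mulr_ge0 ?exprn_ge0 ?nc_ge0//.
    by rewrite ler_wpM2l// lerXn2r ?nnegrE ?nc_ge0.
  by have := nc_1B kz => h; rewrite lef_pV2 ?posrE//; lra.
have M0 : 0 <= 2 * r ^+ n.+1 / (1 - r) by rewrite divr_ge0 ?mulr_ge0 ?exprn_ge0//; lra.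
apply: (@le_trans _ _ (2 * (2 * r ^+ n.+1 / (1 - r) * m))).
  rewrite -Rintegral_cst//.
  apply: nc_cint_le => //; first by apply: cintegrableB => //; exact: cintegrable_hkernel.
  apply: (@measurable_bounded_integrable _ _ _ _ _ D) => //.
  exists (2 * r ^+ n.+1 / (1 - r)); split; first exact: num_real.
  by move=> y My x Dx /=; rewrite ger0_norm// ltW.
rewrite ler_pdivlMr ?mulr_gt0// in Hn'.
have -> : 2 * (2 * r ^+ n.+1 / (1 - r) * m) = 4 * r ^+ n.+1 * m / (1 - r) by field; lra.
rewrite ler_pdivrMr//; have : 0 <= r ^+ n.+1 by rewrite exprn_ge0.
nra.
Qed.

(** Bounded by 1 on the disc, as the Herglotz integral has nonnegative real
    part. It is a singular inner function if mu is a singular measure on the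
    circle, and it serves for outer functions if mu has a density or the poles
    are off the circle. *)
Definition inner z := expC (- herglotz z).

Lemma nc_inner z : nc (inner z) = expR (- Re (herglotz z)).
Proof. by rewrite nc_expC cReN. Qed.

Lemma nc_inner_le1 z : nc z < 1 -> nc (inner z) <= 1.
Proof. by move=> z1; rewrite nc_inner expR_le1 oppr_le0 Re_herglotz_ge0. Qed.

Lemma inner0 : inner 0 = (expR (- fine (mu D)))%:C%C.
Proof.
by rewrite /inner herglotz0 expCE cReN cImN /= oppr0 expi0 mulr1.
Qed.

Lemma poly_approx_inner r : 0 <= r < 1 -> poly_approx r inner.
Proof.
move=> r01; have /andP[r0 _] := r01; apply: poly_approx_expC => //.
apply: (@poly_approx_eq _ _ (fun z => -1 * herglotz z)) => [z _|]; first by rewrite mulN1r.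
by apply: poly_approxM => //; [exact: poly_approx_cst|exact: poly_approx_herglotz].
Qed.

End Herglotz.

(** * Continuous complex functions on segments *)

Section CircleIntegral.
Variable R : realType.
Local Notation C := R[i].
Local Notation nc := (@Normc.normc R).
Local Notation Re := (@complex.Re R).
Local Notation Im := (@complex.Im R).
Local Notation leb := (@lebesgue_measure R).
Implicit Types (f g : R -> C) (a b c r s t : R).

Definition ccont f := continuous (fun t => Re (f t)) /\ continuous (fun t => Im (f t)).

Lemma ccont_ext f g : f =1 g -> ccont f -> ccont g.
Proof. by move=> /funext ->. Qed.

Lemma ccont_cst (z : C) : ccont (fun=> z).
Proof. by split => t; exact: cvg_cst. Qed.

Lemma ccontD f g : ccont f -> ccont g -> ccont (fun t => f t + g t).
Proof.
move=> [f1 f2] [g1 g2]; split => t.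
  by under eq_fun do rewrite cReD; apply: cvgD; [exact: f1|exact: g1].
by under eq_fun do rewrite cImD; apply: cvgD; [exact: f2|exact: g2].
Qed.

Lemma ccontM f g : ccont f -> ccont g -> ccont (fun t => f t * g t).
Proof.
move=> [f1 f2] [g1 g2]; split => t.
  under eq_fun do rewrite cReM.
  by apply: cvgB; apply: cvgM; [exact: f1|exact: g1|exact: f2|exact: g2].
under eq_fun do rewrite cImM.
by apply: cvgD; apply: cvgM; [exact: f1|exact: g2|exact: f2|exact: g1].
Qed.

Lemma ccontB f g : ccont f -> ccont g -> ccont (fun t => f t - g t).
Proof.
move=> cf cg; apply: ccontD => //.
apply: (@ccont_ext (fun t => -1 * g t)); first by move=> t; rewrite mulN1r.
by apply: ccontM => //; exact: ccont_cst.
Qed.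

Lemma ccont_conj f : ccont f -> ccont (fun t => (f t)^*%C).
Proof.
move=> [f1 f2]; split => t; first by under eq_fun do rewrite cRe_conj; exact: f1.
by under eq_fun do rewrite cIm_conj; apply: cvgN; exact: f2.
Qed.

Lemma continuous_nc f : ccont f -> continuous (fun t => nc (f t)).
Proof.
move=> [f1 f2] t; under eq_fun do rewrite ncE.
apply: continuous_comp; last exact: sqrt_continuous.
by apply: cvgD; rewrite !expr2; under eq_fun do rewrite expr2;
  apply: cvgM; [exact: f1|exact: f1|exact: f2|exact: f2].
Qed.

Lemma ccont_expi c : ccont (fun t => expi (c * t)).
Proof.
split => t.
  apply: (@continuous_comp _ _ _ ( *%R c) cos); first exact: mulrl_continuous.
  exact: continuous_cos.
apply: (@continuous_comp _ _ _ ( *%R c) sin); first exact: mulrl_continuous.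
exact: continuous_sin.
Qed.

Lemma ccont_expi1 : ccont (@expi R).
Proof. by apply: ccont_ext (ccont_expi 1) => t; rewrite mul1r. Qed.

Lemma ccont_lim f : (forall e, 0 < e -> exists2 g, ccont g & forall t, nc (f t - g t) <= e) ->
  ccont f.
Proof.
move=> H; split => t; apply/cvgrPdist_le => e e0;
  have e3 : 0 < e / 3 by [rewrite divr_gt0];
  have [g [g1 g2] fg] := H _ e3.
  have /cvgrPdist_le/(_ _ e3) := g1 t; apply: filterS => s gs.
  have h1 := fg t; have h2 := fg s.
  have := le_trans (ler_Re _) h1; have := le_trans (ler_Re _) h2.
  move: gs; rewrite !cReD !cReN !ler_norml => /andP[? ?] /andP[? ?] /andP[? ?].
  by apply/andP; split; lra.
have /cvgrPdist_le/(_ _ e3) := g2 t; apply: filterS => s gs.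
have h1 := fg t; have h2 := fg s.
have := le_trans (ler_Im _) h1; have := le_trans (ler_Im _) h2.
move: gs; rewrite !cImD !cImN !ler_norml => /andP[? ?] /andP[? ?] /andP[? ?].
by apply/andP; split; lra.
Qed.

Definition polar r t : C := r%:C%C * expi t.

Lemma nc_polar r t : 0 <= r -> nc (polar r t) = r.
Proof. by move=> r0; rewrite Normc.normcM nc_expi mulr1 nc_real ger0_norm. Qed.

Lemma nc_polarB r s t : 0 <= r -> nc (polar r s - polar r t) = r * nc (expi s - expi t).
Proof. by move=> r0; rewrite -mulrBr Normc.normcM nc_real ger0_norm. Qed.

Lemma ccont_poly r (q : {poly C}) : ccont (fun t => q.[polar r t]).
Proof.
elim/poly_ind: q => [|q c IH].
  by apply: ccont_ext (ccont_cst 0) => t; rewrite horner0.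
have : ccont (fun t => q.[polar r t] * polar r t + c).
  apply: ccontD; last exact: ccont_cst.
  by apply: ccontM => //; apply: ccontM; [exact: ccont_cst|exact: ccont_expi1].
by apply: ccont_ext => t; rewrite !hornerE.
Qed.

Lemma ccont_poly_approx r (G : C -> C) : 0 <= r -> poly_approx r G ->
  ccont (fun t => G (polar r t)).
Proof.
move=> r0 PG; apply: ccont_lim => e /PG[q qG].
by exists (fun t => q.[polar r t]); [exact: ccont_poly|move=> t; apply: qG; rewrite nc_polar].
Qed.

Definition segint a b f := cint leb `[a, b] f.

Lemma continuous_integrable_seg a b (h : R -> R) : continuous h ->
  leb.-integrable `[a, b] (EFin \o h).
Proof.
move=> ch; apply: continuous_compact_integrable; first exact: segment_compact.
exact: continuous_subspaceT.
Qed.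

Lemma ccont_integrable a b f : ccont f -> cintegrable leb `[a, b] f.
Proof. by move=> [f1 f2]; split; exact: continuous_integrable_seg. Qed.

Lemma segintD a b f g : ccont f -> ccont g ->
  segint a b (fun t => f t + g t) = segint a b f + segint a b g.
Proof. by move=> cf cg; apply: cintD => //; exact: ccont_integrable. Qed.

Lemma segintB a b f g : ccont f -> ccont g ->
  segint a b (fun t => f t - g t) = segint a b f - segint a b g.
Proof. by move=> cf cg; apply: cintB => //; exact: ccont_integrable. Qed.

Lemma segintZ a b (z : C) f : ccont f -> segint a b (fun t => z * f t) = z * segint a b f.
Proof. by move=> cf; apply: cintZ => //; exact: ccont_integrable. Qed.

Lemma segint_sum a b (F : nat -> R -> C) n : (forall i, ccont (F i)) ->
  segint a b (fun t => \sum_(i < n) F i t) = \sum_(i < n) segint a b (F i).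
Proof.
move=> cF; apply: (proj2 (cint_sum _ _ _ _)) => //.
  exact: ccont_integrable (ccont_cst 0).
by move=> i; exact: ccont_integrable.
Qed.

Lemma nc_segint a b f (M : R) : a <= b -> ccont f ->
  (forall t, a <= t <= b -> nc (f t) <= M) -> nc (segint a b f) <= 2 * (M * (b - a)).
Proof.
move=> ab cf fM.
have E : fine (leb `[a, b]) = b - a.
  rewrite lebesgue_measure_itv/= lte_fin; case: ltP => [_|ba]; first by rewrite -EFinB.
  by rewrite /=; lra.
rewrite -E -Rintegral_cst//; apply: nc_cint_le => //; first exact: ccont_integrable.
  by apply: (@continuous_integrable_seg a b (fun=> M)) => t; exact: cvg_cst.
Qed.

Lemma segint_split a b c f : a <= b -> b <= c -> ccont f ->
  segint a c f = segint a b f + segint b c f.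
Proof.
move=> ab bc [f1 f2].
have aux (h : R -> R) : continuous h ->
    \int[leb]_(x in `[a, c]) h x = \int[leb]_(x in `[a, b]) h x + \int[leb]_(x in `[b, c]) h x.
  move=> ch.
  have := @Rintegral_itvB _ h (BLeft a) (BRight c) b (continuous_integrable_seg a c ch).
  rewrite !bnd_simp => /(_ ab bc) => E.
  rewrite -[LHS](subrK (\int[leb]_(x in `[a, b]) h x)) E addrC; congr (_ + _).
  apply: Rintegral_itv_obnd_cbnd.
  apply: (integrableS _ _ _ (continuous_integrable_seg b c ch)) => //.
  by apply: subset_itvr; rewrite bnd_simp.
by apply: complex_eq; rewrite /= aux.
Qed.

(** The primitive [e^{ict} / (ic)] takes the same value at both ends; its real
    and imaginary parts are treated separately. *)
Lemma segint_expi a b c : a < b -> c != 0 -> expi (c * a) = expi (c * b) ->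
  segint a b (fun t => expi (c * t)) = 0.
Proof.
move=> ab c0 [E1 E2].
have FTC (F f : R -> R) : (forall x : R, is_derive x 1 F (f x)) -> continuous f ->
    F a = F b -> \int[leb]_(x in `[a, b]) f x = 0.
  move=> dF cf Fab; rewrite /Rintegral (@continuous_FTC2 _ f F a b ab) ?Fab ?subee//.
  - exact: continuous_subspaceT.
  - have cF : continuous F.
      by move=> x; apply: differentiable_continuous; apply/derivable1_diffP; have [] := dF x.
    split => [x _| |]; first by have [] := dF x.
      exact: cvg_at_right_filter (cF a).
    exact: cvg_at_left_filter (cF b).
  - by move=> x _; rewrite derive1E; have [_ ->] := dF x.
apply: complex_eq => /=.
  apply: (@FTC (fun t => c^-1 * sin (c * t))); last by rewrite E2.
    move=> x; have H : is_derive x 1 (fun t => sin (c * t)) (cos (c * x) * c).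
      have := @is_derive1_comp _ sin ( *%R c) x (cos (c * x)) c; apply.
      have := @is_deriveZ _ _ _ id c x 1 1 (is_derive_id x 1).
      by rewrite /GRing.scale/= mulr1.
    have := @is_deriveZ _ _ _ (fun t => sin (c * t)) c^-1 x 1 _ H.
    by rewrite /GRing.scale/= mulrCA mulVf// mulr1.
  by case: (ccont_expi c).
apply: (@FTC (fun t => - c^-1 * cos (c * t))); last by rewrite E1.
  move=> x; have H : is_derive x 1 (fun t => cos (c * t)) (- sin (c * x) * c).
    have := @is_derive1_comp _ cos ( *%R c) x (- sin (c * x)) c; apply.
    have := @is_deriveZ _ _ _ id c x 1 1 (is_derive_id x 1).
    by rewrite /GRing.scale/= mulr1.
  have := @is_deriveZ _ _ _ (fun t => cos (c * t)) (- c^-1) x 1 _ H.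
  have e : - c^-1 * (- sin (c * x) * c) = sin (c * x) by field.
  by rewrite /GRing.scale/= e.
by case: (ccont_expi c).
Qed.

End CircleIntegral.

(** * Fourier coefficients on circles *)

Section FourierCoefficients.
Variable R : realType.
Local Notation C := R[i].
Local Notation nc := (@Normc.normc R).
Implicit Types (f : R -> C) (G : C -> C) (r : R) (q : {poly C}).

Definition circint f : C := segint 0 (2 * pi) f.

Let twopi_gt0 : 0 < 2 * pi :> R. Proof. by rewrite mulr_gt0 ?pi_gt0. Qed.

Lemma nc_circint f (M : R) : ccont f -> (forall t, 0 <= t <= 2 * pi -> nc (f t) <= M) ->
  nc (circint f) <= 4 * pi * M.
Proof.
move=> cf fM; have := nc_segint (ltW twopi_gt0) cf fM; rewrite subr0.
by rewrite (_ : 2 * (M * (2 * pi)) = 4 * pi * M) //; ring.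
Qed.

(** [0, 2 pi] is the union of k + 1 periods of the exponential. On each of
    them the exponential has mean zero, so f may be replaced by its increment,
    which is O(L / k). *)
Lemma fourier_lipschitz f (L : R) (k : nat) : ccont f ->
  (forall s t, 0 <= s <= 2 * pi -> 0 <= t <= 2 * pi -> nc (f s - f t) <= L * `|s - t|) ->
  nc (circint (fun t => expi (k.+1%:R * t) * f t)) <= 8 * pi ^+ 2 * L / k.+1%:R.
Proof.
move=> cf fL; set n := k.+1; pose N : R := n%:R; rewrite -/N.
have N0 : 0 < N by rewrite ltr0n.
pose h := 2 * pi / N; have h0 : 0 < h by rewrite divr_gt0.
have nh : N * h = 2 * pi by rewrite mulrC divfK// gt_eqF.
have L0 : 0 <= L.
  have := fL 0 (2 * pi); rewrite !lexx (ltW twopi_gt0) sub0r normrN gtr0_norm//.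
  by move=> /(_ isT isT)/(le_trans (nc_ge0 _)); rewrite pmulr_lge0.
have cg : ccont (fun t => expi (N * t) * f t) by apply: ccontM => //; exact: ccont_expi.
have piece a : 0 <= a -> a + h <= 2 * pi ->
    nc (segint a (a + h) (fun t => expi (N * t) * f t)) <= 2 * (L * h * h).
  move=> a0 ah.
  have cfa : ccont (fun t => f t - f a) by apply: ccontB => //; exact: ccont_cst.
  have -> : segint a (a + h) (fun t => expi (N * t) * f t) =
            segint a (a + h) (fun t => expi (N * t) * (f t - f a)).
    have E : segint a (a + h) (fun t => f a * expi (N * t)) = 0.
      rewrite segintZ; last exact: ccont_expi.
      rewrite segint_expi ?mulr0// ?ltrDl ?gt_eqF//.
      by rewrite mulrDr nh expiD2pi.
    rewrite -[RHS]addr0 -E -segintD; last 2 first.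
    - by apply: ccontM => //; exact: ccont_expi.
    - by apply: ccontM; [exact: ccont_cst|exact: ccont_expi].
    by apply: eq_cint => t _; ring.
  have ha : a <= a + h by rewrite lerDl ltW.
  have := @nc_segint _ a (a + h) (fun t => expi (N * t) * (f t - f a)) (L * h) ha.
  rewrite addrAC subrr add0r; apply.
    by apply: ccontM => //; exact: ccont_expi.
  move=> t /andP[at1 at2]; rewrite Normc.normcM nc_expi mul1r.
  rewrite (le_trans (fL t a _ _))//; last 1 first.
  - by rewrite ler_wpM2l// ger0_norm ?subr_ge0//; lra.
  - by apply/andP; split; lra.
  - by apply/andP; split; lra.
have ind j : (j <= n)%N ->
    nc (segint 0 (j%:R * h) (fun t => expi (N * t) * f t)) <= j%:R * (2 * (L * h * h)).
  elim: j => [_|j IH jn].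
    rewrite !mul0r; have := @nc_segint _ 0 0 (fun t => expi (N * t) * f t) (nc (f 0)) (lexx _) cg.
    rewrite subrr !mulr0; apply => t /andP[t0 t1].
    have -> : t = 0 by apply/eqP; rewrite eq_le t0 t1.
    by rewrite Normc.normcM nc_expi mul1r.
  have jN : (j.+1%:R : R) <= N by rewrite ler_nat.
  have j0 : 0 <= j%:R * h by rewrite mulr_ge0// ltW.
  have e : j.+1%:R * h = j%:R * h + h by rewrite -natr1 mulrDl mul1r.
  have le2 : j.+1%:R * h <= 2 * pi by rewrite -nh ler_pM2r.
  rewrite (@segint_split _ 0 (j%:R * h))//; last by rewrite e lerDl ltW.
  have -> : j.+1%:R * (2 * (L * h * h)) = j%:R * (2 * (L * h * h)) + 2 * (L * h * h).
    by rewrite -natr1; ring.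
  rewrite (le_trans (ncD _ _))// lerD ?IH//; first exact: ltnW.
  by rewrite e piece// -e.
have := ind n (leqnn n); rewrite -/N nh => /le_trans; apply.
rewrite le_eqVlt; apply/orP; left; apply/eqP; rewrite /h; field.
by rewrite gt_eqF.
Qed.

Lemma expi_2pin (n : nat) : expi (n%:R * (2 * pi)) = 1 :> C.
Proof. by rewrite -[X in expi X]add0r expiDnpi expi0. Qed.

Lemma circint_expi (c : R) : c != 0 -> expi (c * (2 * pi)) = 1 -> circint (fun t => expi (c * t)) = 0.
Proof. by move=> c0 cE; apply: segint_expi => //; rewrite mulr0 expi0 cE. Qed.

Lemma circint_cst (z : C) : circint (fun=> z) = (2 * pi)%:C%C * z.
Proof.
have E : fine (@lebesgue_measure R `[0, 2 * pi]) = 2 * pi.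
  by rewrite lebesgue_measure_itv/= lte_fin twopi_gt0 /= oppr0 addr0.
apply: complex_eq; rewrite /= Rintegral_cst// E ?cReM ?cImM /=; case: z => a b /=; ring.
Qed.

Lemma horner_polar q r t : q.[polar r t] = \sum_(i < size q) (q`_i * r%:C%C ^+ i) * expi (i%:R * t).
Proof. by rewrite horner_coef; apply: eq_bigr => i _; rewrite exprMn mulrA expiX. Qed.

Lemma circint_expi_poly (j : nat) r q : (0 < j)%N ->
  circint (fun t => expi (j%:R * t) * q.[polar r t]) = 0.
Proof.
move=> j0.
have -> : circint (fun t => expi (j%:R * t) * q.[polar r t]) =
    circint (fun t => \sum_(i < size q) (q`_i * r%:C%C ^+ i) * expi ((j + i)%:R * t)).
  apply: eq_cint => t _; rewrite horner_polar mulr_sumr; apply: eq_bigr => i _.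
  by rewrite mulrCA -expiD -mulrDl -natrD.
have cF (i : nat) : ccont (fun t => (q`_i * r%:C%C ^+ i) * expi ((j + i)%:R * t)).
  by apply: ccontM; [exact: ccont_cst|exact: ccont_expi].
rewrite [LHS](segint_sum _ _ _ cF) big1// => i _.
rewrite segintZ; last exact: ccont_expi.
by rewrite -/(circint _) circint_expi ?mulr0 ?expi_2pin// pnatr_eq0 -lt0n addn_gt0 j0.
Qed.

Lemma circint_expi_conj_poly (j : nat) r q :
  circint (fun t => expi (j%:R * t) * (q.[polar r t])^*%C) =
  (2 * pi)%:C%C * (q`_j * r%:C%C ^+ j)^*%C.
Proof.
pose F (i : nat) t : C := (q`_i * r%:C%C ^+ i)^*%C * expi ((j%:R - i%:R) * t).
have cF i : ccont (F i) by apply: ccontM; [exact: ccont_cst|exact: ccont_expi].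
have Fi (i : nat) : circint (F i) = if i == j then (2 * pi)%:C%C * (q`_j * r%:C%C ^+ j)^*%C else 0.
  rewrite [LHS]segintZ; last exact: ccont_expi.
  have [->|ij] := eqVneq i j.
    rewrite mulrC; congr (_ * _).
    have -> : segint 0 (2 * pi) (fun t => expi ((j%:R - j%:R) * t)) = circint (fun=> 1).
      by apply: eq_cint => t _; rewrite subrr mul0r expi0.
    by rewrite circint_cst mulr1.
  rewrite -/(circint _) circint_expi ?mulr0//; first by rewrite subr_eq0 eqr_nat eq_sym.
  by rewrite mulrBl expiD expiN !expi_2pin conjc1 mulr1.
have -> : circint (fun t => expi (j%:R * t) * (q.[polar r t])^*%C) =
    circint (fun t => \sum_(i < size q) F i t).
  apply: eq_cint => t _; rewrite horner_polar raddf_sum mulr_sumr; apply: eq_bigr => i _.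
  rewrite -[X in _ * X = _]/((_ * _)^*%C) cconjM -expiN mulrCA -expiD.
  by rewrite /F mulrBl.
rewrite [LHS](segint_sum _ _ _ cF) (eq_bigr _ (fun (i : 'I__) _ => Fi i)).
rewrite -big_mkcond /=; have [jq|jq] := ltnP j (size q).
  by rewrite (big_pred1 (Ordinal jq))// => i /=; rewrite -val_eqE.
rewrite big_pred0 => [|i]; first by rewrite nth_default// mul0r conjc0 mulr0.
by apply/negbTE; rewrite neq_ltn (leq_trans _ jq)// ltn_ord.
Qed.

Lemma nc_small_eq0 (z : C) (c : R) : (forall e, 0 < e -> nc z <= c * e) -> z = 0.
Proof.
move=> H; apply/eqP; rewrite -nc_eq0 eq_le nc_ge0 andbT.
apply/ler_addgt0Pr => e e0; rewrite add0r.
have c1 : 0 < `|c| + 1 by rewrite ltr_wpDl.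
have := H (e / (`|c| + 1)) (divr_gt0 e0 c1); move=> /le_trans; apply.
have e2 : 0 <= e / (`|c| + 1) by rewrite divr_ge0 ?ltW.
rewrite (@le_trans _ _ ((`|c| + 1) * (e / (`|c| + 1))))//.
  by rewrite ler_wpM2r//; have := ler_norm c; lra.
by rewrite mulrC divfK// gt_eqF.
Qed.

Lemma circint_conj f : ccont f -> circint (fun t => (f t)^*%C) = (circint f)^*%C.
Proof.
move=> [_ f2]; apply: complex_eq; rewrite ?cRe_conj ?cIm_conj /=.
  by apply: eq_Rintegral => t _; rewrite cRe_conj.
under eq_Rintegral do rewrite cIm_conj -mulN1r.
by rewrite RintegralZl ?mulN1r//; exact: continuous_integrable_seg.
Qed.

(** Cauchy's theorem for circles: times e^{ijt}, a polynomial has only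
    positive frequencies. *)
Lemma circint_expi_approx (j : nat) r G : 0 <= r -> (0 < j)%N -> poly_approx r G ->
  circint (fun t => expi (j%:R * t) * G (polar r t)) = 0.
Proof.
move=> r0 j0 PG; have cG := ccont_poly_approx r0 PG.
have ce := @ccont_expi R j%:R.
apply: (@nc_small_eq0 _ (4 * pi)) => e e0; have [q qG] := PG _ e0.
rewrite -[X in nc X]subr0 -(circint_expi_poly r q j0) -segintB; last 2 first.
- exact: ccontM.
- by apply: ccontM => //; exact: ccont_poly.
apply: nc_circint => [|t _].
  by apply: ccontB; apply: ccontM => //; exact: ccont_poly.
by rewrite -mulrBr Normc.normcM nc_expi mul1r qG// nc_polar.
Qed.

Lemma circint_mean r G : 0 <= r -> poly_approx r G ->
  circint (fun t => G (polar r t)) = (2 * pi)%:C%C * G 0.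
Proof.
move=> r0 PG; have cG := ccont_poly_approx r0 PG.
apply/eqP; rewrite -subr_eq0; apply/eqP.
apply: (@nc_small_eq0 _ (6 * pi)) => e e0; have [q qG] := PG _ e0.
have qE : circint (fun t => q.[polar r t]) = (2 * pi)%:C%C * q.[0].
  pose p := q - q.[0]%:P.
  have p0 : p`_0 = 0 by rewrite -horner_coef0 hornerD hornerN hornerC subrr.
  have := circint_expi_conj_poly 0 r p; rewrite p0 mul0r conjc0 mulr0 => E.
  have cp := ccont_poly r p.
  have E2 : circint (fun t => p.[polar r t]) = 0.
    apply/eqP; rewrite -conjc_eq0 -circint_conj//; apply/eqP; rewrite -[RHS]E.
    by apply: eq_cint => t _; rewrite mul0r expi0 mul1r.
  apply/eqP; rewrite -subr_eq0 -(circint_cst q.[0]) -segintB; last 2 first.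
  - exact: ccont_poly.
  - exact: ccont_cst.
  rewrite -[X in _ == X]E2; apply/eqP; apply: eq_cint => t _.
  by rewrite /p hornerD hornerN hornerC.
have -> : circint (fun t => G (polar r t)) - (2 * pi)%:C%C * G 0 =
   circint (fun t => G (polar r t) - q.[polar r t]) + (2 * pi)%:C%C * (q.[0] - G 0).
  rewrite [circint (fun t => _ - _)]segintB//; last exact: ccont_poly.
  by move: qE; rewrite /circint => ->; ring.
rewrite (le_trans (ncD _ _))//.
have h1 : nc (circint (fun t => G (polar r t) - q.[polar r t])) <= 4 * pi * e.
  apply: nc_circint => [|t _]; first by apply: ccontB => //; exact: ccont_poly.
  by rewrite qG// nc_polar.
have h2 : nc ((2 * pi)%:C%C * (q.[0] - G 0)) <= 2 * pi * e.
  by rewrite Normc.normcM nc_real gtr0_norm// ler_wpM2l ?(ltW twopi_gt0)// ncB qG// Normc.normc0.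
lra.
Qed.

(** Up to the factor 2 pi the integral is the conjugate of the j-th Taylor
    coefficient times r^j, which grows with r. So estimates near the unit
    circle carry over to all smaller circles. *)
Lemma circint_expi_conj_le (j : nat) (r r' : R) G : 0 <= r -> r <= r' -> poly_approx r' G ->
  nc (circint (fun t => expi (j%:R * t) * (G (polar r t))^*%C)) <=
  nc (circint (fun t => expi (j%:R * t) * (G (polar r' t))^*%C)).
Proof.
move=> r0 rr PG; have r'0 := le_trans r0 rr.
have cGr (s : R) : 0 <= s -> s <= r' -> ccont (fun t => G (polar s t)).
  by move=> s0 sr; apply: ccont_poly_approx => //; exact: poly_approx_le PG.
have ce := @ccont_expi R j%:R.
have pi0 := pi_gt0 R.
apply/ler_addgt0Pr => e' e0'; pose e : R := e'; rewrite -/e.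
have e0 : 0 < e by []; have e1 : 0 < e / (8 * pi) by rewrite divr_gt0 ?mulr_gt0.
have [q qG] := PG _ e1.
have close (s : R) : 0 <= s -> s <= r' ->
    nc (circint (fun t => expi (j%:R * t) * (G (polar s t))^*%C) -
        circint (fun t => expi (j%:R * t) * (q.[polar s t])^*%C)) <= e / 2.
  move=> s0 sr; have cG := cGr s s0 sr.
  rewrite -segintB; [|by apply: ccontM => //; apply: ccont_conj => //; exact: ccont_poly..].
  have E (a p : R) : 0 < p -> a / 2 = 4 * p * (a / (8 * p)).
    by move=> p0; field; exact: lt0r_neq0.
  rewrite (E _ _ pi0).
  apply: nc_circint => [|t _].
    by apply: ccontB; apply: ccontM => //; apply: ccont_conj => //; exact: ccont_poly.
  rewrite -mulrBr Normc.normcM nc_expi mul1r -rmorphB nc_conj qG// nc_polar//.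
have h1 := close r r0 rr; have h2 := close r' r'0 (lexx _).
have h3 : nc (circint (fun t => expi (j%:R * t) * (q.[polar r t])^*%C)) <=
          nc (circint (fun t => expi (j%:R * t) * (q.[polar r' t])^*%C)).
  have nq (s : R) : 0 <= s -> nc ((2 * pi)%:C%C * (q`_j * s%:C%C ^+ j)^*%C) =
      2 * pi * (nc q`_j * s ^+ j).
    move=> s0; rewrite Normc.normcM nc_conj Normc.normcM ncX.
    by rewrite nc_real (gtr0_norm twopi_gt0) nc_real (ger0_norm s0).
  rewrite (circint_expi_conj_poly j r q) (circint_expi_conj_poly j r' q) nq// nq//.
  by rewrite ler_wpM2l ?(ltW twopi_gt0)// ler_wpM2l ?nc_ge0// lerXn2r ?nnegrE.
move: h1 h2 h3; move: (circint _) (circint _) (circint _) (circint _) => a b c d h1 h2 h3.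
have := nc_rev a b; have := nc_rev d c; rewrite (ncB a b); lra.
Qed.

End FourierCoefficients.

(** * Power series and the pairing with l^p *)

Section PowerSeries.
Variable R : realType.
Local Notation C := R[i].
Local Notation nc := (@Normc.normc R).
Implicit Types (f g : C -> C) (a : nat -> C) (r : R) (z : C).

Lemma cvgC_nc (u : nat -> C) (l : C) :
  ((u : nat -> C^o) @ \oo --> (l : C^o)) <->
  (forall e : R, 0 < e -> exists N : nat, forall n, (N <= n)%N -> nc (l - u n) <= e).
Proof.
split.
  move=> /cvgrPdist_le H e e0.
  have /H[N _ HN] : (0 : C) < e%:C%C by rewrite ltcR.
  by exists N => n /HN; rewrite normc_abs lecR.
move=> H; apply/cvgrPdist_le => -[e e'].
rewrite ltcE/= => /andP[/eqP -> e0].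
have [N HN] := H _ e0; exists N => // n /HN le; rewrite normc_abs.
by rewrite -[X in _ <= X]/(e%:C%C) lecR.
Qed.

Definition partial_sum a n : {poly C} := \poly_(k < n) a k.

Lemma partial_sumE a n z : (partial_sum a n).[z] = series (fun k => a k * z ^+ k) n.
Proof. by rewrite horner_poly /series /= big_mkord. Qed.

(** At a radius s between r and 1 the terms are bounded, so on the disc of
    radius r they are dominated by a geometric series of ratio r / s. *)
Lemma power_series_uniform f a r e : power_series_on_disc f a -> 0 <= r < 1 -> 0 < e ->
  exists N : nat, forall n, (N <= n)%N -> forall z, nc z <= r ->
    nc (f z - (partial_sum a n).[z]) <= e.
Proof.
move=> fa /andP[r0 r1] e0.
pose s := (r + 1) / 2; have rs : r < s by rewrite /s; lra.
have s1 : s < 1 by rewrite /s; lra.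
have s0 : 0 < s by lra.
(* terms are differences of consecutive partial sums, which converge *)
have [M M0 HM] : exists2 M : R, 0 < M & forall k, nc (a k) * s ^+ k <= M.
  have z1 : `|s%:C%C : C| < 1 by rewrite normc_abs nc_real gtr0_norm// ltcR.
  have /cvgC_nc/(_ 1 ltr01)[N HN] := fa _ z1.
  exists (2 + \sum_(k < N) nc (a k) * s ^+ k).
    rewrite ltr_pwDl// sumr_ge0// => i _; rewrite mulr_ge0 ?nc_ge0 ?exprn_ge0//.
    exact: ltW.
  move=> k; have [kN|Nk] := ltnP k N.
    rewrite (bigD1 (Ordinal kN))//= addrCA lerDl addr_ge0// sumr_ge0// => i _.
    by rewrite mulr_ge0 ?nc_ge0 ?exprn_ge0// ltW.
  have h1 := HN _ Nk; have h2 := HN _ (leqW Nk).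
  have -> : nc (a k) * s ^+ k = nc (series (fun k => a k * s%:C%C ^+ k) k.+1 -
                                    series (fun k => a k * s%:C%C ^+ k) k).
    rewrite seriesSB Normc.normcM ncX nc_real gtr0_norm//.
  rewrite ncB in h2; apply: le_trans (nc_tri _ (f s%:C%C) _) _.
  rewrite (@le_trans _ _ 2) ?lerDl ?sumr_ge0//; last first.
    by move=> i _; rewrite mulr_ge0 ?nc_ge0 ?exprn_ge0// ltW.
  lra.
pose q := r / s; have q0 : 0 <= q by rewrite divr_ge0// ltW.
have q1 : q < 1 by rewrite ltr_pdivrMr// mul1r.
have term k z : nc z <= r -> nc (a k * z ^+ k) <= M * q ^+ k.
  move=> zr; rewrite Normc.normcM ncX /q exprMn exprVn mulrA ler_pdivlMr ?exprn_gt0//.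
  rewrite mulrAC; apply: ler_pM; rewrite ?mulr_ge0 ?exprn_ge0 ?nc_ge0//; first exact: ltW.
  by rewrite lerXn2r ?nnegrE ?nc_ge0.
have geo m n : (1 - q) * \sum_(m <= k < m + n) q ^+ k <= q ^+ m.
  elim: n => [|n IH]; first by rewrite addn0 big_geq// mulr0 exprn_ge0.
  have E : (1 - q) * \sum_(m <= k < m + n) q ^+ k = q ^+ m - q ^+ (m + n).
    elim: {IH} n => [|n IH]; first by rewrite addn0 big_geq// mulr0 subrr.
    rewrite addnS big_nat_recr ?leq_addr//= mulrDr IH exprS; ring.
  have E' : (1 - q) * \sum_(m <= k < m + n.+1) q ^+ k = q ^+ m - q ^+ (m + n.+1).
    by rewrite addnS big_nat_recr ?leq_addr//= mulrDr E exprS; ring.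
  by rewrite E' gerBl exprn_ge0.
have [N HN] := @exprn_small R q (e * (1 - q) / (2 * M)) ltac:(by rewrite q0 q1)
  ltac:(by rewrite divr_gt0 ?mulr_gt0// subr_gt0).
exists N.+1 => n Nn z zr.
have z1 : `|z| < 1 by rewrite normc_abs ltcR (le_lt_trans zr).
have /cvgC_nc/(_ (e / 2) (divr_gt0 e0 (ltr0Sn _ 1)))[N' HN'] := fa _ z1.
have h1 := HN' (n + N')%N (leq_addl _ _).
rewrite (le_trans (nc_tri _ (series (fun k => a k * z ^+ k) (n + N')%N) _))//.
have h2 : nc (series (fun k => a k * z ^+ k) (n + N')%N - (partial_sum a n).[z]) <= e / 2.
  rewrite partial_sumE /series /= (big_cat_nat (n := n))//= ?leq_addr//.
  rewrite addrAC subrr add0r (le_trans (nc_sum _ _ _))//.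
  apply: (@le_trans _ _ (M * \sum_(n <= k < n + N') q ^+ k)).
    by rewrite mulr_sumr; apply: ler_sum => k _; exact: term.
  have := geo n N'; set S := \sum_(_ <= _ < _) _ => hS.
  have hq : q ^+ n <= q ^+ N.+1 by rewrite ler_wiXn2l// ltW.
  rewrite ler_pdivlMr ?mulr_gt0// in HN.
  have qq : 0 < 1 - q by rewrite subr_gt0.
  rewrite -(ler_pM2r qq).
  have : M * ((1 - q) * S) <= M * q ^+ N.+1 by rewrite ler_pM2l// (le_trans hS).
  lra.
lra.
Qed.

Lemma poly_approx_power_series f a r : power_series_on_disc f a -> 0 <= r < 1 ->
  poly_approx r f.
Proof.
move=> fa r01 e e0; have [N HN] := power_series_uniform fa r01 e0.
by exists (partial_sum a N); exact: HN.
Qed.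

Lemma analytic_cst (c : C) : analytic_on_disc (fun=> c).
Proof.
exists (fun k => if k == 0%N then c else 0) => z _; apply/cvgC_nc => e e0.
exists 1%N => -[//|n] _; rewrite /series /= big_nat_recl//= expr0 mulr1 big1 ?addr0.
  by rewrite subrr Normc.normc0 ltW.
by move=> i _; rewrite mul0r.
Qed.

Lemma analyticD f g : analytic_on_disc f -> analytic_on_disc g ->
  analytic_on_disc (fun z => f z + g z).
Proof.
move=> [a fa] [b gb]; exists (fun k => a k + b k) => z z1; apply/cvgC_nc => e e0.
have e2 : 0 < e / 2 by rewrite divr_gt0.
have /cvgC_nc/(_ _ e2)[N HN] := fa z z1; have /cvgC_nc/(_ _ e2)[N' HN'] := gb z z1.
exists (maxn N N') => n; rewrite geq_max => /andP[/HN h1 /HN' h2].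
rewrite (_ : series _ n = series (fun k => a k * z ^+ k) n + series (fun k => b k * z ^+ k) n).
  by rewrite opprD addrACA (le_trans (ncD _ _))//; lra.
by rewrite /series /= -big_split /=; apply: eq_bigr => i _; rewrite mulrDl.
Qed.

Lemma analyticZ (c : C) f : analytic_on_disc f -> analytic_on_disc (fun z => c * f z).
Proof.
move=> [a fa]; exists (fun k => c * a k) => z z1; apply/cvgC_nc => e e0.
have c1 : 0 < nc c + 1 by rewrite ltr_wpDl ?nc_ge0.
have /cvgC_nc/(_ _ (divr_gt0 e0 c1))[N HN] := fa z z1.
exists N => n /HN h1.
rewrite (_ : series _ n = c * series (fun k => a k * z ^+ k) n).
  rewrite -mulrBr Normc.normcM (@le_trans _ _ ((nc c + 1) * (e / (nc c + 1))))//.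
    by rewrite ler_pM ?nc_ge0// lerDl.
  by rewrite mulrC divfK// gt_eqF.
by rewrite /series /= mulr_sumr; apply: eq_bigr => i _; rewrite mulrA.
Qed.

Lemma analyticX f : analytic_on_disc f -> analytic_on_disc (fun z => z * f z).
Proof.
move=> [a fa]; exists (fun k => if k is k'.+1 then a k' else 0) => z z1.
apply/cvgC_nc => e e0.
have c1 : 0 < nc z + 1 by rewrite ltr_wpDl ?nc_ge0.
have /cvgC_nc/(_ _ (divr_gt0 e0 c1))[N HN] := fa z z1.
exists N.+1 => -[//|n] /HN h1.
rewrite (_ : series _ n.+1 = z * series (fun k => a k * z ^+ k) n).
  rewrite -mulrBr Normc.normcM (@le_trans _ _ ((nc z + 1) * (e / (nc z + 1))))//.
    by rewrite ler_pM ?nc_ge0// lerDl.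
  by rewrite mulrC divfK// gt_eqF.
rewrite /series /= big_nat_recl//= mul0r add0r mulr_sumr; apply: eq_bigr => i _.
by rewrite exprS mulrCA.
Qed.

(** Makes the Taylor coefficients of [P S_mu - 1] those of an expansion, which
    is how its l^p norm says something about the function. *)
Lemma analytic_poly (q : {poly C}) f : analytic_on_disc f ->
  analytic_on_disc (fun z => q.[z] * f z).
Proof.
move=> fa; elim/poly_ind: q => [|q c IH].
  suff -> : (fun z => (0 : {poly C}).[z] * f z) = (fun=> 0) by exact: analytic_cst.
  by apply/funext => z; rewrite horner0 mul0r.
suff -> : (fun z => (q * 'X + c%:P).[z] * f z) = (fun z => z * (q.[z] * f z) + c * f z).
  by apply: analyticD; [exact: analyticX|exact: analyticZ].
by apply/funext => z; rewrite hornerD hornerM hornerX hornerC; ring.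
Qed.

Lemma taylor_coefP f : analytic_on_disc f -> power_series_on_disc f (taylor_coef f).
Proof. exact: xgetPex. Qed.

Lemma lp_norm_small p (F : nat -> C -> C) (c : R) : 0 < p -> 0 < c ->
  lp_norm p (F n) @[n --> \oo] --> 0%E ->
  exists n, forall N, \sum_(k < N) nc (taylor_coef (F n) k) `^ p <= c.
Proof.
move=> p0 c0 cv.
have cp : 0 < c `^ p^-1 by rewrite powR_gt0.
have /fine_cvgP[fin /cvgrPdist_lt/(_ _ cp) lt] := cv.
have [n [fn ltn]] : exists n, lp_norm p (F n) \is a fin_num /\
    `|0 - fine (lp_norm p (F n))| < c `^ p^-1.
  have [n _ Hn] := filterI fin lt.
  by exists n; apply: Hn => /=.
exists n => N; rewrite leNgt; apply/negP => cS; move: ltn; apply/negP; rewrite -leNgt.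
rewrite sub0r normrN (le_trans _ (ler_norm _))// -lee_fin fineK// -poweR_EFin.
have le1 : (c%:E <= \sum_(0 <= k <oo) (nc (taylor_coef (F n) k) `^ p)%:E)%E.
  apply: le_trans (nneseries_lim_ge N _); last by move=> i _ _; rewrite lee_fin powR_ge0.
  by rewrite sumEFin lee_fin big_mkord ltW.
apply: gt0_ler_poweR => //; rewrite ?invr_ge0 ?in_itv/= ?leey ?andbT ?lee_fin ?(ltW c0) ?(ltW p0)//.
by rewrite (le_trans _ le1)// lee_fin ltW.
Qed.

(** Cauchy condensation: the terms with [2^n <= k + 1 < 2^(n + 1)] are 2^n in
    number and at most [2^(- n q)] each, so they contribute at most x^n with
    [x = 2^(1 - q) < 1]. *)
Lemma riemann_bounded (q : R) : 1 < q ->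
  exists2 Z : R, 0 < Z & forall N, \sum_(k < N) (k.+1%:R `^ q)^-1 <= Z.
Proof.
move=> q1; pose x : R := 2 `^ (1 - q).
have x0 : 0 < x by rewrite powR_gt0.
have x1 : x < 1.
  rewrite /x (_ : 1 - q = - (q - 1)); last by ring.
  rewrite powRN invf_lt1 ?powR_gt0// -[X in X < _](powRr0 2).
  rewrite lt_neqAle ler_powR ?ler1n ?subr_ge0 ?(ltW q1)// andbT powRr0 eq_sym.
  by rewrite powR_eq1 !negb_or subr_eq0 (gt_eqF q1) -leNgt ler0n andbT pnatr_eq1.
have dyadic n : (1 - x) * \sum_(0 <= k < 2 ^ n - 1) (k.+1%:R `^ q)^-1 <= 1 - x ^+ n.
  elim: n => [|n IH]; first by rewrite expn0 subnn big_geq// mulr0 expr0 subrr.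
  have le1 : (2 ^ n - 1 <= 2 ^ n.+1 - 1)%N by rewrite leq_sub2r// leq_exp2l.
  rewrite (big_cat_nat _ le1)//= mulrDr.
  have h : \sum_(2 ^ n - 1 <= k < 2 ^ n.+1 - 1) (k.+1%:R `^ q)^-1 <= x ^+ n.
    have -> : x ^+ n = \sum_(2 ^ n - 1 <= k < 2 ^ n.+1 - 1) ((2 ^ n)%N%:R `^ q)^-1.
      rewrite sumr_const_nat.
      have -> : (2 ^ n.+1 - 1 - (2 ^ n - 1) = 2 ^ n)%N.
        have : (0 < 2 ^ n)%N by rewrite expn_gt0.
        by rewrite expnS; lia.
      have yE : (2 ^ n)%N%:R = 2 `^ n%:R :> R by rewrite natrX powR_mulrn.
      rewrite -[RHS]mulr_natl yE -powRrM -powRN -powRD; last by rewrite pnatr_eq0 implybT.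
      rewrite /x -powR_mulrn ?powR_ge0// -powRrM; congr (_ `^ _); ring.
    rewrite big_nat_cond [leRHS]big_nat_cond; apply: ler_sum => k /andP[/andP[k1 _] _].
    have kn : (2 ^ n <= k.+1)%N by move: k1; rewrite leq_subLR add1n.
    rewrite lef_pV2 ?posrE ?powR_gt0 ?ltr0n ?expn_gt0//.
    by apply: ge0_ler_powR; rewrite ?nnegrE ?ler_nat// (le_trans _ (ltW q1)).
  have h2 : (1 - x) * \sum_(2 ^ n - 1 <= k < 2 ^ n.+1 - 1) (k.+1%:R `^ q)^-1 <= (1 - x) * x ^+ n.
    by rewrite ler_wpM2l// subr_ge0 ltW.
  rewrite exprS; lra.
exists (1 - x)^-1; first by rewrite invr_gt0 subr_gt0.
move=> N; rewrite -[leRHS]mul1r ler_pdivlMr ?subr_gt0// mulrC.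
have NN : (N <= 2 ^ N - 1)%N by rewrite leq_subRL ?expn_gt0// add1n ltn_expl.
apply: le_trans (_ : 1 - x ^+ N <= 1); last by rewrite gerBl exprn_ge0// ltW.
apply: le_trans (dyadic N); rewrite ler_wpM2l ?subr_ge0 ?(ltW x1)//.
rewrite -(big_mkord xpredT (fun k => (k.+1%:R `^ q)^-1)) (big_cat_nat _ NN)//= lerDl.
by apply: sumr_ge0 => k _; rewrite invr_ge0 powR_ge0.
Qed.

(** Hoelder's inequality against [1 / (k + 1)], which lies in l^q. It is
    obtained from Young's inequality for [x_k / s] and [s / (k + 1)]: s is
    chosen so that the q-th powers sum to at most eta / 2, and then a small
    sum of the p-th powers makes up the rest. *)
Lemma lp_harmonic_small (p eta : R) : 1 < p -> 0 < eta ->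
  exists2 c : R, 0 < c & forall (x : nat -> R) (N : nat), (forall k, 0 <= x k) ->
    \sum_(k < N) x k `^ p <= c -> \sum_(k < N) x k / k.+1%:R <= eta.
Proof.
move=> p1 eta0; have p0 : 0 < p by lra.
pose q := p / (p - 1).
have pm : 0 < p - 1 by lra.
have q1 : 1 < q by rewrite /q ltr_pdivlMr//; lra.
have q0 : 0 < q by lra.
have pq : p^-1 + q^-1 = 1 by rewrite /q; field; rewrite !lt0r_neq0.
have [Z Z0 HZ] := riemann_bounded q1.
pose s := (eta / 2 / Z) `^ q^-1.
have s0 : 0 < s by rewrite powR_gt0// !divr_gt0.
have sq : s `^ q = eta / 2 / Z by rewrite -powRrM mulVf ?gt_eqF// powRr1// ltW// !divr_gt0.
exists (s `^ p * (eta / 2)).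
  by apply: mulr_gt0; [exact: powR_gt0|exact: divr_gt0].
move=> x N x0 H.
have term k : x k / k.+1%:R <= (s `^ p)^-1 * x k `^ p + s `^ q * (k.+1%:R `^ q)^-1.
  have -> : x k / k.+1%:R = (x k * s^-1) * (s * k.+1%:R^-1).
    by rewrite [RHS]mulrA divfK// gt_eqF.
  have k0 : 0 <= k.+1%:R^-1 :> R by rewrite invr_ge0.
  have sV : 0 <= s^-1 by rewrite invr_ge0 ltW.
  apply: le_trans (conjugate_powR (mulr_ge0 (x0 k) sV) (mulr_ge0 (ltW s0) k0) p0 q0 pq) _.
  apply: lerD.
    rewrite powRM// -powR_inv1 ?(ltW s0)// -powRrM mulN1r powRN [leRHS]mulrC.
    by rewrite ler_pdivrMr// ler_peMr ?(ltW p1)// mulr_ge0 ?powR_ge0// invr_ge0 powR_ge0.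
  rewrite powRM ?(ltW s0)// -powR_inv1// -powRrM mulN1r powRN.
  by rewrite ler_pdivrMr// ler_peMr ?(ltW q1)// mulr_ge0 ?powR_ge0// invr_ge0 powR_ge0.
apply: (@le_trans _ _ (\sum_(k < N) ((s `^ p)^-1 * x k `^ p + s `^ q * (k.+1%:R `^ q)^-1))).
  by apply: ler_sum => k _; exact: term.
rewrite big_split /= -!mulr_sumr.
have h1 : (s `^ p)^-1 * \sum_(k < N) x k `^ p <= eta / 2.
  rewrite -(ler_pM2l (powR_gt0 p s0)) mulrA mulfV ?mul1r//.
  exact: lt0r_neq0 (powR_gt0 p s0).
have h2 : s `^ q * \sum_(k < N) (k.+1%:R `^ q)^-1 <= eta / 2.
  by rewrite sq -[leRHS](divfK (lt0r_neq0 Z0)) ler_wpM2l// ltW// !divr_gt0.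
lra.
Qed.

(** Term by term, a_k meets the Fourier coefficient of Phi of index k + m + 1,
    which is at most [B / (k + 1)]. Exchanging sum and integral is avoided by
    replacing f by a partial sum, at an arbitrarily small cost. *)
Lemma power_series_pairing f a r (m : nat) (Phi : R -> C) (B S : R) :
  power_series_on_disc f a -> 0 <= r < 1 -> ccont Phi -> (forall t, nc (Phi t) <= 1) ->
  (forall k, nc (circint (fun t => expi (k.+1%:R * t) * Phi t)) <= B / k.+1%:R) ->
  (forall N, \sum_(k < N) nc (a k) / k.+1%:R <= S) -> 0 <= B ->
  nc (circint (fun t => f (polar r t) * (expi (m.+1%:R * t) * Phi t))) <= B * S.
Proof.
move=> fa r01 cPhi Phi1 HB HS B0; have /andP[r0 r1] := r01.
have cf := ccont_poly_approx r0 (poly_approx_power_series fa r01).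
have ce : ccont (fun t => expi (m.+1%:R * t) * Phi t) by apply: ccontM => //; exact: ccont_expi.
have pi0 := pi_gt0 R.
apply/ler_addgt0Pr => e' e0'; pose e : R := e'; rewrite -/e.
have e0 : 0 < e by []; have e1 : 0 < e / (4 * pi) by rewrite divr_gt0 ?mulr_gt0.
have [N HN] := power_series_uniform fa r01 e1.
have cp : ccont (fun t => (partial_sum a N).[polar r t]) by exact: ccont_poly.
have -> : circint (fun t => f (polar r t) * (expi (m.+1%:R * t) * Phi t)) =
   circint (fun t => (partial_sum a N).[polar r t] * (expi (m.+1%:R * t) * Phi t)) +
   circint (fun t => (f (polar r t) - (partial_sum a N).[polar r t]) * (expi (m.+1%:R * t) * Phi t)).
  rewrite -segintD; [|by apply: ccontM => //; exact: ccontB..].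
  by apply: eq_cint => t _; ring.
rewrite (le_trans (ncD _ _))//; apply: lerD; last first.
  have -> : e = 4 * pi * (e / (4 * pi)) by rewrite mulrC divfK// gt_eqF// mulr_gt0.
  apply: nc_circint => [|t _]; first by apply: ccontM => //; exact: ccontB.
  rewrite Normc.normcM Normc.normcM nc_expi mul1r -[leRHS]mulr1 ler_pM ?nc_ge0//.
  by apply: HN; rewrite ?nc_polar.
pose F (k : nat) t : C := (a k * r%:C%C ^+ k) * (expi ((k + m).+1%:R * t) * Phi t).
have cF k : ccont (F k).
  by apply: ccontM; [exact: ccont_cst|apply: ccontM => //; exact: ccont_expi].
have -> : circint (fun t => (partial_sum a N).[polar r t] * (expi (m.+1%:R * t) * Phi t)) =
    circint (fun t => \sum_(k < N) F k t).
  apply: eq_cint => t _; rewrite horner_poly mulr_suml; apply: eq_bigr => k _.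
  rewrite /F exprMn expiX -addnS natrD mulrDl expiD; ring.
rewrite [X in nc X](segint_sum _ _ _ cF) (le_trans (nc_sum _ _ _))//.
apply: (@le_trans _ _ (\sum_(k < N) B * (nc (a k) / k.+1%:R))); last first.
  by rewrite -mulr_sumr ler_wpM2l.
apply: ler_sum => k _; rewrite segintZ; last by apply: ccontM => //; exact: ccont_expi.
rewrite Normc.normcM Normc.normcM ncX nc_real (ger0_norm r0).
have h1 := HB (k + m)%N.
have h2 : B / (k + m).+1%:R <= B / k.+1%:R.
  by rewrite ler_wpM2l// lef_pV2 ?posrE ?ltr0n// ler_nat ltnS leq_addr.
rewrite mulrCA; apply: ler_pM; rewrite ?mulr_ge0 ?nc_ge0 ?exprn_ge0//.
  by rewrite ler_piMr ?nc_ge0// exprn_ile1// ltW.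
exact: le_trans h1 h2.
Qed.

End PowerSeries.

(** * Distance to a subset of the circle *)

Section Distance.
Variable R : realType.
Local Notation C := R[i].
Local Notation nc := (@Normc.normc R).
Variable E : set (circle R).
Hypothesis E0 : E !=set0.
Implicit Types (z w : C) (e : circle R).

Lemma nc_circle e : nc (sval e) = 1.
Proof.
have := svalP e; rewrite inE /unit_circle /= normc_abs => h.
exact: (complexI h).
Qed.

Definition dist z := inf [set nc (z - sval e) | e in E].

Let dist_lb z : has_lbound [set nc (z - sval e) | e in E].
Proof. by exists 0 => _ [e _ <-]; exact: nc_ge0. Qed.

Let dist_ne z : [set nc (z - sval e) | e in E] !=set0.
Proof. by case: E0 => e Ee; exists (nc (z - sval e)); exists e. Qed.

Lemma dist_le z e : E e -> dist z <= nc (z - sval e).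
Proof. by move=> Ee; apply: ge_inf => //; exists e. Qed.

Lemma dist_ge z (a : R) : (forall e, E e -> a <= nc (z - sval e)) -> a <= dist z.
Proof. by move=> H; apply: lb_le_inf => // _ [e Ee <-]; exact: H. Qed.

Lemma dist_ge0 z : 0 <= dist z.
Proof. by apply: dist_ge => e _; exact: nc_ge0. Qed.

Lemma dist_lt z (a : R) : dist z < a -> exists2 e, E e & nc (z - sval e) < a.
Proof. by move=> /(inf_lt (dist_ne z))[_ [e Ee <-]]; exists e. Qed.

Lemma dist_lip z w : dist z <= dist w + nc (z - w).
Proof.
rewrite -lerBlDr; apply: dist_ge => e Ee; rewrite lerBlDr.
by rewrite (le_trans (dist_le z Ee))// [leRHS]addrC nc_tri.
Qed.

Lemma dist_ge1 z : 1 - nc z <= dist z.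
Proof.
by apply: dist_ge => e _; rewrite ncB (le_trans _ (nc_rev _ _))// nc_circle.
Qed.

Lemma dist_le2 z : nc z <= 1 -> dist z <= 2.
Proof.
move=> z1; case: E0 => e Ee; rewrite (le_trans (dist_le z Ee))//.
by rewrite (le_trans (ncBD _ _))// nc_circle; lra.
Qed.

Lemma dist_gt0 (x : circle R) : closed E -> ~ E x -> 0 < dist (sval x).
Proof.
move=> cE nEx.
have oE : open (~` E) by rewrite openC.
move: oE; rewrite openE => /(_ x nEx); rewrite /interior /=.
rewrite nbhsE => -[U [[V oV VU] Ux] UE].
have Vx : V (sval x) by move: Ux; rewrite -VU.
move: oV; rewrite openE => /(_ _ Vx); rewrite /interior /= => /nbhs_ballP[[r r'] /=].
rewrite ltcE /= => /andP[/eqP r'0 r0] rV.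
apply: (lt_le_trans r0); apply: dist_ge => e Ee; rewrite leNgt; apply/negP => lt.
apply: (UE e) => //; rewrite -VU /=; apply: rV.
rewrite /ball /= normc_abs r'0; rewrite -[X in _ < X]/(r%:C%C).
by rewrite ltcR.
Qed.

Lemma dist_cis_cont : continuous (fun t : R => dist (expi t)).
Proof.
move=> t; apply/cvgrPdist_le => e e0.
have e2 : 0 < e / 2 by rewrite divr_gt0.
near=> s.
have st : `|t - s| <= e / 2 by near: s; apply: cvgr_dist_le.
have h := nc_expiB t s.
have := dist_lip (expi t) (expi s); have := dist_lip (expi s) (expi t); rewrite (ncB (expi s)).
by rewrite ler_norml => h1 h2; apply/andP; split; lra.
Unshelve. all: by end_near. Qed.

End Distance.

(** * Collars of a Beurling-Carleson set *)

Section CarlesonSum.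
Variable R : realType.
Local Notation C := R[i].
Local Notation nc := (@Normc.normc R).
Local Notation leb := (@lebesgue_measure R).
Variable E : set (circle R).
Hypotheses (E0 : E !=set0) (BC : Beurling_Carleson E).
Local Notation I2pi := (`[0, 2 * pi[%classic : set R).

(** A set of angles rather than of points of the circle, to have Lebesgue
    measure on the line at hand. *)
Definition collar (j : nat) : set R := I2pi `&` [set t | dist E (expi t) < (1 / 2) ^+ j].

Lemma leb_mono (A B : set R) : measurable A -> measurable B -> A `<=` B ->
  (leb A <= leb B)%E.
Proof. by move=> mA mB AB; apply: le_measure; rewrite ?inE. Qed.

Lemma measurable_collar j : measurable (collar j).
Proof.
apply: measurableI => //; apply: open_measurable.
rewrite (_ : [set t | _] = (fun t => dist E (expi t)) @^-1` [set x | x < (1 / 2) ^+ j])//.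
by apply: open_comp => [t _|]; [exact: dist_cis_cont|exact: open_lt].
Qed.

Lemma circle_lebesgueE (A : set (circle R)) :
  circle_lebesgue A = leb ((@cis R @^-1` A) `&` I2pi).
Proof. by []. Qed.

(** The minimum is L for about [ln (1 / L)] values of j and is then dominated
    by a geometric series that starts at about L. The multiple of L also
    absorbs the negative logarithm when L exceeds 1; lengths of arcs are at
    most 2 pi, hence below 8. *)
Lemma sum_min_geometric_le (L c : R) : 0 <= L -> L <= 8 -> 1 <= c -> forall J,
  \sum_(0 <= j < J) Num.min L (c * (1 / 2) ^+ j) <= (20 + 2 * c) * L + 2 * (L * ln (1 / L)).
Proof.
move=> L0 L8 c1 J; have c20 : 0 <= 2 * c by lra.
set y := ln (1 / L).
have geo n m : \sum_(n <= j < n + m) c * (1 / 2) ^+ j <= 2 * c * (1 / 2) ^+ n.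
  have -> : \sum_(n <= j < n + m) c * (1 / 2) ^+ j =
      2 * c * (1 / 2) ^+ n - 2 * c * (1 / 2) ^+ (n + m).
    elim: m => [|m IH]; first by rewrite addn0 big_geq// subrr.
    by rewrite addnS big_nat_recr ?leq_addr//= IH exprS; field.
  by rewrite gerBl !mulr_ge0 ?exprn_ge0//; lra.
have split n : \sum_(0 <= j < J) Num.min L (c * (1 / 2) ^+ j) <= n%:R * L + 2 * c * (1 / 2) ^+ n.
  have m0 j : 0 <= Num.min L (c * (1 / 2) ^+ j).
    by rewrite le_min L0 mulr_ge0 ?exprn_ge0//; lra.
  apply: (@le_trans _ _ (\sum_(0 <= j < n + J) Num.min L (c * (1 / 2) ^+ j))).
    by rewrite [leRHS](big_cat_nat (n := J))//= ?leq_addl// lerDl sumr_ge0.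
  rewrite (big_cat_nat (n := n))//= ?leq_addr//; apply: lerD.
    apply: (@le_trans _ _ (\sum_(0 <= j < n) L)).
      by apply: ler_sum => j _; rewrite ge_min lexx.
    by rewrite sumr_const_nat subn0 mulr_natl.
  apply: le_trans (geo n J); apply: ler_sum => j _.
  by rewrite ge_min lexx orbT.
move: L0; rewrite le_eqVlt => /predU1P[L0|L0].
  rewrite -L0 mulr0 mul0r mulr0 addr0 big1// => j _.
  by apply: min_idPl; rewrite mulr_ge0 ?exprn_ge0//; lra.
have yE : expR y = 1 / L by rewrite lnK// posrE divr_gt0.
have LV : L * (1 / L) = 1 by rewrite mulrC divfK// gt_eqF.
have [y0|y0] := leP 0 y.
  pose n := (Num.truncn (2 * y)).+1.
  have n1 : 2 * y <= n%:R by exact: ltW (truncnS_gt _).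
  have n2 : n%:R <= 2 * y + 1.
    have : (Num.truncn (2 * y))%:R <= 2 * y by rewrite truncn_le ?mulr_ge0.
    by rewrite /n -natr1; lra.
  (* because e^(1/2) <= 2, n >= 2 ln (1 / L) halvings lead below L *)
  have pn : (1 / 2) ^+ n <= L.
    have e2 : expR (1 / 2) <= 2 :> R.
      have := @expR_quad R (1 / 2); rewrite ger0_norm//.
      by move=> /(_ (lexx _)); rewrite ler_norml => /andP[_]; lra.
    have h : 1 / L <= 2 ^+ n.
      rewrite -yE (@le_trans _ _ (expR (1 / 2) ^+ n))//; last first.
        by rewrite lerXn2r ?nnegrE ?expR_ge0.
      rewrite -expRM_natl ler_expR; lra.
    rewrite expr_div_n expr1n ler_pdivrMr ?exprn_gt0//.
    by have := ler_wpM2l (ltW L0) h; rewrite LV.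
  rewrite (le_trans (split n))//.
  have h1 : n%:R * L <= (2 * y + 1) * L by rewrite ler_pM2r.
  have h2 : 2 * c * (1 / 2) ^+ n <= 2 * c * L by rewrite ler_wpM2l.
  move: h1 h2 (ltW L0); clear.
  by move: (n%:R * L) (2 * c * (1 / 2) ^+ n) => u v h1 h2 h3; lra.
rewrite (le_trans (split 0%N))// mul0r add0r expr0 mulr1 {split geo}.
have L1 : 1 <= L.
  rewrite leNgt; apply/negP => L1; move: y0; apply/negP; rewrite -leNgt.
  by rewrite ln_ge0// ler_pdivlMr// mul1r ltW.
have h := expR_ge1Dx (- y); rewrite expRN yE div1r invrK in h.
nra.
Qed.

(** Points at distance at most rho from [e^{is}] have an argument within 2 rho
    of s modulo 2 pi, and for angles in [0, 2 pi) and |s - pi| <= pi three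
    intervals of length 4 rho cover the possibilities. *)
Lemma near_point_measure (w : C) (rho : R) : nc w = 1 -> 0 <= rho ->
  exists B : set R, [/\ measurable B, I2pi `&` [set t | nc (expi t - w) <= rho] `<=` B &
    (leb B <= (12 * rho)%:E)%E].
Proof.
move=> w1 r0; have [s [s1 ->]] := @unit_expi R w pi w1.
pose J (c : R) := `[c - 2 * rho, c + 2 * rho]%classic.
have mJ c : (leb (J c) = (4 * rho)%:E)%E.
  rewrite /J lebesgue_measure_itv/= lte_fin; case: ltP => h.
    by rewrite -EFinB; congr EFin; lra.
  by congr EFin; lra.
exists (J s `|` J (s + 2 * pi) `|` J (s - 2 * pi)); split.
- by do 2?apply: measurableU; exact: measurable_itv.
- move=> t [t2 tr]; have /andP[t0 t1] : 0 <= t < 2 * pi by move: t2; rewrite /= in_itv.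
  have {}tr : nc (expi t - expi s) <= rho by exact: tr.
  have pi0 := pi_gt0 R; move: s1; rewrite ler_norml => /andP[s1 s2].
  have near (c : R) : expi c = expi s -> `|t - c| <= pi -> J c t.
    move=> cs tc; have := nc_expi_lb tc; rewrite cs => h.
    have : `|t - c| <= 2 * rho by lra.
    by rewrite /J /= in_itv/= ler_distl.
  have [h1|h1] := leP (t - s) (- pi).
    right; apply: near; first by rewrite -[in RHS](subrK (2 * pi) s) expiD2pi.
    by rewrite ler_norml; apply/andP; split; lra.
  have [h2|h2] := leP (t - s) pi.
    by left; left; apply: near => //; rewrite ler_norml; apply/andP; split; lra.
  left; right; apply: near; first by rewrite expiD2pi.
  by rewrite ler_norml; apply/andP; split; lra.
- have h1 : (leb (J s `|` J (s + 2 * pi)%R `|` J (s - 2 * pi)%R) <=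
     leb (J s `|` J (s + 2 * pi)%R) + leb (J (s - 2 * pi)%R))%E.
    by apply: measureU2; do ?apply: measurableU; exact: measurable_itv.
  have h2 : (leb (J s `|` J (s + 2 * pi)%R) <= leb (J s) + leb (J (s + 2 * pi)%R))%E.
    by apply: measureU2; exact: measurable_itv.
  apply: (le_trans h1); rewrite mJ; apply: (le_trans (leeD2r _ h2)).
  by rewrite !mJ -!EFinD lee_fin; lra.
Qed.

Lemma measurable_cis_arc (I : set (circle R)) : open_arc I -> measurable (@cis R @^-1` I).
Proof.
move=> [a [b ->]]; apply: open_measurable; rewrite openE => t /= [u].
rewrite in_itv/= => /andP[au ub] ut.
have m0 : 0 < Num.min (u - a) (b - u) by rewrite lt_min; apply/andP; split; lra.
rewrite /interior /=; near=> s => /=; exists (u + (s - t)).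
  have : `|t - s| < Num.min (u - a) (b - u) by near: s; apply: cvgr_dist_lt.
  rewrite lt_min !ltr_norml in_itv/= => /andP[/andP[? ?] /andP[? ?]].
  by apply/andP; split; lra.
apply: val_inj; change (expi (u + (s - t)) = expi s).
have {}ut : expi u = expi t by rewrite /expi ut.
by rewrite expiD ut -expiD addrC subrK.
Unshelve. all: by end_near. Qed.

(** Inside an arc that avoids E, a point close to E is close to an end point,
    since the way to E leads out of the arc. The bound is 96 = 2 * 12 * 4: two
    end points, and [near_point_measure] for the radius [4 * 2^-j]. *)
Lemma collar_arc_measure (I : set (circle R)) j : open_arc I -> I `<=` ~` E ->
  (leb (collar j `&` @cis R @^-1` I) <= (96 * (1 / 2) ^+ j)%:E)%E.
Proof.
move=> oI IE; have mI := measurable_cis_arc oI; move: oI => [a [b Iab]].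
have r0 : 0 <= 4 * (1 / 2) ^+ j :> R by rewrite mulr_ge0 ?exprn_ge0.
have [A [mA subA lA]] := near_point_measure (nc_expi a) r0.
have [B [mB subB lB]] := near_point_measure (nc_expi b) r0.
have sub : collar j `&` @cis R @^-1` I `<=` A `|` B.
  move=> t [[t2 /= /(dist_lt E0)[e Ee eh]] It].
  have [u] : exists2 u, a < u < b & expi u = expi t.
    move: It; rewrite /= Iab => -[u]; rewrite /= in_itv/= => uab ut.
    by exists u => //; rewrite /expi ut.
  move=> /andP[au ub] ut.
  have [s [su es]] := @unit_expi R (sval e) u (nc_circle e).
  have nI : ~ (a < s < b).
    move=> sab; apply: (IE (cis s)); last first.
      by rewrite (_ : cis s = e)//; apply: val_inj; rewrite /= es.
    by rewrite Iab; exists s => //=; rewrite in_itv/=.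
  have h := nc_expi_lb su; rewrite -es ncB ut in h.
  have far : u - a <= 2 * (1 / 2) ^+ j \/ b - u <= 2 * (1 / 2) ^+ j.
    have [sa|sa] := leP s a.
      left; have := ler_norm (- (s - u)); rewrite normrN; lra.
    right; have sb : b <= s by rewrite leNgt; apply/negP => sb; apply: nI; rewrite sa.
    have := ler_norm (s - u); lra.
  case: far => far; [left; apply: subA; split=> //; change (nc (expi t - expi a) <= 4 * (1 / 2) ^+ j)
                  |right; apply: subB; split=> //; change (nc (expi t - expi b) <= 4 * (1 / 2) ^+ j)];
    rewrite -ut.
    by rewrite (le_trans (nc_expiB _ _))// gtr0_norm ?subr_gt0//; lra.
  by rewrite (le_trans (nc_expiB _ _))// ltr0_norm ?subr_lt0//; lra.
have mT := measurable_collar j.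
apply: (@le_trans _ _ (leb (A `|` B))).
  by apply: leb_mono => //; [exact: measurableI|exact: measurableU].
apply: (le_trans (measureU2 leb mA mB)).
apply: (le_trans (leeD lA lB)); rewrite -EFinD lee_fin; lra.
Qed.

Lemma leb_I2pi : leb I2pi = (2 * pi)%:E.
Proof.
rewrite lebesgue_measure_itv/= lte_fin mulr_gt0 ?pi_gt0//.
by rewrite sube0.
Qed.

(** Up to the null set E, a collar is the union of its traces on the
    complementary arcs; a trace is bounded both by the length of the arc and
    by [collar_arc_measure]. After exchanging the sums, [sum_min_geometric_le]
    leaves the total length and the sum in Carleson's condition. *)
Lemma Carleson_sum_bounded : exists K : R, forall J,
  (\sum_(0 <= j < J) leb (collar j) <= K%:E)%E.
Proof.
have [cE lE [I [oI tI EI sI]]] := BC.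
have IE n : I n `<=` ~` E by rewrite EI => x Ix; exists n.
have mI n := measurable_cis_arc (oI n).
pose S n := @cis R @^-1` (I n) `&` I2pi.
have mS n : measurable (S n) by apply: measurableI.
have tS : trivIset setT S.
  apply/trivIsetP => i j _ _ ij; apply/seteqP; split => // t [[h1 _] [h2 _]].
  have /trivIsetP/(_ i j Logic.I Logic.I ij)/seteqP[/(_ (cis t))] := tI.
  by move=> /(_ (conj h1 h2)).
pose L n := arc_length (I n).
have Sfin n : (leb (S n) <= (2 * pi)%:E)%E.
  by rewrite -leb_I2pi; apply: leb_mono; [exact: mS|exact: measurable_itv|exact: subIsetr].
have LE n : leb (S n) = (L n)%:E.
  rewrite /L /arc_length circle_lebesgueE fineK//.
  by rewrite ge0_fin_numE// (le_lt_trans (Sfin n))// ltry.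
have L0 n : 0 <= L n by rewrite -lee_fin -LE.
have pi4 : pi < 4 :> R by have := pihalf_lt2 R; lra.
have L8 n : L n <= 8.
  have := Sfin n; rewrite LE lee_fin; lra.
have sumL N : \sum_(0 <= n < N) L n <= 2 * pi.
  rewrite -lee_fin -sumEFin; under eq_bigr do rewrite -LE.
  rewrite -leb_I2pi big_mkord -measure_bigsetU//.
  apply: leb_mono; [exact: bigsetU_measurable|exact: measurable_itv|].
  by rewrite -bigcup_mkord; apply: bigcup_sub => n _; exact: subIsetr.
have [M HM] : exists M : R, forall N, \sum_(0 <= n < N) (L n * ln (1 / L n)) <= M.
  have [M [_ HM]] := cvg_seq_bounded sI.
  by exists (M + 1) => N; rewrite (le_trans (ler_norm _))//; apply: HM => //; rewrite ltrDl.
pose c : R := 96.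
have Tn j : (leb (collar j) <= \sum_(0 <= n <oo) (Num.min (L n) (c * (1 / 2) ^+ j))%:E)%E.
  pose Z := @cis R @^-1` E `&` I2pi.
  have mZ : measurable Z.
    have -> : Z = I2pi `\` \bigcup_n S n.
      apply/seteqP; split => [t [Et t2]|t [t2 nS]].
        split => // -[n _ [In _]]; exact: (IE n (cis t)).
      split => //; apply: contrapT => nE; apply: nS.
      have : (~` E) (cis t) by [].
      by rewrite EI => -[n _ In]; exists n.
    by apply: measurableD => //; exact: bigcup_measurable.
  have Z0 : leb Z = 0%E by exact: lE.
  have mT := measurable_collar j.
  pose U n := collar j `&` @cis R @^-1` (I n).
  have mU n : measurable (U n) by exact: measurableI.
  have sub : collar j `<=` Z `|` \bigcup_n U n.
    move=> t tj; have [Et|nE] := pselect (E (cis t)); first by left; split => //; case: tj.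
    right; have : (~` E) (cis t) by [].
    by rewrite EI => -[n _ In]; exists n.
  have mB : measurable (\bigcup_n U n) by exact: bigcup_measurable.
  have h1 : (leb (collar j) <= leb Z + leb (\bigcup_n U n))%E.
    apply: le_trans (measureU2 leb mZ mB); apply: leb_mono => //.
    exact: measurableU.
  rewrite (le_trans h1)// Z0 add0e.
  have h2 : (leb (\bigcup_n U n) <= \sum_(0 <= n <oo) leb (U n))%E.
    exact: (measure_sigma_subadditive leb mU mB (@subset_refl _ _)).
  apply: (le_trans h2); apply: lee_nneseries => n _//.
  rewrite EFin_min le_min; apply/andP; split.
    by rewrite -LE; apply: leb_mono => // t [[t2 _] In]; split.
  exact: collar_arc_measure (oI n) (IE n).
exists ((20 + 2 * c) * (2 * pi) + 2 * M) => J.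
have m0 j n : (0 <= (Num.min (L n) (c * (1 / 2) ^+ j))%:E)%E.
  by rewrite lee_fin le_min L0 mulr_ge0 ?exprn_ge0.
apply: (@le_trans _ _ (\sum_(0 <= j < J) \sum_(0 <= n <oo)
    (Num.min (L n) (c * (1 / 2) ^+ j))%:E)%E).
  by apply: lee_sum => j _; exact: Tn.
rewrite -(@nneseries_sum_nat _ 0 J (fun j n => (Num.min (L n) (c * (1 / 2) ^+ j))%:E))//.
apply: lime_le; first by apply: is_cvg_nneseries => n _ _; exact: sume_ge0.
apply: nearW => N; under eq_bigr do rewrite sumEFin.
rewrite sumEFin lee_fin.
apply: (@le_trans _ _ (\sum_(0 <= n < N) ((20 + 2 * c) * L n + 2 * (L n * ln (1 / L n))))).
  by apply: ler_sum => n _; apply: sum_min_geometric_le => //; rewrite /c; lra.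
rewrite big_split /= -!mulr_sumr; apply: lerD; rewrite ler_wpM2l//.
by rewrite /c; lra.
Qed.

End CarlesonSum.

(** * An outer factor vanishing on E *)

Section OuterFactor.
Variable R : realType.
Local Notation C := R[i].
Local Notation nc := (@Normc.normc R).
Local Notation Re := (@complex.Re R).
Local Notation leb := (@lebesgue_measure R).
Variable E : set (circle R).
Hypotheses (E0 : E !=set0) (BC : Beurling_Carleson E).
Local Notation dist := (dist E).
Local Notation collar := (collar E).

(** 640 = 2 * 4 * 80: on an arc of length D / 4 the real part of the kernel is
    at least 1 / (80 D), and each collar is to contribute 2 to the real part
    of the Herglotz integral. *)
Fact outer_kappa_subproof : {k : {nonneg R} | k%:num = 640}.
Proof.
have h : 0 <= 640 :> R by exact: ler0n.
by exists (NngNum h).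
Qed.

Definition outer_kappa : {nonneg R} := sval outer_kappa_subproof.

Definition outer_piece (j : nat) : {measure set _ -> \bar R} :=
  mrestr (mscale outer_kappa leb) (measurable_collar E0 j).

(** At a point e^{it} the density is 640 times the number of collars of index
    at least J that contain it, which is about [log (1 / dist)] for small
    distances. *)
Definition outer_measure (J : nat) : {measure set _ -> \bar R} := mseries outer_piece J.

Lemma outer_pieceE j A : outer_piece j A = (outer_kappa%:num%:E * leb (A `&` collar j))%E.
Proof. by []. Qed.

Let kappa : R := outer_kappa%:num.

Let kappaE : kappa = 640. Proof. exact: svalP outer_kappa_subproof. Qed.

Let kappa_gt0 : 0 < kappa. Proof. by rewrite kappaE; lra. Qed.

Lemma outer_total_fin J : (outer_measure J setT < +oo)%E.
Proof.
have [K HK] := Carleson_sum_bounded E0 BC.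
apply: (@le_lt_trans _ _ (kappa * K)%:E); last exact: ltry.
apply: lime_le; first by apply: is_cvg_nneseries => j _ _; exact: measure_ge0.
apply: nearW => N; apply: (@le_trans _ _ (\sum_(0 <= j < N) outer_piece j setT)%E).
  have [JN|NJ] := leqP J N; last by rewrite big_geq ?(ltnW NJ)//; exact: sume_ge0.
  by rewrite [leRHS](big_cat_nat (n := J))//= leeDr// sume_ge0.
under eq_bigr do rewrite outer_pieceE setTI.
by rewrite -ge0_sume_distrr// EFinM -/kappa lee_pmul2l// lte_fin.
Qed.

(** The total mass is a tail of a convergent series. *)
Lemma outer_total_small (e : R) : 0 < e -> exists J, fine (outer_measure J setT) <= e.
Proof.
move=> e0.
have cv : outer_measure N setT @[N --> \oo] --> 0%E.
  apply: (@nneseries_tail_cvg R (fun j => outer_piece j setT) xpredT (outer_total_fin 0)).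
  by move=> k _; exact: measure_ge0.
have /fine_cvgP[fin /cvgrPdist_le/(_ _ e0)[J _ HJ]] := cv.
exists J; have := HJ J (leqnn J); rewrite sub0r normrN => h.
exact: le_trans (ler_norm _) h.
Qed.

(** The pole is e^{it} pushed outwards, by about a quarter of the distance of
    e^{it} to E. The resulting function is as smooth near a point of the disc
    as the distance of that point to E permits. *)
Definition outer_node t : C := (1 - dist (expi t) / 4)%:C%C * (expi t)^*%C.

Let rho t : R := 1 - dist (expi t) / 4.

Let rho01 t : 0 <= rho t <= 1.
Proof.
have := dist_le2 E0 (_ : nc (expi t) <= 1); rewrite nc_expi lexx => /(_ isT) h.
by have := dist_ge0 E0 (expi t); rewrite /rho => h0; apply/andP; split; lra.
Qed.

Lemma nc_outer_node t : nc (outer_node t) = rho t.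
Proof.
have /andP[r0 _] := rho01 t.
by rewrite Normc.normcM nc_conj nc_expi mulr1 nc_real ger0_norm.
Qed.

Lemma outer_node_le1 t : nc (outer_node t) <= 1.
Proof. by rewrite nc_outer_node; have /andP[] := rho01 t. Qed.

Lemma outer_node_meas : @cmeasurable _ _ R [set: measurableTypeR R] outer_node.
Proof.
have [h1 h2] : ccont outer_node.
  apply: ccontM; last by apply: ccont_conj; exact: ccont_expi1.
  split => t; last exact: cvg_cst.
  by apply: cvgB; [exact: cvg_cst|apply: cvgMl; exact: dist_cis_cont].
by split; exact: continuous_measurable_fun.
Qed.

Lemma outer_node_den t (z : C) : nc (1 - outer_node t * z) = nc (expi t - (rho t)%:C%C * z).
Proof.
have ee : expi t * (expi t)^*%C = 1 by rewrite mulr_conj nc_expi expr1n.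
have -> : expi t - (rho t)%:C%C * z = expi t * (1 - outer_node t * z).
  rewrite mulrBr mulr1 /outer_node -/(rho t); congr (_ - _).
  by rewrite -(mulrA (_%:C%C)) mulrCA (mulrA (expi t)) ee mul1r.
by rewrite Normc.normcM nc_expi mul1r.
Qed.

(** With [X] the denominator and [d] the distance of [e^{it}] to E, one has [d
    / 4 <= X] because the pole is off the circle, hence [|z - e^{it}| <= X + d
    / 4 <= 2 X] and [dist z <= 2 X + d <= 6 X]. *)
Lemma dist_outer_node t (z : C) : nc z < 1 -> dist z <= 6 * nc (1 - outer_node t * z).
Proof.
move=> z1; rewrite outer_node_den; set X := nc _.
have /andP[r0 r1] := rho01 t.
have nz : nc ((rho t)%:C%C * z) = rho t * nc z by rewrite Normc.normcM nc_real ger0_norm.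
have X1 : 1 - rho t <= X.
  have := nc_rev (expi t) ((rho t)%:C%C * z); rewrite nc_expi nz -/X.
  have : rho t * nc z <= rho t by rewrite ler_piMr// ltW.
  lra.
have h1 := dist_lip E0 z (expi t).
have h2 : nc (z - expi t) <= X + (1 - rho t).
  rewrite ncB; have -> : expi t - z = (expi t - (rho t)%:C%C * z) + (rho t - 1)%:C%C * z.
    by rewrite real_complexB1; ring.
  rewrite (le_trans (ncD _ _))// lerD2l Normc.normcM nc_real distrC ger0_norm ?subr_ge0//.
  by rewrite ler_piMr ?subr_ge0// ltW.
have h3 : dist (expi t) = 4 * (1 - rho t) by rewrite /rho; field.
lra.
Qed.

(** The real part is [(1 - |k z|^2) / |1 - k z|^2]. The numerator is at least
    D / 16 because [1 - r] and the shift of the pole cannot both be small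
    compared with D, and the denominator is at most [(17 D / 8)^2] because t
    is close to t0. *)
Lemma Re_outer_ge (r t0 t : R) : 0 <= r < 1 -> `|t - t0| <= dist (polar r t0) / 4 ->
  1 / (80 * dist (polar r t0)) <= Re (hkernel (outer_node t) (polar r t0)) /\
  dist (expi t) <= 5 / 2 * dist (polar r t0).
Proof.
move=> /andP[r0 r1]; set z := polar r t0; set D := dist z => tt.
have nz : nc z = r by rewrite nc_polar.
have D1 : 1 - r <= D by rewrite -nz; exact: dist_ge1.
have D0 : 0 < D by lra.
have e0z : nc (expi t0 - z) = 1 - r.
  rewrite /z /polar -{1}[expi t0]mul1r -mulrBl Normc.normcM nc_expi mulr1.
  by rewrite -(rmorph1 (real_complex R)) -rmorphB nc_real ger0_norm// subr_ge0 ltW.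
have ez : nc (expi t - z) <= D / 2 + (1 - r).
  rewrite (le_trans (nc_tri _ (expi t0) _))// e0z lerD2r (le_trans (nc_expiB _ _))//; lra.
have d1 := dist_lip E0 (expi t) z; have d2 := dist_lip E0 z (expi t).
rewrite (ncB z) -/D in d2; rewrite -/D in d1; split; last lra.
have z1 : nc z < 1 by rewrite nz.
have /andP[p0 p1] := rho01 t.
have rE : dist (expi t) = 4 * (1 - rho t) by rewrite /rho; field.
rewrite Re_hkernel ?outer_node_le1// outer_node_den Normc.normcM nc_outer_node nz.
set X := nc (expi t - _).
have X2 : X <= 17 / 8 * D.
  have -> : X = nc ((expi t - z) + (1 - rho t)%:C%C * z).
    by rewrite /X; congr nc; rewrite real_complex1B; ring.
  rewrite (le_trans (ncD _ _))// Normc.normcM nc_real ger0_norm ?subr_ge0// nz.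
  have : (1 - rho t) * r <= 1 - rho t by rewrite ler_piMr ?subr_ge0// ltW.
  lra.
have X0 : 0 < X.
  rewrite /X -outer_node_den lt_def nc_ge0 andbT nc_eq0.
  exact: hkernel_den (outer_node_le1 _) z1.
have pr0 : 0 <= rho t * r by rewrite mulr_ge0.
have pr1 : rho t * r <= rho t by rewrite ler_piMr// ltW.
have pr2 : rho t * r <= r by rewrite ler_piMl.
have num : D / 16 <= 1 - (rho t * r) ^+ 2.
  have : (rho t * r) ^+ 2 <= rho t * r by rewrite expr2 ler_piMr//; lra.
  lra.
rewrite ler_pdivlMr ?exprn_gt0// (le_trans _ num)//.
have XX : X ^+ 2 <= (17 / 8 * D) ^+ 2 by rewrite lerXn2r ?nnegrE ?(ltW X0)//; lra.
rewrite mulrAC ler_pdivrMr ?mulr_gt0// mul1r (le_trans XX)//.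
rewrite exprMn; have : 0 <= D ^+ 2 by rewrite sqr_ge0.
have -> : D / 16 * (80 * D) = 5 * D ^+ 2 by field.
lra.
Qed.

Definition outer J := inner (outer_measure J) setT outer_node.

(** An arc of length D / 4 next to t0 lies in all collars of index at most n,
    and by the choice of the constant each of them contributes 2. *)
Lemma outer_herglotz_ge J n (r t0 : R) : 0 <= r < 1 -> 0 <= t0 <= 2 * pi -> (J <= n)%N ->
  5 / 2 * dist (polar r t0) < (1 / 2) ^+ n ->
  2 * (n.+1 - J)%:R <= Re (herglotz (outer_measure J) setT outer_node (polar r t0)).
Proof.
move=> r01 /andP[t0a t0b] Jn; set D := dist (polar r t0) => Dn.
have /andP[r0 r1] := r01.
have z1 : nc (polar r t0) < 1 by rewrite nc_polar.
have D0 : 0 < D by have := dist_ge1 E0 (polar r t0); rewrite nc_polar// -/D; lra.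
have D2 : D <= 2 by apply: dist_le2 => //; exact: ltW.
have pi2 := pi_ge2 R.
(* the arc extends to the right of t0, or to the left if it would leave [0, 2
   pi] *)
have [a [a0 a1 a2]] : exists a, [/\ 0 <= a, a + D / 4 <= 2 * pi &
    forall t, a <= t < a + D / 4 -> `|t - t0| <= D / 4].
  have [h|h] := leP (t0 + D / 4) (2 * pi).
    exists t0; split => // t /andP[h1 h2]; rewrite ger0_norm; lra.
  exists (t0 - D / 4); split; [lra|lra|] => t /andP[h1 h2].
  by rewrite ler_norml; apply/andP; split; lra.
pose B := `[a, a + D / 4[%classic : set (measurableTypeR R).
have mB : measurable B by exact: measurable_itv.
have lB : leb B = (D / 4)%:E.
  rewrite /B lebesgue_measure_itv/= lte_fin ltrDl divr_gt0//.
  by rewrite -EFinB addrAC subrr add0r.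
have inB t : B t -> a <= t < a + D / 4 by rewrite /B /= in_itv.
have sub j : (j <= n)%N -> B `&` collar j = B.
  move=> jn; apply/setIidl => t Bt; have /andP[h1 h2] := inB _ Bt; split.
    by rewrite /= in_itv/=; apply/andP; split; lra.
  have [_ h3] := Re_outer_ge r01 (a2 _ (inB _ Bt)).
  apply: (@le_lt_trans _ _ (5 / 2 * D)) => //; apply: (lt_le_trans Dn).
  by rewrite ler_wiXn2l//; lra.
have mBge : ((kappa * (n.+1 - J)%:R * (D / 4))%:E <= outer_measure J B)%E.
  have -> : (kappa * (n.+1 - J)%:R * (D / 4))%:E = (\sum_(J <= j < n.+1) outer_piece j B)%E.
    rewrite (eq_big_nat _ _ (F2 := fun=> (kappa * (D / 4))%:E)); last first.
      by move=> j /andP[_ jn]; rewrite outer_pieceE sub// lB.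
    rewrite sumEFin sumr_const_nat -mulr_natl; congr EFin; ring.
  by apply: nneseries_lim_ge => j _ _; exact: measure_ge0.
have fB : (outer_measure J B < +oo)%E.
  by apply: le_lt_trans (outer_total_fin J); apply: le_measure; rewrite ?inE.
have H := @Re_herglotz_ge _ _ R (outer_measure J) setT outer_node measurableT
  (outer_total_fin J) outer_node_meas outer_node_le1 B (polar r t0) (1 / (80 * D)) mB
  (@subsetT _ _) z1 ltac:(by rewrite divr_ge0// mulr_ge0// ltW)
  (fun t Bt => proj1 (Re_outer_ge r01 (a2 _ (inB _ Bt)))).
apply: le_trans H.
rewrite mulrAC mul1r ler_pdivlMr ?mulr_gt0//.
apply: (@le_trans _ _ (kappa * (n.+1 - J)%:R * (D / 4))).
  by rewrite kappaE; lra.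
by rewrite -lee_fin fineK// ge0_fin_numE.
Qed.

(** If n is the number of collars that reach the point, then F is at most
    [e^(- 2 (n - J))], while 2^-n is comparable with the distance to E and
    [e^-2 <= 2^-2]. *)
Lemma outer_small J : exists2 c : R, 0 <= c & forall r t, 0 <= r < 1 -> 0 <= t <= 2 * pi ->
  nc (outer J (polar r t)) <= c * dist (polar r t) ^+ 2.
Proof.
have c0 : 0 <= 7 * 4 ^+ J * expR (2 * J%:R) :> R by rewrite !mulr_ge0 ?exprn_ge0 ?expR_ge0.
exists (7 * 4 ^+ J * expR (2 * J%:R)) => // r t r01 t01.
have /andP[r0 r1] := r01.
have z1 : nc (polar r t) < 1 by rewrite nc_polar.
set D := dist (polar r t).
have D0 : 0 < D by have := dist_ge1 E0 (polar r t); rewrite nc_polar// -/D; lra.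
have nF1 : nc (outer J (polar r t)) <= 1.
  by apply: nc_inner_le1 => //; exact: outer_node_le1.
have eJ : 1 <= expR (2 * J%:R) :> R by rewrite -expR0 ler_expR mulr_ge0.
have p4 n : (4 : R) ^+ n = 2 ^+ n ^+ 2 by rewrite -exprM mulnC exprM; congr (_ ^+ n); ring.
have ph n : (2 : R) ^+ n * (1 / 2) ^+ n = 1.
  by rewrite -exprMn (_ : 2 * (1 / 2) = 1) ?expr1n//; field.
have [n Hn Hmin] : exists2 n, (1 / 2) ^+ n <= 5 / 2 * D &
    forall m, (m < n)%N -> 5 / 2 * D < (1 / 2) ^+ m.
  have ex : exists n, (1 / 2) ^+ n <= 5 / 2 * D.
    have [||n Hn] := @exprn_small R (1 / 2) (5 / 2 * D); [lra|lra|by exists n.+1].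
  exists (ex_minn ex); case: ex_minnP => // n hn nmin m mn.
  by rewrite ltNge; apply/negP => /nmin; rewrite leqNgt mn.
have [nJ|Jn] := leqP n J.
  apply: (le_trans nF1).
  have h : 1 <= 2 ^+ J * (5 / 2 * D).
    rewrite -[X in X <= _](ph J) ler_wpM2l ?exprn_ge0//; apply: le_trans Hn.
    by rewrite ler_wiXn2l//; lra.
  have h2 : 1 <= 4 ^+ J * (25 / 4 * D ^+ 2).
    have -> : 4 ^+ J * (25 / 4 * D ^+ 2) = (2 ^+ J * (5 / 2 * D)) ^+ 2 by rewrite p4; field.
    by rewrite exprn_ege1.
  have : 4 ^+ J * (25 / 4 * D ^+ 2) * 1 <= 4 ^+ J * (25 / 4 * D ^+ 2) * expR (2 * J%:R).
    by apply: ler_wpM2l => //; lra.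
  have : 0 <= 4 ^+ J * D ^+ 2 * expR (2 * J%:R) by rewrite !mulr_ge0 ?exprn_ge0 ?expR_ge0// ltW.
  lra.
case: n Hn Hmin Jn => // n Hn Hmin Jn.
have H := outer_herglotz_ge r01 t01 (Jn : (J <= n)%N) (Hmin n (ltnSn n)).
rewrite nc_inner.
have e2 : expR (- 2%:R) <= (1 / 2) ^+ 2 :> R.
  have -> : - 2%:R = 2%:R * -1 :> R by ring.
  rewrite expRM_natl lerXn2r ?nnegrE ?expR_ge0// expRN.
  by rewrite div1r lef_pV2 ?posrE ?expR_gt0//; have := @expR_ge1Dx R 1; lra.
apply: (@le_trans _ _ (expR (2 * J%:R) * ((1 / 2) ^+ n.+1) ^+ 2)).
  apply: (@le_trans _ _ (expR (2 * J%:R) * expR (n.+1%:R * - 2%:R))).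
    rewrite -expRD ler_expR.
    move: H; rewrite natrB; last exact: ltnW.
    by lra.
  rewrite ler_wpM2l ?expR_ge0// expRM_natl -exprM mulnC exprM.
  by rewrite lerXn2r ?nnegrE ?expR_ge0 ?exprn_ge0.
have h1 : ((1 / 2) ^+ n.+1) ^+ 2 <= (5 / 2 * D) ^+ 2.
  by rewrite lerXn2r ?nnegrE ?exprn_ge0//; lra.
have h4 : 1 <= 4 ^+ J :> R by rewrite exprn_ege1//; lra.
have D20 : 0 <= D ^+ 2 by rewrite sqr_ge0.
apply: (@le_trans _ _ (expR (2 * J%:R) * (7 * D ^+ 2))).
  rewrite ler_wpM2l ?expR_ge0//; apply: (le_trans h1).
  by rewrite exprMn; lra.
have : expR (2 * J%:R) * (7 * D ^+ 2) * 1 <= expR (2 * J%:R) * (7 * D ^+ 2) * 4 ^+ J.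
  by apply: ler_wpM2l => //; rewrite mulr_ge0 ?expR_ge0// mulr_ge0.
lra.
Qed.

End OuterFactor.

(** * Lipschitz bound for an outer factor times a conjugate inner function *)

Section LipschitzProduct.
Context d1 d2 (T1 : measurableType d1) (T2 : measurableType d2) (R : realType).
Local Notation C := R[i].
Local Notation nc := (@Normc.normc R).
Variables (m1 : {measure set T1 -> \bar R}) (D1 : set T1) (k1 : T1 -> C).
Variables (m2 : {measure set T2 -> \bar R}) (D2 : set T2) (k2 : T2 -> C).
Hypotheses (mD1 : measurable D1) (fD1 : (m1 D1 < +oo)%E).
Hypotheses (mk1 : cmeasurable D1 k1) (k1le : forall x, nc (k1 x) <= 1).
Hypotheses (mD2 : measurable D2) (fD2 : (m2 D2 < +oo)%E).
Hypotheses (mk2 : cmeasurable D2 k2) (k2le : forall x, nc (k2 x) <= 1).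
Variable E : set (circle R).
Hypothesis E0 : E !=set0.
Local Notation dist := (dist E).
Hypothesis den1 : forall x z, D1 x -> nc z < 1 -> dist z <= 6 * nc (1 - k1 x * z).
Hypothesis den2 : forall x z, D2 x -> nc z < 1 -> dist z <= 6 * nc (1 - k2 x * z).
Local Notation F := (inner m1 D1 k1).
Local Notation th := (inner m2 D2 k2).

(** The Herglotz integrals in the exponents have derivatives O(dist^-2), which
    the zero of second order of F makes up for. In finite differences, the
    exponents at z and w differ by O(|z - w| / (dist z * dist w)), and this is
    good enough if the two distances are comparable. Otherwise |z - w| is at
    least half the larger distance, and the size of F alone gives the bound. *)
Lemma inner_product_lipschitz (c : R) (Z : set C) : 0 <= c ->
  (forall z, Z z -> nc z < 1) -> (forall z, Z z -> nc (F z) <= c * dist z ^+ 2) ->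
  exists2 L : R, 0 <= L & forall z w, Z z -> Z w ->
    nc (F z * (th z)^*%C - F w * (th w)^*%C) <= L * nc (z - w).
Proof.
move=> c0 Z1 HF.
set M1 := fine (m1 D1); set M2 := fine (m2 D2).
have M10 : 0 <= M1 by rewrite fine_ge0.
have M20 : 0 <= M2 by rewrite fine_ge0.
pose B := 144 * (M1 + M2).
have B0 : 0 <= B by rewrite mulr_ge0 ?addr_ge0.
exists (8 * c + 6 * c * B); first by apply: addr_ge0; apply: mulr_ge0 => //; rewrite mulr_ge0.
pose A z := - herglotz m1 D1 k1 z + (- herglotz m2 D2 k2 z)^*%C.
have PE z : F z * (th z)^*%C = expC (A z) by rewrite expCD -conj_expC.
have Pn z : nc z < 1 -> nc (expC (A z)) <= nc (F z).
  move=> z1; rewrite -PE Normc.normcM nc_conj ler_piMr ?nc_ge0//.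
  by apply: nc_inner_le1.
(* z is the point farther from E *)
move=> z w; wlog dd : z w / dist w <= dist z => [H|] Zz Zw.
  case: (leP (dist w) (dist z)) => [/H h|/ltW/H h]; [exact: h|].
  by rewrite [X in X <= _]ncB (ncB z w); exact: h.
have z1 := Z1 _ Zz; have w1 := Z1 _ Zw.
have dw0 : 0 < dist w by have := dist_ge1 E0 w; lra.
have dz0 : 0 < dist z by lra.
have dz2 : dist z <= 2 by apply: dist_le2 => //; exact: ltW.
have lip := dist_lip E0 z w.
have N0 : 0 <= nc (z - w) by exact: nc_ge0.
set dz := dist z in dd dz0 dz2 lip *; set dw := dist w in dd dw0 lip.
set N := nc (z - w) in lip N0 *.
have Mz : nc (expC (A z)) <= c * dz ^+ 2 by rewrite (le_trans (Pn _ z1))// HF.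
have Mw : nc (expC (A w)) <= c * dz ^+ 2.
  rewrite (le_trans (Pn _ w1))// (le_trans (HF _ Zw))// ler_wpM2l//.
  by rewrite lerXn2r ?nnegrE// ltW.
rewrite !PE.
have [small|big] := leP dw (dz / 2).
  have dN : dz <= 2 * N by lra.
  have h : c * dz ^+ 2 <= 4 * c * N.
    have h1 : dz ^+ 2 <= 4 * N by rewrite expr2; nra.
    have := ler_wpM2l c0 h1; lra.
  have h0 : 0 <= c * N by rewrite mulr_ge0.
  have h2 : 0 <= 6 * c * B * N by do 2?apply: mulr_ge0 => //; rewrite mulr_ge0.
  rewrite (le_trans (ncBD _ _))//; lra.
have AA : nc (A z - A w) <= B * N / (dz * dw).
  have -> : A z - A w = (herglotz m1 D1 k1 w - herglotz m1 D1 k1 z) +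
      (herglotz m2 D2 k2 w - herglotz m2 D2 k2 z)^*%C.
    by apply: complex_eq; rewrite /A !(cReD, cReN, cRe_conj, cImD, cImN, cIm_conj); ring.
  have lb1 (z' : C) : nc z' < 1 -> forall x, D1 x -> dist z' / 6 <= nc (1 - k1 x * z').
    by move=> z'1 x Dx; have := den1 Dx z'1; lra.
  have lb2 (z' : C) : nc z' < 1 -> forall x, D2 x -> dist z' / 6 <= nc (1 - k2 x * z').
    by move=> z'1 x Dx; have := den2 Dx z'1; lra.
  have p1 : 0 < dz / 6 by lra.
  have p2 : 0 < dw / 6 by lra.
  have h1 := nc_herglotz_diff mD1 fD1 mk1 k1le w1 z1 p2 p1 (lb1 _ w1) (lb1 _ z1).
  have h2 := nc_herglotz_diff mD2 fD2 mk2 k2le w1 z1 p2 p1 (lb2 _ w1) (lb2 _ z1).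
  rewrite (le_trans (ncD _ _))// nc_conj (le_trans (lerD h1 h2))//.
  rewrite (ncB w z) -/N -/M1 -/M2 le_eqVlt; apply/orP; left; apply/eqP.
  by rewrite /B; field; rewrite !lt0r_neq0.
have H := expC_lip Mz Mw.
apply: (le_trans H).
have cz : 0 <= 3 * (c * dz ^+ 2) by apply: mulr_ge0 => //; apply: mulr_ge0 => //; exact: sqr_ge0.
apply: (le_trans (ler_wpM2l cz AA)).
have -> : 3 * (c * dz ^+ 2) * (B * N / (dz * dw)) = (3 * c * B * N) * (dz / dw).
  by field; rewrite !lt0r_neq0.
have q2 : dz / dw <= 2 by rewrite ler_pdivrMr//; lra.
have P0 : 0 <= 3 * c * B * N by do 2?apply: mulr_ge0 => //; rewrite mulr_ge0.
have := ler_wpM2l P0 q2.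
have : 0 <= 8 * c * N by rewrite !mulr_ge0.
lra.
Qed.

End LipschitzProduct.

(** * Singular inner functions of restricted measures *)

Section RestrictedInner.
Variable R : realType.
Local Notation C := R[i].
Local Notation nc := (@Normc.normc R).
Local Notation Re := (@complex.Re R).
Local Notation leb := (@lebesgue_measure R).
Variable mu : {finite_measure set (circle R) -> \bar R}.
Implicit Types (D E : set (circle R)) (z : C).

Definition circle_node (x : circle R) : C := (sval x)^*%C.

Lemma circle_node_le1 x : nc (circle_node x) <= 1.
Proof. by rewrite nc_conj nc_circle. Qed.

Lemma circle_nodeK x : sval x * circle_node x = 1.
Proof. by rewrite mulr_conj nc_circle expr1n. Qed.

(** The measurable subsets of the circle are generated by its open sets, and
    the two parts of the conjugate are 1-Lipschitz functions of the point. *)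
Lemma circle_node_meas D : measurable D -> cmeasurable D circle_node.
Proof.
move=> mD.
have mopen (h : circle R -> R) : (forall V : set R, open V -> open (h @^-1` V)) ->
    measurable_fun D h.
  move=> H; apply: (@measurable_funS _ _ _ _ setT) => //.
  apply: (measurability _ (RGenOpens.measurableE R)) => // _ [_ [a [b ->] <-]].
  by rewrite setTI; apply: sub_sigma_algebra; apply: H; exact: interval_open.
have cont (h : C -> R) : (forall z w, `|h z - h w| <= nc (z - w)) ->
    forall V : set R, open V -> open ((fun x : circle R => h (sval x)) @^-1` V).
  move=> hl V oV.
  exists ((h : C^o -> R) @^-1` V) => //.
  rewrite openE => z Vz; move: oV; rewrite openE => /(_ _ Vz); rewrite /interior /=.
  move=> /nbhs_ballP[e e0 eV]; apply/nbhs_ballP; exists e%:C%C; first by rewrite /= ltcR.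
  move=> w; rewrite /ball /= normc_abs ltcR => zw; apply: eV.
  exact: le_lt_trans (hl _ _) zw.
split; apply: mopen => V oV.
  apply: (cont (fun z => Re z^*%C)) => // z w.
  by rewrite -cReN -cReD -rmorphB (le_trans (ler_Re _))// nc_conj.
apply: (cont (fun z => complex.Im z^*%C)) => // z w.
by rewrite -cImN -cImD -rmorphB (le_trans (ler_Im _))// nc_conj.
Qed.

Lemma mu_lty D : measurable D -> (mu D < +oo)%E.
Proof. by move=> mD; rewrite ltey_eq fin_num_measure. Qed.

Definition inner_on D := inner mu D circle_node.

Lemma singular_innerE z : nc z < 1 -> singular_inner mu z = inner_on setT z.
Proof.
move=> z1; congr (expC (- _)).
have kE x : (sval x + z) / (sval x - z) = hkernel (circle_node x) z.
  have xx := circle_nodeK x.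
  have d0 := hkernel_den (circle_node_le1 x) z1.
  have x0 : sval x != 0 by rewrite -nc_eq0 nc_circle oner_eq0.
  rewrite /hkernel -[LHS]/((sval x + z) / (sval x - z)).
  have -> : sval x + z = sval x * (1 + circle_node x * z).
    by rewrite mulrDr mulr1 mulrA xx mul1r.
  have -> : sval x - z = sval x * (1 - circle_node x * z).
    by rewrite mulrBr mulr1 mulrA xx mul1r.
  by rewrite -mulf_div divff// mul1r.
by apply: complex_eq => /=; apply: eq_Rintegral => x _; rewrite kE.
Qed.

Lemma inner_on_split E z : measurable E -> nc z < 1 ->
  inner_on setT z = inner_on E z * inner_on (~` E) z.
Proof.
move=> mE z1; rewrite /inner_on /inner -expCD -opprD; congr (expC (- _)).
have mC : measurable (~` E) by exact: measurableC.
have [i1 i2] := cintegrable_hkernel (@measurableT _ _) (mu_lty measurableT)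
  (circle_node_meas measurableT) circle_node_le1 z1.
have dj : [disjoint E & ~` E].
  by apply/disj_setPS => x [Ex nEx].
rewrite -(setvU E) setUC in i1 i2 *.
by apply: complex_eq => /=; apply: Rintegral_setU.
Qed.

Lemma circle_node_den x z : nc (1 - circle_node x * z) = nc (z - sval x).
Proof.
have -> : z - sval x = - (sval x * (1 - circle_node x * z)).
  by rewrite mulrBr mulr1 mulrA circle_nodeK mul1r opprB.
by rewrite normcN Normc.normcM nc_circle mul1r.
Qed.

Lemma dist_circle_node E x z : E !=set0 -> E x -> nc z < 1 ->
  dist E z <= 6 * nc (1 - circle_node x * z).
Proof.
move=> E0 Ex z1; have h := dist_le z Ex.
by rewrite circle_node_den; have := nc_ge0 (z - sval x); lra.
Qed.

(** * Radial limits off a closed null set *)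

Section Radial.
Variable E : set (circle R).
Hypotheses (E0 : E !=set0) (cE : closed E) (lE : circle_lebesgue E = 0%E).

Lemma measurable_closed : measurable E.
Proof.
rewrite -(setCK E); apply: measurableC; apply: sub_sigma_algebra.
exact: closed_openC.
Qed.

Let mE := measurable_closed.
Local Notation th := (inner_on E).

Lemma inner_on_le1 D z : nc z < 1 -> nc (inner_on D z) <= 1.
Proof. by move=> z1; apply: nc_inner_le1 => //; exact: circle_node_le1. Qed.

Lemma poly_approx_inner_on D r : measurable D -> 0 <= r < 1 -> poly_approx r (inner_on D).
Proof.
move=> mD r01; apply: poly_approx_inner => //.
- exact: mu_lty.
- exact: circle_node_meas.
- exact: circle_node_le1.
Qed.

Definition gap r t : R := 1 - nc (th (polar r t)) ^+ 2.

Lemma gap01 r t : 0 <= r < 1 -> 0 <= gap r t <= 1.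
Proof.
move=> /andP[r0 r1]; have n1 : nc (polar r t) < 1 by rewrite nc_polar.
have := inner_on_le1 E n1 => h; rewrite /gap.
have : nc (th (polar r t)) ^+ 2 <= 1 by rewrite exprn_ile1 ?nc_ge0.
have : 0 <= nc (th (polar r t)) ^+ 2 by rewrite exprn_ge0 ?nc_ge0.
by move=> h1 h2; apply/andP; split; lra.
Qed.

Lemma gap_cont r : 0 <= r < 1 -> continuous (gap r).
Proof.
move=> r01; have /andP[r0 r1] := r01.
have cth := ccont_poly_approx r0 (poly_approx_inner_on mE r01).
have -> : gap r = (fun t => 1 - nc (th (polar r t)) * nc (th (polar r t))).
  by apply/funext => t; rewrite /gap expr2.
move=> t; apply: cvgB; first exact: cvg_cst.
by apply: cvgM; exact: continuous_nc.
Qed.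

(** The real part of the kernel is at most 2 (1 - r) over the squared distance
    from the pole, and [1 - e^(- 2 x) <= 2 x]. *)
Lemma gap_le r t : 0 <= r < 1 -> 1 - r < dist E (expi t) ->
  gap r t <= 4 * fine (mu E) / (dist E (expi t) - (1 - r)) ^+ 2 * (1 - r).
Proof.
move=> r01 far; have /andP[r0 r1] := r01.
set z := polar r t; have nz : nc z = r by rewrite nc_polar.
have z1 : nc z < 1 by rewrite nz.
set D := dist E (expi t) - (1 - r); have D0 : 0 < D by rewrite subr_gt0.
have Dz x : E x -> D <= nc (1 - circle_node x * z).
  move=> Ex; rewrite circle_node_den.
  apply: le_trans (dist_le z Ex); rewrite /D lerBlDr.
  have := dist_lip E0 (expi t) z.
  have -> : nc (expi t - z) = 1 - r; last by [].
  rewrite /z /polar -{1}[expi t]mul1r -mulrBl Normc.normcM nc_expi mulr1.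
  by rewrite -real_complex1B nc_real ger0_norm// subr_ge0 ltW.
have H : Re (herglotz mu E circle_node z) <= 2 * (1 - r) / D ^+ 2 * fine (mu E).
  apply: Re_herglotz_le => //; first exact: mu_lty.
  - exact: circle_node_meas.
  - exact: circle_node_le1.
  move=> x Ex; rewrite Re_hkernel ?circle_node_le1//.
  have nx : nc (circle_node x * z) = r by rewrite Normc.normcM nc_conj nc_circle mul1r.
  have h := Dz x Ex; have X0 : 0 < nc (1 - circle_node x * z) by exact: lt_le_trans h.
  rewrite nx; apply: ler_pM.
  - by rewrite subr_ge0 exprn_ile1// ltW.
  - by rewrite invr_ge0 exprn_ge0 ?nc_ge0.
  - by nra.
  rewrite lef_pV2 ?posrE ?exprn_gt0//.
  by rewrite lerXn2r ?nnegrE// ltW.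
rewrite /gap nc_inner -expRM_natl.
have := expR_ge1Dx (2%:R * - Re (herglotz mu E circle_node z)).
rewrite -/z => h1.
have -> : 4 * fine (mu E) / D ^+ 2 * (1 - r) = 2 * (2 * (1 - r) / D ^+ 2 * fine (mu E)) by ring.
lra.
Qed.

(** By [gap_le] the gap tends to 0 at each point off the null set E, and it is
    bounded by 1: dominated convergence. *)
Lemma gap_small (e rho : R) : 0 < e -> 0 <= rho < 1 ->
  exists r, [/\ rho <= r, r < 1 & \int[leb]_(t in `[0, 2 * pi]) gap r t <= e].
Proof.
move=> e0 /andP[rho0 rho1].
pose r n : R := 1 - n.+1%:R^-1.
have r01 n : 0 <= r n < 1.
  rewrite /r; apply/andP; split; last by rewrite gtrDl oppr_lt0 invr_gt0.
  by rewrite subr_ge0 invf_le1 ?ler1n.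
have /cvgrPdist_le h0 := @cvg_harmonic R.
have rE n : 1 - r n = n.+1%:R^-1 by rewrite /r opprB addrC subrK.
(* circle_lebesgue is defined on [0, 2 pi), so the point 2 pi is added by
   hand *)
pose N : set R := (@cis R @^-1` E `&` `[0, 2 * pi[) `|` [set 2 * pi].
have mS : measurable (@cis R @^-1` E `&` `[0, 2 * pi[%classic).
  apply: measurableI => //; rewrite -(setCK E) preimage_setC; apply: measurableC.
  apply: open_measurable; rewrite openE => t /= nEt.
  have dt : 0 < dist E (expi t) by apply: dist_gt0.
  have := dist_cis_cont E0; move=> /(_ t)/cvgrPdist_lt/(_ _ dt).
  rewrite /interior; apply: filterS => s /= h Es.
  have : dist E (expi s) <= 0.
    by rewrite (le_trans (dist_le (expi s) Es))// /expi subrr Normc.normc0.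
  move: h; have := ler_norm (dist E (expi t) - dist E (expi s)); lra.
have N0 : leb.-negligible N.
  apply: negligibleU.
    by exists (@cis R @^-1` E `&` `[0, 2 * pi[%classic); split => //; exact: lE.
  exists [set 2 * pi]; split; [exact: measurable_set1|exact: lebesgue_measure_set1|by []].
have ptw t : `[0, 2 * pi]%classic t -> ~ N t -> (gap (r n) t)%:E @[n --> \oo] --> (0 : R)%:E.
  rewrite /= in_itv/= => /andP[t0 t1] nN.
  have nE : ~ E (cis t).
    move=> Et; apply: nN; have [->|ne] := eqVneq t (2 * pi); first by right.
    by left; split => //=; rewrite in_itv/= t0 lt_neqAle ne.
  have d0 : 0 < dist E (expi t) by apply: dist_gt0.
  set d := dist E (expi t) in d0 *.
  apply/cvg_EFin; first exact: nearW.
  apply/cvgrPdist_le => e' e'0.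
  have M0 : 0 <= fine (mu E) by rewrite fine_ge0.
  pose K := 4 * fine (mu E) / (d / 2) ^+ 2.
  have K0 : 0 <= K by rewrite divr_ge0 ?sqr_ge0// mulr_ge0.
  have a1 : 0 < Num.min (d / 2) (e' / (K + 1)).
    by rewrite lt_min !divr_gt0// ltr_wpDl.
  have := h0 _ a1; apply: filterS => n.
  rewrite sub0r normrN /harmonic ger0_norm ?invr_ge0// le_min => /andP[n1 n2].
  have {}n1 : 1 - r n <= d / 2 by rewrite rE.
  have {}n2 : 1 - r n <= e' / (K + 1) by rewrite rE.
  have /andP[g0 g1] := gap01 t (r01 n); have /andP[_ rn1] := r01 n.
  rewrite sub0r normrN /= ger0_norm//.
  have far : 1 - r n < dist E (expi t) by rewrite -/d; lra.
  rewrite (le_trans (gap_le (r01 n) far))// -/d.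
  apply: (@le_trans _ _ (K * (e' / (K + 1)))).
    apply: ler_pM => //; first by rewrite divr_ge0 ?sqr_ge0// mulr_ge0.
      lra.
    rewrite /K ler_wpM2l ?mulr_ge0// lef_pV2 ?posrE ?exprn_gt0//; [|lra|lra].
    by rewrite lerXn2r ?nnegrE//; lra.
  rewrite mulrCA ler_piMr ?(ltW e'0)// ler_pdivrMr ?ltr_wpDl//; lra.
have mI : measurable (`[0, 2 * pi]%classic : set (measurableTypeR R)) by exact: measurable_itv.
have mgap n : measurable_fun `[0, 2 * pi]%classic (fun t => (gap (r n) t)%:E).
  apply/measurable_EFinP; apply: measurable_funTS.
  exact: continuous_measurable_fun (gap_cont (r01 n)).
have i1 : leb.-integrable `[0, 2 * pi] (EFin \o (fun=> 1)).
  exact: (@continuous_integrable_seg R 0 (2 * pi) (fun=> 1) (fun t => cvg_cst _)).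
have [_ _ cv] := @dominated_convergence _ _ R leb `[0, 2 * pi]%classic mI
  (fun n t => (gap (r n) t)%:E) (fun=> 0%E) (fun=> 1%E) mgap
  ltac:(exact: measurable_cst)
  ltac:(case: N0 => B [mB B0 NB]; exists B; split => // t /= H; apply: NB;
        apply: contrapT => nN; apply: H => tI; exact: ptw)
  i1
  ltac:(apply: aeW => t n tI /=; rewrite lee_fin ger0_norm;
        have /andP[] := gap01 t (r01 n) => //).
rewrite integral0 in cv.
have /fine_cvgP[_ /cvgrPdist_le/(_ _ e0)] := cv.
have r1p : 0 < 1 - rho by rewrite subr_gt0.
have := h0 _ r1p; move=> hA hB.
have [n [hn1 hn2]] : exists n, `|0 - @harmonic R n| <= 1 - rho /\
    `|0 - fine (\int[leb]_(t in `[0%R, (2 * pi)%R]) (gap (r n) t)%:E)| <= e.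
  have : \forall n \near \oo, `|0 - @harmonic R n| <= 1 - rho /\
    `|0 - fine (\int[leb]_(t in `[0%R, (2 * pi)%R]) (gap (r n) t)%:E)| <= e.
    by apply: filterS2 hA hB.
  by move=> [n _ Hn]; exists n; apply: Hn => /=.
exists (r n); split.
- have hE : @harmonic R n = 1 - r n by rewrite rE.
  by move: hn1; rewrite sub0r normrN => h1; have := ler_norm (@harmonic R n); lra.
- by have /andP[] := r01 n.
- by move: hn2; rewrite sub0r normrN => /(le_trans (ler_norm _)).
Qed.

End Radial.
End RestrictedInner.

(** * The annihilating functions and the conclusion *)

Section Annihilator.
Variable R : realType.
Local Notation C := R[i].
Local Notation nc := (@Normc.normc R).
Local Notation Re := (@complex.Re R).
Local Notation leb := (@lebesgue_measure R).
Variable mu : {finite_measure set (circle R) -> \bar R}.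
Variable E : set (circle R).
Hypotheses (E0 : E !=set0) (BC : Beurling_Carleson E).
Let cE : closed E. Proof. by case: BC. Qed.
Let lE : circle_lebesgue E = 0%E. Proof. by case: BC. Qed.
Let mE : measurable E. Proof. exact: measurable_closed. Qed.
Let mCE : measurable (~` E). Proof. exact: measurableC. Qed.
Local Notation th := (inner_on mu E).
Local Notation F := (outer E0).
Implicit Types (r s t e : R).

Lemma poly_approx_outer J r : 0 <= r < 1 -> poly_approx r (F J).
Proof.
move=> r01; apply: poly_approx_inner => //.
- exact: outer_total_fin.
- exact: outer_node_meas.
- exact: outer_node_le1.
Qed.

Lemma outer_le1 J (z : C) : nc z < 1 -> nc (F J z) <= 1.
Proof. by move=> z1; apply: nc_inner_le1 => //; exact: outer_node_le1. Qed.

Definition Phi J r t : C := F J (polar r t) * (th (polar r t))^*%C.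

Lemma inner_on_cont r : 0 <= r < 1 -> ccont (fun t => th (polar r t)).
Proof.
by move=> r01; apply: ccont_poly_approx; [case/andP: r01|exact: poly_approx_inner_on].
Qed.

Lemma outer_cont J r : 0 <= r < 1 -> ccont (fun t => F J (polar r t)).
Proof.
by move=> r01; apply: ccont_poly_approx; [case/andP: r01|exact: poly_approx_outer].
Qed.

Lemma Phi_cont J r : 0 <= r < 1 -> ccont (Phi J r).
Proof.
by move=> r01; apply: ccontM; [exact: outer_cont|apply: ccont_conj; exact: inner_on_cont].
Qed.

Let polar_lt1 r t : 0 <= r < 1 -> nc (polar r t) < 1.
Proof. by move=> /andP[r0 r1]; rewrite nc_polar. Qed.

Lemma Phi_le1 J r t : 0 <= r < 1 -> nc (Phi J r t) <= 1.
Proof.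
move=> r01; rewrite Normc.normcM nc_conj mulr_ile1 ?nc_ge0//.
  by apply: outer_le1; exact: polar_lt1.
by apply: inner_on_le1; exact: polar_lt1.
Qed.

(** The bound does not depend on r, which lets r tend to 1 for a fixed
    function in l^p_A. *)
Lemma Phi_fourier J : exists2 B : R, 0 <= B & forall r k, 0 <= r < 1 ->
  nc (circint (fun t => expi (k.+1%:R * t) * Phi J r t)) <= B / k.+1%:R.
Proof.
have [c c0 Fc] := outer_small E0 BC J.
pose Z : set C := [set z | exists r t, [/\ 0 <= r < 1, 0 <= t <= 2 * pi & z = polar r t]].
have Z1 z : Z z -> nc z < 1 by move=> [r [t [r01 _ ->]]]; exact: polar_lt1.
have FZ z : Z z -> nc (F J z) <= c * dist E z ^+ 2.
  by move=> [r [t [r01 t01 ->]]]; exact: Fc.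
have [L L0 HL] := inner_product_lipschitz (@measurableT _ _) (outer_total_fin E0 BC J)
  (outer_node_meas E0) (outer_node_le1 E0) mE (mu_lty mu mE) (circle_node_meas mE)
  (@circle_node_le1 R) E0 (fun x z _ => @dist_outer_node R E E0 x z)
  (fun x z => @dist_circle_node R E x z E0) c0 Z1 FZ.
have L2 : 0 <= 2 * L by rewrite mulr_ge0.
exists (8 * pi ^+ 2 * (2 * L)); first by do 2?apply: mulr_ge0 => //; exact: sqr_ge0.
move=> r k r01; apply: fourier_lipschitz; first exact: Phi_cont.
move=> s t s01 t01; have /andP[r0 r1] := r01.
apply: (le_trans (HL (polar r s) (polar r t) _ _)); [by exists r, s|by exists r, t|].
rewrite nc_polarB// (mulrC 2 L) -mulrA ler_wpM2l//.
have h := nc_expiB s t; apply: le_trans h.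
by rewrite ler_piMl ?nc_ge0// ltW.
Qed.

Variable p : R.
Hypotheses (p1 : 1 < p) (cyc : cyclic_lpA p (singular_inner mu)).

(** Let [g = P S_mu - 1] with P from the definition of cyclicity, small in
    l^p_A. The pairing with 1 is the pairing with [P S_mu] minus the pairing
    with g; the second is small by duality. In the first, conj(theta) theta is
    1 minus the gap; the part with 1 vanishes by Cauchy's theorem, and the
    part with the gap is bounded by a multiple of its integral. *)
Lemma cyclic_annihilates J m e : 0 < e -> exists2 eta : R, 0 < eta &
  forall r, 0 <= r < 1 -> \int[leb]_(t in `[0, 2 * pi]) gap mu E r t <= eta ->
    nc (circint (fun t => expi (m.+1%:R * t) * Phi J r t)) <= e.
Proof.
move=> e0; have [[af _] [P cvP]] := cyc.
have [B B0 HB] := Phi_fourier J.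
have e1 : 0 < e / (2 * (B + 1)) by rewrite divr_gt0// mulr_gt0// ltr_wpDl.
have [c c0 Hc] := lp_harmonic_small p1 e1.
have [n Hn] := lp_norm_small (lt_trans ltr01 p1) c0 cvP.
pose g (z : C) := (P n).[z] * singular_inner mu z - 1.
have ag : analytic_on_disc g.
  by apply: analyticD; [exact: analytic_poly|exact: analytic_cst].
have Ha := taylor_coefP ag.
have [M M0 PM] := poly_bounded (P n) (ler01 : 0 <= 1).
exists (e / (4 * (M + 1))); first by rewrite divr_gt0// mulr_gt0// ltr_wpDl.
move=> r r01 Hgap; have /andP[r0 r1] := r01.
have cexpi : ccont (fun t => expi (m.+1%:R * t) : C) by exact: ccont_expi.
have cPhi := Phi_cont J r01.
have cg : ccont (fun t => g (polar r t)).
  by apply: ccont_poly_approx => //; exact: poly_approx_power_series Ha r01.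
pose G (z : C) := (P n).[z] * inner_on mu (~` E) z * F J z.
have PG : poly_approx r G.
  apply: poly_approxM => //; last exact: poly_approx_outer.
  apply: poly_approxM => //; last exact: poly_approx_inner_on.
  exact: poly_approx_poly.
have cG : ccont (fun t => G (polar r t)) by exact: ccont_poly_approx.
have cth := inner_on_cont r01.
have cgap : ccont (fun t => (gap mu E r t)%:C%C).
  by split; [exact: gap_cont|move=> t; exact: cvg_cst].
have E1 : circint (fun t => expi (m.+1%:R * t) * Phi J r t) =
    - circint (fun t => (expi (m.+1%:R * t) * G (polar r t)) * (gap mu E r t)%:C%C)
    - circint (fun t => g (polar r t) * (expi (m.+1%:R * t) * Phi J r t)).
  have H0 : circint (fun t => expi (m.+1%:R * t) * G (polar r t)) = 0.
    exact: circint_expi_approx.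
  rewrite -[X in X - _]add0r -{1}H0 -segintB; last 2 first.
  - exact: ccontM.
  - by apply: ccontM => //; exact: ccontM.
  rewrite -segintB; last 2 first.
  - by apply: ccontB; [exact: ccontM|apply: ccontM => //; exact: ccontM].
  - by apply: ccontM => //; exact: ccontM.
  apply: eq_cint => t _; have z1 := polar_lt1 t r01.
  rewrite /g singular_innerE// (inner_on_split _ mE z1) /Phi /G /gap.
  rewrite real_complex1B -mulr_conj.
  by move: (expi _) (_.[_]) (inner_on _ _ _) (inner_on _ _ _) (F J _) (_^*%C) => *; ring.
rewrite E1 -opprD normcN (le_trans (ncD _ _))//.
have h1 : nc (circint (fun t => g (polar r t) * (expi (m.+1%:R * t) * Phi J r t))) <= e / 2.
  apply: (@le_trans _ _ (B * (e / (2 * (B + 1))))).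
    apply: (@power_series_pairing R g (taylor_coef g) r m (Phi J r) B _ Ha r01 cPhi) => //.
    - by move=> t; exact: Phi_le1.
    - by move=> k; exact: HB.
    - by move=> N; apply: (Hc (fun k => nc (taylor_coef g k))) => // k; exact: nc_ge0.
  have B1 : 0 < B + 1 by rewrite ltr_wpDl.
  rewrite mulrA ler_pdivrMr ?mulr_gt0//.
  have : 0 <= e * B by rewrite mulr_ge0// ltW.
  by have := e0; lra.
have h2 : nc (circint (fun t => (expi (m.+1%:R * t) * G (polar r t)) * (gap mu E r t)%:C%C)) <= e / 2.
  have ig : leb.-integrable `[0, 2 * pi] (EFin \o gap mu E r).
    by apply: continuous_integrable_seg; exact: gap_cont.
  have igM : leb.-integrable `[0, 2 * pi] (EFin \o (fun t => M * gap mu E r t)).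
    by apply: integrableZlF.
  have := @nc_cint_le _ _ R leb `[0, 2 * pi]%classic (measurable_itv _)
    (fun t => (expi (m.+1%:R * t) * G (polar r t)) * (gap mu E r t)%:C%C) (fun t => M * gap mu E r t).
  move=> /(_ ltac:(by apply: ccont_integrable; apply: ccontM => //; exact: ccontM) igM).
  rewrite RintegralZl//; move=> H.
  apply: (le_trans (H _)).
    move=> t _; have z1 := polar_lt1 t r01; have /andP[g0 _] := gap01 mu E t r01.
    rewrite Normc.normcM nc_real (ger0_norm g0) ler_wpM2r//.
    rewrite Normc.normcM nc_expi mul1r /G Normc.normcM Normc.normcM.
    have f1 := outer_le1 J z1; have s1 := inner_on_le1 mu (~` E) z1.
    have P1 : nc (P n).[polar r t] <= M by apply: PM; exact: ltW.
    rewrite -[leRHS]mulr1; apply: ler_pM; rewrite ?mulr_ge0 ?nc_ge0//.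
    by rewrite -[leRHS]mulr1; apply: ler_pM; rewrite ?nc_ge0.
  have M1 : 0 < M + 1 by rewrite ltr_wpDl.
  apply: (@le_trans _ _ (2 * (M * (e / (4 * (M + 1)))))).
    by rewrite ler_pM2l// ler_wpM2l.
  rewrite !mulrA ler_pdivrMr ?mulr_gt0//.
  have : 0 <= M * e by rewrite mulr_ge0// ltW.
  by have := e0; lra.
lra.
Qed.

(** On each circle the mean of Re F is [F 0 = exp (- mass)], close to 1 for
    large J. As |F| is at most 1, [|1 - F|^2 <= 2 - 2 Re F], so F is close to
    1 in mean square. *)
Lemma outer_near1 e : 0 < e -> exists J, forall r, 0 <= r < 1 ->
  \int[leb]_(t in `[0, 2 * pi]) nc (1 - F J (polar r t)) <= e.
Proof.
move=> e0; have pi0 := pi_gt0 R; have pi4 : pi < 4 :> R by have := pihalf_lt2 R; lra.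
pose tau := e / 16; have tau0 : 0 < tau by rewrite divr_gt0.
have tau2 : 0 < tau ^+ 2 by rewrite exprn_gt0.
have [J Jt] := outer_total_small E0 BC tau2.
exists J => r r01; have /andP[r0 r1] := r01.
have cF := outer_cont J r01; have [cF1 cF2] := cF.
have c1F : ccont (fun t => 1 - F J (polar r t)) by apply: ccontB => //; exact: ccont_cst.
have iF : leb.-integrable `[0, 2 * pi] (EFin \o (fun t => Re (F J (polar r t)))).
  exact: continuous_integrable_seg.
have Imean : \int[leb]_(t in `[0, 2 * pi]) Re (F J (polar r t)) = 2 * pi * Re (F J 0).
  have := circint_mean r0 (poly_approx_outer J r01) => /(congr1 Re).
  by rewrite mulrC cReMr mulrC.
have F0 : Re (F J 0) = expR (- fine (outer_measure E0 J setT)).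
  by rewrite /outer inner0.
(* |1 - F| <= tau / 2 + |1 - F|^2 / (2 tau), the arithmetic-geometric mean
   inequality *)
pose h t := tau / 2 + tau^-1 * (1 - Re (F J (polar r t))).
have ih : leb.-integrable `[0, 2 * pi] (EFin \o h).
  apply: continuous_integrable_seg => t; apply: cvgD; first exact: cvg_cst.
  by apply: cvgMr; apply: cvgB; [exact: cvg_cst|exact: cF1].
have in1 : leb.-integrable `[0, 2 * pi] (EFin \o (fun t => nc (1 - F J (polar r t)))).
  by apply: continuous_integrable_seg; exact: continuous_nc.
have le_h t : nc (1 - F J (polar r t)) <= h t.
  have f1 := outer_le1 J (polar_lt1 t r01).
  set w := F J (polar r t) in f1 *.
  have q : nc (1 - w) ^+ 2 <= 2 - 2 * Re w.
    have : nc w ^+ 2 <= 1 by rewrite exprn_ile1 ?nc_ge0.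
    rewrite !nc_sqr cReD cImD cReN cImN /=; lra.
  have N0 := nc_ge0 (1 - w); rewrite /h -/w.
  set N := nc (1 - w) in q N0 *.
  have -> : tau / 2 + tau^-1 * (1 - Re w) = (tau ^+ 2 + (2 - 2 * Re w)) / (2 * tau).
    by field; rewrite gt_eqF.
  rewrite ler_pdivlMr ?mulr_gt0//.
  have : 0 <= (N - tau) ^+ 2 by rewrite sqr_ge0.
  rewrite sqrrB; lra.
apply: (@le_trans _ _ (\int[leb]_(t in `[0, 2 * pi]) h t)).
  by apply: le_Rintegral => // t _; exact: le_h.
have mI : fine (leb `[0, 2 * pi]%classic) = 2 * pi.
  by rewrite lebesgue_measure_itv/= lte_fin mulr_gt0//= oppr0 addr0.
have -> : \int[leb]_(t in `[0, 2 * pi]) h t =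
    (tau / 2 + tau^-1) * (2 * pi) - tau^-1 * (2 * pi * Re (F J 0)).
  have -> : h = (fun t => (tau / 2 + tau^-1) - tau^-1 * Re (F J (polar r t))).
    by apply/funext => t; rewrite /h; ring.
  rewrite RintegralB//; last 2 first.
  - by apply: continuous_integrable_seg => t; exact: cvg_cst.
  - exact: integrableZlF.
  by rewrite Rintegral_cst// mI RintegralZl// Imean.
have := expR_ge1Dx (- fine (outer_measure E0 J setT)); rewrite -F0 => h1.
have h2 : 1 - Re (F J 0) <= tau ^+ 2 by lra.
have tV : 0 < tau^-1 by rewrite invr_gt0.
have h3 : tau^-1 * (1 - Re (F J 0)) <= tau.
  have := ler_wpM2l (ltW tV) h2.
  by rewrite expr2 mulrA mulVf ?mul1r// gt_eqF.
have h4 : (tau / 2 + tau^-1 * (1 - Re (F J 0))) * (2 * pi) <= (3 / 2 * tau) * (2 * 4).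
  apply: ler_pM; [|lra|lra|lra].
  have f1 : Re (F J 0) <= 1.
    have := outer_le1 J (_ : nc (0 : C) < 1); rewrite Normc.normc0 ltr01 => /(_ isT).
    exact: le_trans (le_trans (ler_norm _) (ler_Re _)).
  apply: addr_ge0; first by rewrite divr_ge0// ltW.
  by apply: mulr_ge0; [exact: ltW|rewrite subr_ge0].
have -> : (tau / 2 + tau^-1) * (2 * pi) - tau^-1 * (2 * pi * Re (F J 0)) =
   (tau / 2 + tau^-1 * (1 - Re (F J 0))) * (2 * pi) by ring.
apply: (le_trans h4); rewrite /tau; lra.
Qed.

(** On a circle of radius s close to 1, F is replaced by 1 by means of
    [outer_near1], and then [cyclic_annihilates] applies; the coefficient at
    radius r is no larger. *)
Lemma inner_coef_eq0 m r : 0 <= r < 1 ->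
  circint (fun t => expi (m.+1%:R * t) * (th (polar r t))^*%C) = 0.
Proof.
move=> r01; have /andP[r0 r1] := r01.
apply: (@nc_small_eq0 _ _ 1) => e e0; rewrite mul1r.
have e4 : 0 < e / 4 by rewrite divr_gt0.
have e2 : 0 < e / 2 by rewrite divr_gt0.
have [J HJ] := outer_near1 e4.
have [eta eta0 Heta] := cyclic_annihilates J m e2.
have [s [rs s1 Hs]] := gap_small mu E0 cE lE eta0 r01.
have s01 : 0 <= s < 1 by rewrite s1 (le_trans r0 rs).
have /andP[s0 _] := s01.
apply: (le_trans (circint_expi_conj_le m.+1 r0 rs (poly_approx_inner_on mu mE s01))).
have cexpi : ccont (fun t => expi (m.+1%:R * t) : C) by exact: ccont_expi.
have cF := outer_cont J s01; have cth := ccont_conj (inner_on_cont s01).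
have c1F : ccont (fun t => 1 - F J (polar s t)) by apply: ccontB => //; exact: ccont_cst.
have cT : ccont (fun t => (1 - F J (polar s t)) * (expi (m.+1%:R * t) * (th (polar s t))^*%C)).
  by apply: ccontM => //; exact: ccontM.
have -> : circint (fun t => expi (m.+1%:R * t) * (th (polar s t))^*%C) =
   circint (fun t => expi (m.+1%:R * t) * Phi J s t) +
   circint (fun t => (1 - F J (polar s t)) * (expi (m.+1%:R * t) * (th (polar s t))^*%C)).
  rewrite -segintD//; last by apply: ccontM => //; exact: Phi_cont.
  by apply: eq_cint => t _; rewrite /Phi; ring.
rewrite (le_trans (ncD _ _))//.
have h1 := Heta s s01 Hs.
have h2 : nc (circint (fun t =>
    (1 - F J (polar s t)) * (expi (m.+1%:R * t) * (th (polar s t))^*%C))) <= 2 * (e / 4).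
  apply: (@le_trans _ _ (2 * \int[leb]_(t in `[0, 2 * pi]) nc (1 - F J (polar s t)))); last first.
    by rewrite ler_pM2l// HJ.
  apply: nc_cint_le => //; first exact: ccont_integrable.
    by apply: continuous_integrable_seg; exact: continuous_nc.
  move=> t _; rewrite Normc.normcM Normc.normcM nc_expi mul1r nc_conj ler_piMr ?nc_ge0//.
  by apply: inner_on_le1; exact: polar_lt1.
lra.
Qed.

(** Of the expansion of the first factor only the constant term survives, the
    conjugate of theta being orthogonal to the higher ones by
    [inner_coef_eq0]. *)
Lemma inner_mean_square r : 0 <= r < 1 ->
  circint (fun t => th (polar r t) * (th (polar r t))^*%C) = (2 * pi)%:C%C * (nc (th 0) ^+ 2)%:C%C.
Proof.
move=> r01; have /andP[r0 r1] := r01.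
have PT := poly_approx_inner_on mu mE r01.
have cth := inner_on_cont r01; have cthc := ccont_conj cth.
have mean : circint (fun t => (th (polar r t))^*%C) = ((2 * pi)%:C%C * th 0)^*%C.
  by rewrite circint_conj// circint_mean.
have polyE (q : {poly C}) : circint (fun t => q.[polar r t] * (th (polar r t))^*%C) =
    q.[0] * circint (fun t => (th (polar r t))^*%C).
  have -> : circint (fun t => q.[polar r t] * (th (polar r t))^*%C) =
     circint (fun t => \sum_(i < size q)
       (q`_i * r%:C%C ^+ i) * (expi (i%:R * t) * (th (polar r t))^*%C)).
    apply: eq_cint => t _; rewrite horner_polar mulr_suml; apply: eq_bigr => i _.
    by rewrite mulrA.
  have cT (i : nat) :
      ccont (fun t => (q`_i * r%:C%C ^+ i) * (expi (i%:R * t) * (th (polar r t))^*%C)).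
    by apply: ccontM; [exact: ccont_cst|apply: ccontM => //; exact: ccont_expi].
  rewrite [LHS](segint_sum _ _ _ cT) horner_coef0.
  have term (i : nat) : segint 0 (2 * pi)
        (fun t => (q`_i * r%:C%C ^+ i) * (expi (i%:R * t) * (th (polar r t))^*%C)) =
      if i == 0%N then q`_0 * circint (fun t => (th (polar r t))^*%C) else 0.
    rewrite segintZ; last by apply: ccontM => //; exact: ccont_expi.
    case: i => [|i] /=; last by rewrite -/(circint _) inner_coef_eq0// mulr0.
    rewrite expr0 mulr1; congr (_ * _); apply: eq_cint => t _.
    by rewrite mul0r expi0 mul1r.
  rewrite (eq_bigr _ (fun (i : 'I__) _ => term i)).
  case: (size q) (@nth_default _ 0 q 0%N) => [|n] nd.
    by rewrite big_ord0 nd// mul0r.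
  by rewrite big_ord_recl/= big1 ?addr0.
apply/eqP; rewrite -subr_eq0; apply/eqP.
apply: (@nc_small_eq0 _ _ (6 * pi)) => e e0; have [q qT] := PT _ e0.
have pi0 := pi_gt0 R.
have -> : circint (fun t => th (polar r t) * (th (polar r t))^*%C) -
     (2 * pi)%:C%C * (nc (th 0) ^+ 2)%:C%C =
   circint (fun t => (th (polar r t) - q.[polar r t]) * (th (polar r t))^*%C) +
   (q.[0] - th 0) * ((2 * pi)%:C%C * (th 0)^*%C).
  have -> : circint (fun t => (th (polar r t) - q.[polar r t]) * (th (polar r t))^*%C) =
     circint (fun t => th (polar r t) * (th (polar r t))^*%C) - q.[0] * ((2 * pi)%:C%C * (th 0)^*%C).
    have <- : circint (fun t => q.[polar r t] * (th (polar r t))^*%C) =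
        q.[0] * ((2 * pi)%:C%C * (th 0)^*%C).
      by rewrite polyE mean cconjM conjc_real.
    rewrite -segintB; [|exact: ccontM|by apply: ccontM => //; exact: ccont_poly].
    by apply: eq_cint => t _; ring.
  rewrite -mulr_conj; ring.
rewrite (le_trans (ncD _ _))//.
have n0 : nc (th 0) <= 1 by apply: inner_on_le1; rewrite Normc.normc0.
have h1 : nc (circint (fun t => (th (polar r t) - q.[polar r t]) * (th (polar r t))^*%C)) <= 4 * pi * e.
  apply: nc_circint => [|t _].
    by apply: ccontM => //; apply: ccontB => //; exact: ccont_poly.
  rewrite Normc.normcM nc_conj.
  apply: (@le_trans _ _ (nc (th (polar r t) - q.[polar r t]))).
    by apply: ler_piMr; [exact: nc_ge0|apply: inner_on_le1; exact: polar_lt1].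
  by apply: qT; rewrite nc_polar.
have h2 : nc ((q.[0] - th 0) * ((2 * pi)%:C%C * (th 0)^*%C)) <= e * (2 * pi).
  rewrite Normc.normcM Normc.normcM nc_real nc_conj gtr0_norm ?mulr_gt0//.
  apply: ler_pM; rewrite ?nc_ge0 ?mulr_ge0 ?nc_ge0 ?(ltW pi0)//.
    by rewrite ncB; apply: qT; rewrite Normc.normc0.
  by rewrite ler_piMr// mulr_ge0// ltW.
lra.
Qed.

(** The mean of the gap is [1 - exp (- 2 mu(E))] on every circle, and it tends
    to 0. *)
Lemma cyclic_Carleson_null : mu E = 0%E.
Proof.
have fE : mu E \is a fin_num by exact: fin_num_measure.
have pi0 := pi_gt0 R.
suff : fine (mu E) <= 0.
  move=> h; have : (mu E <= 0)%E by rewrite -(fineK fE) lee_fin.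
  by move=> h2; apply/eqP; rewrite eq_le h2 measure_ge0.
have th0 : nc (th 0) ^+ 2 = expR (- (2 * fine (mu E))).
  rewrite /inner_on inner0//.
  by rewrite nc_real ger0_norm ?expR_ge0// -expRM_natl; congr expR; ring.
have gapE r : 0 <= r < 1 ->
    \int[leb]_(t in `[0, 2 * pi]) gap mu E r t = 2 * pi * (1 - nc (th 0) ^+ 2).
  move=> r01; have := inner_mean_square r01 => /(congr1 Re).
  rewrite cReMr /= => H.
  have mI : fine (leb `[0, 2 * pi]%classic) = 2 * pi.
    by rewrite lebesgue_measure_itv/= lte_fin mulr_gt0//= oppr0 addr0.
  have cth := inner_on_cont r01.
  have [cn _] : ccont (fun t => th (polar r t) * (th (polar r t))^*%C).
    by apply: ccontM => //; exact: ccont_conj.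
  have -> : \int[leb]_(t in `[0, 2 * pi]) gap mu E r t =
      \int[leb]_(t in `[0, 2 * pi]) (1 - Re (th (polar r t) * (th (polar r t))^*%C)).
    by apply: eq_Rintegral => t _; rewrite mulr_conj.
  rewrite RintegralB//; last 2 first.
  - by apply: continuous_integrable_seg => t; exact: cvg_cst.
  - exact: continuous_integrable_seg.
  rewrite Rintegral_cst// mI mul1r H; ring.
have small e : 0 < e -> 2 * pi * (1 - nc (th 0) ^+ 2) <= e.
  move=> e0.
  have z01 : 0 <= (0 : R) < 1 by rewrite lexx ltr01.
  have [r [r0 r1]] := gap_small mu E0 cE lE e0 z01.
  by rewrite gapE// r0 r1.
have : 2 * pi * (1 - nc (th 0) ^+ 2) <= 0 by apply/ler_addgt0Pr => e e0; rewrite add0r small.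
rewrite pmulr_rle0 ?mulr_gt0// th0 subr_le0 -[X in X <= _]expR0 ler_expR.
by rewrite oppr_ge0 pmulr_rle0.
Qed.

End Annihilator.

Theorem theorem1p2 (R : realType)
    (mu : {finite_measure set (circle R) -> \bar R}) :
  singular_measure mu ->
  (exists2 p : R, 2 < p & cyclic_lpA p (singular_inner mu)) ->
  forall E : set (circle R), Beurling_Carleson E -> mu E = 0%E.
Proof.
move=> _ [p p2 cyc] E BC; have [->|/set0P E0] := eqVneq E set0; first exact: measure0.
have p1 : 1 < p by apply: lt_trans p2; rewrite ltr1n.
exact: cyclic_Carleson_null E0 BC p p1 cyc.
Qed.
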